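(* Let $\phi\in\mathcal{S}(\mathbb{R}^{n})$ be such that $\int_{\mathbb{R}^n}\phi(t)\,dt=1$ and let $L$ be slowly varying at the origin (resp. at infinity). Let $\mathbf{f}\in\mathcal{S}'(\mathbb{R}^{n},E)$, $\alpha\in\mathbb{R}$ and $x_0\in\mathbb{R}^n$. Then $\mathbf{f}$ is weak-asymptotically bounded of degree $\alpha$ at the point $x_0$ (resp. at infinity) with respect to $L$ in $\mathcal{S}'(\mathbb{R}^n,E)$ if and only if there exists $k\in\mathbb{N}$ such that $$\limsup_{\varepsilon\rightarrow0^+}\ \sup_{|x|^2+y^2=1,\,y>0}\frac{y^k}{\varepsilon^{\alpha}L(\varepsilon)}\left\|F_{\phi}\mathbf{f}\left(x_0+\varepsilon x,\varepsilon y\right)\right\|<\infty$$ $$\left(\text{resp. } \limsup_{\lambda\rightarrow\infty}\ \sup_{|x|^2+y^2=1,\,y>0}\frac{y^k}{\lambda^{\alpha}L(\lambda)}\left\|F_{\phi}\mathbf{f}\left(\lambda x,\lambda y\right)\right\|<\infty\right).$$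
   Context: $E$ is a Banach space with norm $\|\cdot\|$; $\mathbb{N}$ includes $0$. $\mathcal{S}'(\mathbb{R}^n,E)$ is the space of continuous linear maps $\mathcal{S}(\mathbb{R}^n)\to E$. For $\phi\in\mathcal{S}(\mathbb{R}^n)$ with $\int\phi=1$, the $\phi$-transform of $\mathbf{f}\in\mathcal{S}'(\mathbb{R}^n,E)$ is $F_\phi\mathbf{f}(x,y)=\langle\mathbf{f}(x+yt),\phi(t)\rangle=\langle\mathbf{f}(t),y^{-n}\phi((t-x)/y)\rangle\in E$ for $x\in\mathbb{R}^n$, $y>0$. A measurable positive function $L$ on $(0,A]$ (resp. $[A,\infty)$), $A>0$, is slowly varying at the origin (resp. at infinity) if $L(a\varepsilon)/L(\varepsilon)\to1$ as $\varepsilon\to0^+$ (resp. $L(a\lambda)/L(\lambda)\to1$ as $\lambda\to\infty$) for each $a>0$. $\mathbf{f}$ is weak-asymptotically bounded of degree $\alpha$ at $x_0$ (resp. at infinity) with respect to $L$ in $\mathcal{S}'(\mathbb{R}^n,E)$ if for each $\varphi\in\mathcal{S}(\mathbb{R}^n)$, $\|\langle\mathbf{f}(x_0+\varepsilon t),\varphi(t)\rangle\|=O(\varepsilon^\alpha L(\varepsilon))$ as $\varepsilon\to0^+$ (resp. $\|\langle\mathbf{f}(\lambda t),\varphi(t)\rangle\|=O(\lambda^\alpha L(\lambda))$ as $\lambda\to\infty$). *)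

(* Defs.v *)
From HB Require Import structures.
From mathcomp Require Import all_boot all_order all_algebra.
From mathcomp Require Import complex.
From mathcomp Require Import all_classical all_reals all_analysis.
From mathcomp Require Import ring.

Set Implicit Arguments.
Unset Strict Implicit.
Unset Printing Implicit Defensive.
Import Order.TTheory GRing.Theory Num.Theory.
Import numFieldNormedType.Exports.

Local Open Scope classical_set_scope.
Local Open Scope ring_scope.
Local Open Scope complex_scope.

Section complex_calculus.
Variables (R : realType) (n : nat).
Implicit Types (f g : 'rV[R]_n -> R[i]) (i : 'I_n) (s : seq 'I_n).

Definition Rep f : 'rV[R]_n -> R := fun x => complex.Re (f x).
Definition Imp f : 'rV[R]_n -> R := fun x => complex.Im (f x).

(* The derivative library needs a real normed codomain, which R[i] is not;
   hence the real and imaginary parts are differentiated separately. *)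
Definition pderiv i f : 'rV[R]_n -> R[i] := fun x =>
  'D_(delta_mx 0 i) (Rep f) x +i* 'D_(delta_mx 0 i) (Imp f) x.

(* Iterated partial derivatives are indexed by words s rather than
   multi-indices; on smooth functions the order of the letters is irrelevant. *)
Definition pderivs s f : 'rV[R]_n -> R[i] := foldr pderiv f s.

Definition cdifferentiable f x :=
  differentiable (Rep f) x /\ differentiable (Imp f) x.

(* All iterated partial derivatives are Frechet differentiable, i.e. C^oo. *)
Definition smooth f := forall s x, cdifferentiable (pderivs s f) x.

(* `|x| is the max norm on R^n; any other norm gives equivalent seminorms. *)
Definition schwartz_seminorm (m : nat) f : \bar R :=
  ereal_sup [set ((1 + `|x|) ^+ m * Normc.normc (pderivs s f x))%:E |
     s in [set s | (size s <= m)%N] & x in [set: 'rV[R]_n]].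

Definition is_schwartz f :=
  smooth f /\ forall m, (schwartz_seminorm m f < +oo)%E.

Definition schwartz : {pred ('rV[R]_n -> R[i])} := [pred f | `[< is_schwartz f >]].

Lemma RepE (a : R[i]) f g : Rep (a *: f + g) =
  (complex.Re a *: Rep f + (- complex.Im a) *: Imp f) + Rep g.
Proof.
apply/funext => x; rewrite scaleNr; rewrite /Rep/Imp !fctE/=; case: a (f x) (g x) => [a b] [c d] [e h]; reflexivity.
Qed.

Lemma ImpE (a : R[i]) f g : Imp (a *: f + g) =
  (complex.Re a *: Imp f + complex.Im a *: Rep f) + Imp g.
Proof.
by apply/funext => x; rewrite /Rep/Imp !fctE/=; case: a (f x) (g x) => [a b] [c d] [e h]; reflexivity.
Qed.

Let is_diff_lin (p q r : 'rV[R]_n -> R) (b c : R) x v :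
  differentiable p x -> differentiable q x -> differentiable r x ->
  differentiable ((b *: p + c *: q) + r) x /\
  'D_v ((b *: p + c *: q) + r) x = b * 'D_v p x + c * 'D_v q x + 'D_v r x.
Proof.
move=> dp dq dr.
have dbp := @differentiableZ _ _ _ p b x dp.
have dcq := @differentiableZ _ _ _ q c x dq.
have dbc := @differentiableD _ _ _ (b *: p) (c *: q) x dbp dcq.
split; first exact: (@differentiableD _ _ _ (b *: p + c *: q) r x dbc dr).
have D (h : 'rV[R]_n -> R) : differentiable h x -> derivable h x v by move=> /diff_derivable.
rewrite (@deriveD _ _ _ (b *: p + c *: q) r x v (D _ dbc) (D _ dr)).
rewrite (@deriveD _ _ _ (b *: p) (c *: q) x v (D _ dbp) (D _ dcq)).
by rewrite (@deriveZ _ _ _ p b x v (D _ dp)) (@deriveZ _ _ _ q c x v (D _ dq)).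
Qed.

Lemma cdifferentiable_lin a f g x : cdifferentiable f x -> cdifferentiable g x ->
  cdifferentiable (a *: f + g) x.
Proof.
move=> [f1 f2] [g1 g2]; rewrite /cdifferentiable RepE ImpE.
by split; [case: (is_diff_lin (complex.Re a) (- complex.Im a) 0 f1 f2 g1)|
  case: (is_diff_lin (complex.Re a) (complex.Im a) 0 f2 f1 g2)].
Qed.

Lemma pderiv_lin i a f g :
  (forall x, cdifferentiable f x) -> (forall x, cdifferentiable g x) ->
  pderiv i (a *: f + g) = a *: pderiv i f + pderiv i g.
Proof.
move=> df dg; apply/funext => x; rewrite /pderiv RepE ImpE.
have [f1 f2] := df x; have [g1 g2] := dg x.
have [_ ->] := is_diff_lin (complex.Re a) (- complex.Im a) (delta_mx 0 i) f1 f2 g1.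
have [_ ->] := is_diff_lin (complex.Re a) (complex.Im a) (delta_mx 0 i) f2 f1 g2.
rewrite mulNr; case: a => b c; reflexivity.
Qed.

Lemma pderivs_lin s a f g : smooth f -> smooth g ->
  pderivs s (a *: f + g) = a *: pderivs s f + pderivs s g.
Proof.
move=> sf sg; elim: s => //= i s ->.
by rewrite pderiv_lin.
Qed.

Lemma smooth_lin a f g : smooth f -> smooth g -> smooth (a *: f + g).
Proof. by move=> sf sg s x; rewrite pderivs_lin//; exact: cdifferentiable_lin. Qed.

Lemma pderivs0 s : pderivs s (0 : 'rV[R]_n -> R[i]) = 0.
Proof.
elim: s => //= i s ->; apply/funext => x.
have R0 : Rep (0 : 'rV[R]_n -> R[i]) = cst 0 by [].
have I0 : Imp (0 : 'rV[R]_n -> R[i]) = cst 0 by [].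
by rewrite /pderiv R0 I0 !derive_cst.
Qed.

Lemma smooth0 : smooth 0.
Proof. by move=> s x; rewrite pderivs0; split; exact: differentiable_cst. Qed.

Lemma schwartz_seminorm_ub m s f x : (size s <= m)%N ->
  (((1 + `|x|) ^+ m * Normc.normc (pderivs s f x))%:E <= schwartz_seminorm m f)%E.
Proof. by move=> sm; apply: ereal_sup_ubound => /=; exists s => //; exists x. Qed.

Lemma schwartz_seminorm_le m f (b : \bar R) :
  (forall s x, (size s <= m)%N ->
    (((1 + `|x|) ^+ m * Normc.normc (pderivs s f x))%:E <= b)%E) ->
  (schwartz_seminorm m f <= b)%E.
Proof. by move=> h; apply: ge_ereal_sup => /= _ [s sm [x _ <-]]; exact: h. Qed.

Lemma normc_ge0 (z : R[i]) : 0 <= Normc.normc z.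
Proof. by case: z => a b; rewrite sqrtr_ge0. Qed.

Lemma weight_ge0 (x : 'rV[R]_n) m : 0 <= (1 + `|x|) ^+ m.
Proof. by rewrite exprn_ge0// addr_ge0. Qed.

Lemma schwartz_seminorm_ge0 m f : (0 <= schwartz_seminorm m f)%E.
Proof.
apply: le_trans (@schwartz_seminorm_ub m [::] f 0 _) => //.
by rewrite lee_fin mulr_ge0 ?weight_ge0 ?normc_ge0.
Qed.

Lemma schwartz_seminorm_lin m a f g : smooth f -> smooth g ->
  (schwartz_seminorm m (a *: f + g)%R <=
    (Normc.normc a)%:E * schwartz_seminorm m f + schwartz_seminorm m g)%E.
Proof.
move=> sf sg; apply: schwartz_seminorm_le => s x sm.
rewrite pderivs_lin// !fctE.
apply: (@le_trans _ _ ((Normc.normc a)%:E * ((1 + `|x|) ^+ m * Normc.normc (pderivs s f x))%:E +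
  ((1 + `|x|) ^+ m * Normc.normc (pderivs s g x))%:E)%E).
  rewrite -EFinM -EFinD lee_fin mulrCA -mulrDr ler_wpM2l ?weight_ge0//.
  by rewrite (le_trans (le_normcD _ _))// Normc.normcM.
apply: leeD; last exact: schwartz_seminorm_ub.
by apply: lee_wpmul2l; [rewrite lee_fin normc_ge0|exact: schwartz_seminorm_ub].
Qed.

Lemma schwartz_seminorm_mono m m' f : (m <= m')%N ->
  (schwartz_seminorm m f <= schwartz_seminorm m' f)%E.
Proof.
move=> mm; apply: schwartz_seminorm_le => s x sm.
apply: le_trans (@schwartz_seminorm_ub m' s f x (leq_trans sm mm)).
by rewrite lee_fin ler_wpM2r ?normc_ge0// ler_weXn2l// lerDl.
Qed.

Lemma schwartz_submod : submod_closed schwartz.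
Proof.
split.
  apply/asboolP; split; first exact: smooth0.
  move=> m; apply: le_lt_trans (ltry 0); apply: schwartz_seminorm_le => s x _.
  by rewrite pderivs0 Normc.normc0 mulr0.
move=> a f g /asboolP[sf df] /asboolP[sg dg]; apply/asboolP; split.
  exact: smooth_lin.
move=> m; apply: le_lt_trans (schwartz_seminorm_lin _ _ sf sg) _.
rewrite lte_add_pinfty// ?dg// lte_mul_pinfty ?lee_fin ?normc_ge0//.
Qed.

HB.instance Definition _ := GRing.isSubmodClosed.Build R[i] _ schwartz schwartz_submod.

Record schwartzType : Type := SchwartzFun {
  schwartz_fun :> 'rV[R]_n -> R[i];
  schwartz_funP : schwartz_fun \in schwartz }.

HB.instance Definition _ := [isSub for schwartz_fun].
HB.instance Definition _ := gen_eqMixin schwartzType.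
HB.instance Definition _ := gen_choiceMixin schwartzType.
HB.instance Definition _ := [SubChoice_isSubLmodule of schwartzType by <:].

Implicit Types (phi psi : schwartzType).

Lemma schwartz_fun_smooth phi : smooth phi.
Proof. by have /asboolP[] := schwartz_funP phi. Qed.

Lemma schwartz_fun_lin (a : R[i]) phi psi :
  schwartz_fun (a *: phi + psi) = a *: schwartz_fun phi + schwartz_fun psi.
Proof. by []. Qed.

(* The locally convex topology of the seminorms; these increase with m, so that
   the balls of single seminorms form a neighbourhood base. *)
Definition schwartz_nbhs phi : set_system schwartzType :=
  [set U | exists m, exists2 e : R, 0 < e &
    forall psi, (schwartz_seminorm m (psi - phi)%R < e%:E)%E -> U psi].

HB.instance Definition _ := hasNbhs.Build schwartzType schwartz_nbhs.

Lemma schwartz_nbhs_filter phi : ProperFilter (schwartz_nbhs phi).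
Proof.
split; first by move=> [m [e e0 /(_ phi)]]; apply;
  rewrite subrr; apply: le_lt_trans (_ : (_ <= 0)%E) _; rewrite ?lte_fin//;
  apply: schwartz_seminorm_le => s x _; rewrite (pderivs0 s) Normc.normc0 mulr0.
split.
- by exists 0%N, 1.
- move=> U V [m [e e0 mU]] [m' [e' e0' mV]].
  exists (maxn m m'), (Num.min e e'); first by rewrite lt_min e0.
  move=> psi h; split.
    apply: mU; apply: le_lt_trans (schwartz_seminorm_mono _ (leq_maxl m m')) _.
    by apply: lt_le_trans h _; rewrite lee_fin ge_min lexx.
  apply: mV; apply: le_lt_trans (schwartz_seminorm_mono _ (leq_maxr m m')) _.
  by apply: lt_le_trans h _; rewrite lee_fin ge_min lexx orbT.
- by move=> U V UV [m [e e0 mU]]; exists m, e => // psi /mU /UV.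
Qed.

Lemma schwartz_nbhs_singleton phi (U : set schwartzType) :
  schwartz_nbhs phi U -> U phi.
Proof.
move=> [m [e e0]]; apply; rewrite subrr.
apply: le_lt_trans (_ : (_ <= 0)%E) _; rewrite ?lte_fin//.
by apply: schwartz_seminorm_le => s x _; rewrite (pderivs0 s) Normc.normc0 mulr0.
Qed.

Lemma schwartz_nbhs_nbhs phi (U : set schwartzType) :
  schwartz_nbhs phi U -> schwartz_nbhs phi (schwartz_nbhs ^~ U).
Proof.
move=> [m [e e0 mU]]; exists m, (e / 2); first by rewrite divr_gt0.
move=> psi psie; exists m, (e / 2); first by rewrite divr_gt0.
move=> chi chie; apply: mU.
have -> : chi - phi = 1 *: (chi - psi) + (psi - phi).
  by rewrite scale1r addrA subrK.
rewrite schwartz_fun_lin.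
apply: le_lt_trans (schwartz_seminorm_lin _ _ _ _) _.
- exact: schwartz_fun_smooth.
- exact: schwartz_fun_smooth.
by rewrite Normc.normc1 mul1e [e]splitr EFinD lteD.
Qed.

HB.instance Definition _ := Nbhs_isNbhsTopological.Build schwartzType
  schwartz_nbhs_filter schwartz_nbhs_singleton schwartz_nbhs_nbhs.

Section rescaling.
Variables (a : R) (x0 : 'rV[R]_n).

Let derive_affine (g : 'rV[R]_n -> R) x v : differentiable g (a *: (x - x0)) ->
  differentiable (fun t => g (a *: (t - x0))) x /\
  'D_v (fun t => g (a *: (t - x0))) x = a * 'D_v g (a *: (x - x0)).
Proof.
move=> dg.
pose h := fun t : 'rV[R]_n => a *: (t - x0).
have dsub : differentiable (fun t : 'rV[R]_n => t - x0) x.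
  exact: (@differentiableB _ _ _ id (cst x0)).
have dh : differentiable h x := differentiableZ a dsub.
have dgh : differentiable (g \o h) x := differentiable_comp dh dg.
split; first exact: dgh.
have -> : 'D_v (fun t => g (a *: (t - x0))) x = 'd (g \o h) x v.
  exact: (deriveE v dgh).
have -> : 'd (g \o h) x = 'd g (h x) \o 'd h x :> (_ -> _).
  exact: (diff_comp dh dg).
have -> : 'D_v g (a *: (x - x0)) = 'd g (h x) v by exact: (deriveE v dg).
change ('d g (h x) ('d h x v) = a * 'd g (h x) v).
have <- : 'D_v h x = 'd h x v by exact: (deriveE v dh).
have -> : 'D_v h x = a *: v.
  have D1 : derivable (fun t : 'rV[R]_n => t - x0) x v by exact: diff_derivable.
  have -> : 'D_v h x = a *: 'D_v (fun t : 'rV[R]_n => t - x0) x by exact: (deriveZ a D1).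
  congr (_ *: _).
  have Di : derivable (id : 'rV[R]_n -> 'rV[R]_n) x v by exact: derivable_id.
  have Dc : derivable (cst x0 : 'rV[R]_n -> 'rV[R]_n) x v by exact: derivable_cst.
  have -> : 'D_v (fun t : 'rV[R]_n => t - x0) x = 'D_v id x - 'D_v (cst x0) x.
    exact: (deriveB Di Dc).
  have -> : 'D_v (cst x0 : 'rV[R]_n -> 'rV[R]_n) x = 0 by exact: derive_cst.
  have -> : 'D_v (id : 'rV[R]_n -> 'rV[R]_n) x = v by exact: derive_id.
  by rewrite subr0.
by rewrite linearZ.
Qed.

Let pderiv_affine i f : (forall x, cdifferentiable f x) ->
  (forall x, cdifferentiable (fun t => f (a *: (t - x0))) x) /\
  pderiv i (fun t => f (a *: (t - x0))) = a%:C *: (fun t => pderiv i f (a *: (t - x0))).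
Proof.
move=> df; split.
  move=> x; have [f1 f2] := df (a *: (x - x0)).
  by split; [case: (derive_affine 0 f1)|case: (derive_affine 0 f2)].
apply/funext => x; have [f1 f2] := df (a *: (x - x0)).
rewrite /pderiv.
have [_ ->] := derive_affine (delta_mx 0 i) f1.
have [_ ->] := derive_affine (delta_mx 0 i) f2.
rewrite !fctE; apply/eqP; rewrite eq_complex/= !mul0r subr0 addr0.
by rewrite !eqxx.
Qed.

Let pderivs_affine s f : smooth f ->
  pderivs s (fun t => f (a *: (t - x0))) =
  (a ^+ size s)%:C *: (fun t => pderivs s f (a *: (t - x0))).
Proof.
move=> sf; elim: s => [|i s IH]/=; first by rewrite scale1r.
rewrite IH.
have [d e] := pderiv_affine i (sf s).
rewrite -[_ *: _ as X in pderiv i X]addr0.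
rewrite pderiv_lin//; last by move=> x; apply: (smooth0 [::]).
rewrite e scalerA exprSr rmorphM/=.
by rewrite (_ : pderiv i 0 = 0) ?addr0//; exact: (pderivs0 [:: i]).
Qed.

Lemma smooth_affine f : smooth f -> smooth (fun t => f (a *: (t - x0))).
Proof.
move=> sf s x; rewrite pderivs_affine// -[_ *: _]addr0.
apply: cdifferentiable_lin; last exact: (smooth0 [::]).
have [f1 f2] := sf s (a *: (x - x0)).
by split; [case: (derive_affine 0 f1)|case: (derive_affine 0 f2)].
Qed.

Lemma weight_affine x : a != 0 ->
  1 + `|x| <= (1 + `|x0| + `|a|^-1) * (1 + `|a *: (x - x0)|).
Proof.
move=> a0.
have e : `|a|^-1 * `|a *: (x - x0)| = `|x - x0|.
  by rewrite normrZ mulrA mulVf ?mul1r// normr_eq0.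
apply: (@le_trans _ _ (1 + `|x0| + `|x - x0|)).
  by rewrite -addrA lerD2l; have := ler_normD x0 (x - x0); rewrite [x0 + _]addrC subrK.
rewrite -e; have : 0 <= `|a|^-1 by rewrite invr_ge0.
move: `|a|^-1 `|a *: _| `|x0| (normr_ge0 (a *: (x - x0))) (normr_ge0 x0) => p q r q0 r0 p0.
rewrite -subr_ge0 (_ : _ - _ = q + r * q + p); last by ring.
by rewrite !addr_ge0 ?mulr_ge0.
Qed.

Lemma is_schwartz_affine f : a != 0 -> is_schwartz f ->
  is_schwartz (fun t => f (a *: (t - x0))).
Proof.
move=> a0 [sf df]; split; first exact: smooth_affine.
move=> m; pose K := (1 + `|x0| + `|a|^-1) ^+ m * (1 + `|a|) ^+ m.
have K0 : 0 <= K by rewrite mulr_ge0 ?exprn_ge0 ?addr_ge0 ?invr_ge0.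
apply: (@le_lt_trans _ _ (K%:E * schwartz_seminorm m f)%E); last first.
  by rewrite lte_mul_pinfty// lee_fin.
apply: schwartz_seminorm_le => s x sm.
apply: (@le_trans _ _ (K%:E * ((1 + `|a *: (x - x0)|) ^+ m *
    Normc.normc (pderivs s f (a *: (x - x0))))%:E)%E); last first.
  by rewrite lee_wpmul2l ?lee_fin//; exact: schwartz_seminorm_ub.
rewrite -EFinM lee_fin pderivs_affine// fctE Normc.normcM.
have -> : Normc.normc (a ^+ size s)%:C = `|a| ^+ size s.
  by rewrite /Normc.normc/= expr0n/= addr0 sqrtr_sqr normrX.
rewrite /K mulrA mulrACA mulrA; apply: ler_wpM2r; first exact: normc_ge0.
have -> : (1 + `|x0| + `|a|^-1) ^+ m * (1 + `|a *: (x - x0)|) ^+ m * (1 + `|a|) ^+ m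
  = ((1 + `|x0| + `|a|^-1) * (1 + `|a *: (x - x0)|)) ^+ m * (1 + `|a|) ^+ m.
  by rewrite exprMn.
apply: ler_pM; rewrite ?exprn_ge0 ?addr_ge0//.
  by apply: lerXn2r; rewrite ?nnegrE ?mulr_ge0 ?addr_ge0 ?invr_ge0//; exact: weight_affine.
apply: (@le_trans _ _ ((1 + `|a|) ^+ size s)).
  by apply: lerXn2r; rewrite ?nnegrE ?addr_ge0// lerDr.
by apply: ler_weXn2l => //; rewrite lerDl.
Qed.

End rescaling.

(* Junk value for y = 0 (0^-1 = 0); only 0 < y matters. *)
Lemma rescale_subproof phi x y :
  (fun t => (y ^- n)%:C * phi (y^-1 *: (t - x))) \in schwartz.
Proof.
have [->|y0] := eqVneq y 0; last first.
  change ((y ^- n)%:C *: (fun t => phi (y^-1 *: (t - x))) \in schwartz).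
  apply: rpredZ; apply/asboolP; apply: is_schwartz_affine; first by rewrite invr_eq0.
  by apply/asboolP; exact: schwartz_funP.
have [n0|n0] := posnP n; last first.
  rewrite (_ : (fun _ => _) = 0) ?rpred0//; apply/funext => t.
  by rewrite expr0n eqn0Ngt n0 invr0 mul0r.
have rV0 (u v : 'rV[R]_n) : u = v by apply/rowP => j; have := ltn_ord j; rewrite [X in (_ < X)%N]n0.
rewrite (_ : (fun _ => _) = ((0 ^- n)%:C *: (phi : 'rV[R]_n -> R[i]))); last first.
  by apply/funext => t; rewrite (rV0 (_ *: _) t).
by apply: rpredZ; exact: schwartz_funP.
Qed.

Definition rescale phi x y : schwartzType := SchwartzFun (rescale_subproof phi x y).

End complex_calculus.

Section integral.
Variable R : realType.

(* The library has no Lebesgue measure on R^n: this is the iterated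
   one-dimensional Lebesgue integral, which for integrable functions (Schwartz
   functions in particular) is the Lebesgue integral on R^n by Fubini. *)
Fixpoint rV_integral (n : nat) : ('rV[R]_n -> R) -> R :=
  match n with
  | 0 => fun g => g 0
  | n'.+1 => fun g =>
      \int[@lebesgue_measure R]_t
        rV_integral (fun x : 'rV[R]_n' => g (row_mx t%:M x))
  end.

Definition cintegral n (f : 'rV[R]_n -> R[i]) : R[i] :=
  rV_integral (Rep f) +i* rV_integral (Imp f).

End integral.

Section slowly_varying.
Variable R : realType.

(* R with the sigma-algebra of Lebesgue measurable sets (the default one on R
   is the Borel sigma-algebra). *)
Definition lebesgueR : Type := caratheodory_type ((@wlength R idfun)^*)%mu.
HB.instance Definition _ := Measurable.on lebesgueR.

(* L is a total function, but only its values on ]0, A], resp. [A, +oo[,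
   are constrained. *)
Definition slowly_varying0 (L : R -> R) := exists2 A : R, 0 < A &
  [/\ measurable_fun (`]0, A] : set lebesgueR) L,
      forall e, 0 < e <= A -> 0 < L e &
      forall a, 0 < a -> L (a * e) / L e @[e --> 0^'+] --> (1 : R)].

Definition slowly_varyingy (L : R -> R) := exists2 A : R, 0 < A &
  [/\ measurable_fun (`[A, +oo[ : set lebesgueR) L,
      forall l, A <= l -> 0 < L l &
      forall a, 0 < a -> L (a * l) / L l @[l --> +oo] --> (1 : R)].

End slowly_varying.

Section phi_transform.
Variables (R : realType) (n : nat) (E : completeNormedModType R[i]).
Implicit Types (f : schwartzType R n -> E) (phi : schwartzType R n).
Implicit Types (x : 'rV[R]_n) (L : R -> R).

(* The library norm on E takes its values in R[i]. *)
Definition rnorm (v : E) : R := complex.Re `|v|.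

(* <f(x + y t), phi(t)> := <f(t), y^-n phi((t - x) / y)>, for 0 < y *)
Definition affine_pairing f x (y : R) phi : E := f (rescale phi x y).

Definition phi_transform phi f x (y : R) : E := affine_pairing f x y phi.

Definition weak_asymp_bounded0 f (alpha : R) x0 L := forall phi,
  (fun e : R => rnorm (affine_pairing f x0 e phi))
    =O_ (0^'+) (fun e : R => e `^ alpha * L e).

Definition weak_asymp_boundedy f (alpha : R) L := forall phi,
  (fun l : R => rnorm (affine_pairing f 0 l phi))
    =O_ (FilterType +oo_R _) (fun l : R => l `^ alpha * L l).

End phi_transform.

(* Here |x| is the Euclidean norm. *)
Definition half_sphere (R : realType) (n : nat) : set ('rV[R]_n * R) :=
  [set p : 'rV[R]_n * R | \sum_(i < n) p.1 0 i ^+ 2 + p.2 ^+ 2 = 1 /\ 0 < p.2].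

(* Main.v *)
(* Forward implication: the functionals psi |-> f(x0 + e t)(psi) / (e^alpha L(e))
   are bounded for each psi, hence by Banach-Steinhaus on the Frechet space of
   Schwartz functions they are dominated by one seminorm, and the seminorms of
   phi((t - x) / y) / y^n grow at most like a power of 1 / y on the half sphere.

   Converse: a slowly varying L satisfies L(a e) <= 4 max(a, 1/a)^2 L(e), so
   scaling along rays turns the hypothesis into
     |<f(x0 + e t), phi_(x, s)(t)>| <= K (1 + |x|)^q s^(-q) e^alpha L(e)
   for all x, all 0 < s <= 1 and all small (large) e, where
   phi_(x, s)(t) = s^(-n) phi((t - x) / s). A test function psi is decomposed
   without Fourier analysis: let psi_0 = psi, and let psi_(j+1) be psi_j minus a
   Riemann sum of the convolution of psi_j with phi_(0, 2^-j). That Riemann sum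
   is a finite combination of functions phi_(x, 2^-j) whose coefficients grow
   like 2^(3 n j). As the integral of phi is 1, each step gains a factor 2^-j at
   the cost of one derivative; spending a fixed number of derivatives makes psi_j
   decay faster than 2^(-(3 n + q) j), so that the resulting series converges in
   the seminorm dominating f and each of its terms is under control. *)
Require Import Defs.
From HB Require Import structures.
From mathcomp Require Import all_boot all_order all_algebra.
From mathcomp Require Import complex.
From mathcomp Require Import all_classical all_reals all_analysis.
From mathcomp Require Import measurable_realfun ring lra.

Set Implicit Arguments.
Unset Strict Implicit.
Unset Printing Implicit Defensive.
Import Order.TTheory GRing.Theory Num.Theory.
Import numFieldNormedType.Exports.

Local Open Scope classical_set_scope.
Local Open Scope ring_scope.

(** Finite Riemann sums let the linear functional [f] pass through the decomposition without any
    integral with values in [E]. The obstacle is that the derivatives of a combination of functions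
    phi_(x, s) fall on phi and cost powers of 1 / s. Each step is therefore estimated on the sum
    with the roles exchanged, where the translates, and so the derivatives, are those of psi; for
    fine meshes the two sums agree because convolution is commutative. The loss per step is then
    independent of the number of derivatives, so that the number to be spent can be fixed afterwards
    without circularity. Uniformity in e comes from the shape of the decomposition bound: the
    functionals f(x0 + e t), divided by their growth, are dominated by one seminorm with constants
    that may blow up with e, and these constants only multiply a remainder that tends to 0. *)

Local Notation normc := Normc.normc.

(** * Moduli of complex numbers against real and imaginary parts *)

Section complex_modulus.
Variable R : rcfType.
Implicit Types z w : R[i].

Lemma normc_Re_le z : `|complex.Re z| <= normc z.
Proof.
case: z => a b /=; rewrite -sqrtr_sqr.
by rewrite ler_wsqrtr// lerDl sqr_ge0.
Qed.

Lemma normc_Im_le z : `|complex.Im z| <= normc z.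
Proof.
case: z => a b /=; rewrite -sqrtr_sqr.
by rewrite ler_wsqrtr// lerDr sqr_ge0.
Qed.

Lemma normc_le_ReIm z : normc z <= `|complex.Re z| + `|complex.Im z|.
Proof.
case: z => a b /=; rewrite -(ler_pXn2r (n := 2))// ?nnegrE ?sqrtr_ge0 ?addr_ge0//.
rewrite sqr_sqrtr ?addr_ge0 ?sqr_ge0// sqrrD !real_normK ?num_real//.
by rewrite lerD2r lerDl mulrn_wge0// mulr_ge0.
Qed.

Lemma normc_real (x : R) : normc x%:C%C = `|x|.
Proof. by rewrite /= expr0n/= addr0 sqrtr_sqr. Qed.

Lemma ReB z w : complex.Re (z - w) = complex.Re z - complex.Re w.
Proof. by case: z; case: w. Qed.

Lemma ImB z w : complex.Im (z - w) = complex.Im z - complex.Im w.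
Proof. by case: z; case: w. Qed.

Lemma normc_triangle (z w v : R[i]) : normc (z - w) <= normc (z - v) + normc (v - w).
Proof. by rewrite -[z - w](subrKA v) le_normcD. Qed.

Lemma normc_sum (I : Type) (r : seq I) (F : I -> R[i]) :
  normc (\sum_(i <- r) F i) <= \sum_(i <- r) normc (F i).
Proof.
elim/big_rec2: _ => [|i x y _ h]; first by rewrite Normc.normc0.
by apply: le_trans (le_normcD _ _) _; rewrite lerD2l.
Qed.

End complex_modulus.

(** * Mean value inequalities along segments *)

Section mean_value.
Variables (R : realType) (n : nat).
Implicit Types (g : 'rV[R]_n -> R) (f : 'rV[R]_n -> R[i]).

Lemma coord_le_norm (x : 'rV[R]_n) i : `|x 0 i| <= `|x|.
Proof.
rewrite [leRHS]mx_normrE.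
exact: (le_bigmax_cond _ (fun ij : 'I_1 * 'I_n => `|x ij.1 ij.2|) (j := (0, i))).
Qed.

Lemma is_derive_line g x h (t : R) : (forall y, differentiable g y) ->
  is_derive t 1 (fun t : R => g (x + t *: h)) ('D_h g (x + t *: h)).
Proof.
move=> dg.
have dl : is_diff t (fun t : R => x + t *: h) ( *:%R^~ h).
  have := @is_diffD _ _ _ _ _ _ _ t (is_diff_cst x t) (is_diff_scalel t h).
  by rewrite add0r; exact.
have dg' : is_diff (x + t *: h) g ('d g (x + t *: h)) by exact: DiffDef.
have dgl := is_diff_comp dl dg'.
have d := ex_diff (is_diff_def := dgl).
apply: DeriveDef; first exact: (diff_derivable d).
by rewrite (deriveE _ d) (diff_val (is_diff_def := dgl)) /= scale1r deriveE.
Qed.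

Lemma derive_coord g x (h : 'rV[R]_n) : differentiable g x ->
  'D_h g x = \sum_i h 0 i * 'D_(delta_mx 0 i) g x.
Proof.
move=> dg; rewrite deriveE// {1}[h]row_sum_delta linear_sum/=.
by apply: eq_bigr => i _; rewrite linearZ/= deriveE.
Qed.

Lemma MVT_line g x h : (forall y, differentiable g y) ->
  exists2 t, 0 <= t <= 1 & g (x + h) - g x = 'D_h g (x + t *: h).
Proof.
move=> dg; have dl t := is_derive_line x h t dg.
have [|t tI] := @MVT_segment _ (fun t : R => g (x + t *: h)) _ 0 1 ler01
  (fun t _ => dl t).
- apply: continuous_subspaceT => t; apply: differentiable_continuous.
  by apply/derivable1_diffP; exact: (ex_derive (is_derive := dl t)).
- rewrite scale1r scale0r addr0 subr0 mulr1 => e.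
  by exists t => //; move: tI; rewrite in_itv.
Qed.

Lemma mean_value_le g x (h : 'rV[R]_n) (M : R) : (forall y, differentiable g y) ->
  (forall i (t : R), 0 <= t <= 1 -> `|'D_(delta_mx 0 i) g (x + t *: h)| <= M) ->
  `|g (x + h) - g x| <= n%:R * `|h| * M.
Proof.
move=> dg gM; have [t t01 ->] := MVT_line x h dg.
rewrite derive_coord//; apply: le_trans (ler_norm_sum _ _ _) _.
apply: (@le_trans _ _ (\sum_(i < n) `|h| * M)); last first.
  by rewrite sumr_const card_ord -mulrA mulr_natl.
apply: ler_sum => i _; rewrite normrM ler_pM ?gM//.
exact: coord_le_norm.
Qed.

(** The mean value theorem fails for complex values, so the real and imaginary parts are treated
    apart, whence the factor 2. *)
Lemma cmean_value_le f x (h : 'rV[R]_n) (M : R) : (forall y, cdifferentiable f y) ->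
  (forall i (t : R), 0 <= t <= 1 -> normc (pderiv i f (x + t *: h)) <= M) ->
  normc (f (x + h) - f x) <= 2 * (n%:R * `|h| * M).
Proof.
move=> df fM; apply: le_trans (normc_le_ReIm _) _.
rewrite mulr2n mulrDl mul1r ReB ImB; apply: lerD.
  apply: (@mean_value_le (Rep f)) => [y|i t t01]; first by case: (df y).
  exact: le_trans (normc_Re_le _) (fM i t t01).
apply: (@mean_value_le (Imp f)) => [y|i t t01]; first by case: (df y).
exact: le_trans (normc_Im_le _) (fM i t t01).
Qed.

End mean_value.

(** * Weighted sup bounds on Schwartz functions *)

Section weighted_bounds.
Variables (R : realType) (n : nat).
Implicit Types (f g : 'rV[R]_n -> R[i]) (psi chi : schwartzType R n) (x y : 'rV[R]_n).

(** Weight and number of derivatives are separate, unlike in [schwartz_seminorm], since the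
    decomposition spends derivatives at a fixed weight. *)
Definition wbound (a b : nat) f (c : R) := forall s x, (size s <= b)%N ->
  (1 + `|x|) ^+ a * normc (pderivs s f x) <= c.

Lemma weight_ge1 x : 1 <= 1 + `|x|. Proof. by rewrite lerDl. Qed.

Lemma weight_gt0 x : 0 < 1 + `|x|. Proof. by rewrite ltr_pwDl. Qed.

Lemma wbound_ge0 a b f c : wbound a b f c -> 0 <= c.
Proof.
move=> /(_ [::] 0 isT); apply: le_trans.
by rewrite mulr_ge0 ?weight_ge0 ?normc_ge0.
Qed.

Lemma wbound_le a b a' b' f c c' : (a' <= a)%N -> (b' <= b)%N -> c <= c' ->
  wbound a b f c -> wbound a' b' f c'.
Proof.
move=> aa bb cc h s x sb; apply: le_trans cc; apply: le_trans (h s x (leq_trans sb bb)).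
by rewrite ler_wpM2r ?normc_ge0// ler_weXn2l// weight_ge1.
Qed.

Lemma wbound_schwartz a b psi : exists c, wbound a b psi c.
Proof.
have /asboolP[_ /(_ (maxn a b)) fin] := schwartz_funP psi.
exists (fine (schwartz_seminorm (maxn a b) psi)).
apply: (@wbound_le (maxn a b) (maxn a b)) (lexx _) _; rewrite ?leq_maxl ?leq_maxr//.
move=> s x sm; rewrite -lee_fin fineK ?schwartz_seminorm_ub//.
by rewrite ge0_fin_numE// schwartz_seminorm_ge0.
Qed.

Lemma schwartz_of_wbound f : smooth f -> (forall m, exists c, wbound m m f c) ->
  f \in @schwartz R n.
Proof.
move=> sf fb; apply/asboolP; split=> // m; have [c fc] := fb m.
apply: (@le_lt_trans _ _ c%:E) (ltry _).
by apply: schwartz_seminorm_le => s x sm; rewrite lee_fin fc.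
Qed.

Lemma wbound_lin a b k f g c d : smooth f -> smooth g -> wbound a b f c ->
  wbound a b g d -> wbound a b (k *: f + g) (normc k * c + d).
Proof.
move=> sf sg fc gd s x sb; rewrite pderivs_lin//.
apply: (@le_trans _ _ (normc k * ((1 + `|x|) ^+ a * normc (pderivs s f x)) +
  (1 + `|x|) ^+ a * normc (pderivs s g x))); last first.
  by rewrite lerD ?ler_wpM2l ?normc_ge0 ?fc ?gd.
rewrite mulrCA -mulrDr ler_wpM2l ?weight_ge0//.
by apply: le_trans (le_normcD _ _) _; rewrite Normc.normcM.
Qed.

Lemma wboundB a b psi chi c d : wbound a b psi c ->
  wbound a b chi d -> wbound a b (psi - chi : schwartzType R n) (c + d).
Proof.
move=> pc cd; have -> : psi - chi = -1 *: chi + psi by rewrite scaleN1r addrC.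
have := wbound_lin (-1) (schwartz_fun_smooth chi) (schwartz_fun_smooth psi) cd pc.
by rewrite normcN Normc.normc1 mul1r [d + c]addrC.
Qed.

Lemma wboundD a b psi chi c d : wbound a b psi c ->
  wbound a b chi d -> wbound a b (psi + chi : schwartzType R n) (c + d).
Proof.
move=> pc cd; have := wbound_lin 1 (schwartz_fun_smooth psi) (schwartz_fun_smooth chi) pc cd.
by rewrite scale1r Normc.normc1 mul1r.
Qed.

Lemma smooth_pderivs s f : smooth f -> smooth (pderivs s f).
Proof. by move=> sf s' x; rewrite -[pderivs s' _]foldr_cat; exact: sf. Qed.

Lemma pderivsB s psi chi x : pderivs s (psi - chi : schwartzType R n) x =
  pderivs s psi x - pderivs s chi x.
Proof.
have -> : psi - chi = -1 *: chi + psi by rewrite scaleN1r addrC.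
rewrite schwartz_fun_lin pderivs_lin; do ?exact: schwartz_fun_smooth.
by rewrite !fctE scaleN1r addrC.
Qed.

Lemma pderivs_sum s (I : Type) (r : seq I) (k : I -> R[i]) (F : I -> schwartzType R n) x :
  pderivs s (\sum_(j <- r) k j *: F j : schwartzType R n) x =
  \sum_(j <- r) k j * pderivs s (F j) x.
Proof.
elim: r => [|j r IH].
  by rewrite !big_nil (_ : schwartz_fun 0 = 0)// pderivs0.
rewrite !big_cons schwartz_fun_lin pderivs_lin; do ?exact: schwartz_fun_smooth.
by rewrite !fctE IH.
Qed.

Lemma derive_affine (g : 'rV[R]_n -> R) (a : R) x0 x v :
  differentiable g (a *: (x - x0)) ->
  'D_v (fun t => g (a *: (t - x0))) x = a * 'D_v g (a *: (x - x0)).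
Proof.
move=> dg.
have dh : is_diff x (fun t : 'rV[R]_n => a *: (t - x0)) ( *:%R a).
  have := @is_diffZ _ _ _ _ _ a x (is_diffB (is_diff_id x) (is_diff_cst x0 x)).
  by rewrite subr0.
have dg' : is_diff (a *: (x - x0)) g ('d g (a *: (x - x0))) by exact: DiffDef.
have dgh := is_diff_comp dh dg'.
rewrite (deriveE _ (ex_diff (is_diff_def := dgh))) (diff_val (is_diff_def := dgh)).
by rewrite /= linearZ/= deriveE.
Qed.

Lemma pderivs_affine s f (a : R) x0 : smooth f ->
  pderivs s (fun t => f (a *: (t - x0))) =
  (fun t => (a ^+ size s)%:C%C * pderivs s f (a *: (t - x0))).
Proof.
move=> sf; elim: s => [|i s IH] /=; first by apply/funext => t; rewrite mul1r.
rewrite IH; have ss := smooth_affine a x0 (smooth_pderivs s sf).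
have -> : (fun t => (a ^+ size s)%:C%C * pderivs s f (a *: (t - x0))) =
  (a ^+ size s)%:C%C *: (fun t => pderivs s f (a *: (t - x0))) + 0.
  by rewrite addr0.
rewrite pderiv_lin; [|exact: (ss [::])|exact: (@smooth0 _ _ [::])].
rewrite (pderivs0 _ [:: i] : pderiv i 0 = 0) addr0.
apply/funext => x; rewrite !fctE /pderiv; have [d1 d2] := sf s (a *: (x - x0)).
rewrite (derive_affine _ d1) (derive_affine _ d2) exprSr rmorphM/= -mulrA.
by congr (_ * _); apply/eqP; rewrite eq_complex/= !mul0r subr0 addr0 !eqxx.
Qed.

Lemma pderivs_rescale s psi x0 (y : R) x : pderivs s (rescale psi x0 y) x =
  (y ^- n * y ^- size s)%:C%C * pderivs s psi (y^-1 *: (x - x0)).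
Proof.
have sp := schwartz_fun_smooth psi.
have -> : schwartz_fun (rescale psi x0 y) =
  (y ^- n)%:C%C *: (fun t => psi (y^-1 *: (t - x0))) + 0 by rewrite addr0.
rewrite pderivs_lin; [|exact: smooth_affine|exact: smooth0].
by rewrite pderivs0 addr0 fctE pderivs_affine// rmorphM/= -mulrA exprVn.
Qed.

End weighted_bounds.

(** * Differentiability of uniform limits *)

Section uniform_limits.
Variable R : realType.

Lemma is_diff_epsilon (V W : normedModType R) (F : V -> W) (L : {linear V -> W}) x :
  continuous L ->
  (forall e : R, 0 < e -> exists2 d, 0 < d & forall h, `|h| < d ->
     `|F (x + h) - F x - L h| <= e * `|h|) ->
  differentiable F x /\ 'd F x = L :> (V -> W).
Proof.
move=> cL hF.
have FL : F \o shift x = cst (F x) + L +o_ 0 id.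
  apply/eqaddoP => e e0; have [d d0 hd] := hF e e0.
  apply/nbhs_ballP; exists d => //= h; rewrite -ball_normE /= sub0r normrN => /hd.
  by rewrite !fctE /= opprD addrA [h + x]addrC.
have dE := diff_unique cL FL.
by split=> //; apply/diff_locallyP; rewrite dE.
Qed.

Lemma real_cauchy_limit (u : nat -> R) :
  (forall e : R, 0 < e -> exists N, forall M K, (N <= M)%N -> (N <= K)%N -> `|u M - u K| <= e) ->
  exists l, forall e : R, 0 < e -> exists N, forall M, (N <= M)%N -> `|u M - l| <= e.
Proof.
move=> cu; have /cvg_ex[l ul] : cvgn u.
  apply/cauchy_cvgP; apply: cauchy_exP => e e0.
  have [N uN] := cu (e / 2) (divr_gt0 e0 (ltr0n _ 2)).
  exists (u N); exists N => // M NM; apply: le_lt_trans (uN _ _ (leqnn N) NM) _.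
  by rewrite ltr_pdivrMr// ltr_pMr// ltr1n.
exists l => e e0; move/cvgrPdist_le : ul => /(_ e e0)[N _ uN].
by exists N => M NM; rewrite distrC; exact: uN.
Qed.

Variable n : nat.

Lemma is_diff_coords (F : 'rV[R]_n -> R) (g : 'I_n -> R) x :
  (forall e : R, 0 < e -> exists2 d, 0 < d & forall h : 'rV[R]_n, `|h| < d ->
     `|F (x + h) - F x - \sum_i h 0 i * g i| <= e * `|h|) ->
  differentiable F x /\ forall i, 'D_(delta_mx 0 i) F x = g i.
Proof.
pose l (h : 'rV[R]_n) := \sum_i h 0 i * g i => hF.
have lP : linear l.
  move=> a u v; rewrite /l scaler_sumr -big_split/=; apply: eq_bigr => i _.
  by rewrite !mxE mulrDl -mulrA.
pose lM := GRing.isLinear.Build _ _ _ _ _ lP.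
pose L : {linear 'rV[R]_n -> R} := HB.pack l lM.
have cL : continuous L.
  rewrite /L /= /l; elim: (index_enum _) => [|i r IH] h.
    rewrite (_ : (fun _ => _) = cst 0); first exact: cst_continuous.
    by apply/funext => t; rewrite big_nil.
  rewrite (_ : (fun _ => _) =
    (fun t : 'rV[R]_n => t 0 i * g i) \+ (fun t => \sum_(i <- r) t 0 i * g i)).
    by apply: continuousD; [apply: continuousM; [exact: coord_continuous|exact: cst_continuous]|exact: IH].
  by apply/funext => t; rewrite big_cons.
have [dF dE] := is_diff_epsilon cL hF.
split=> // i; rewrite deriveE// dE /= /l (bigD1 i)//= big1 ?addr0.
  by rewrite mxE !eqxx mul1r.
by move=> j ji; rewrite mxE (negbTE ji) andbF mul0r.
Qed.

Lemma diff_coords_epsilon (g : 'rV[R]_n -> R) x : differentiable g x ->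
  forall e : R, 0 < e -> exists2 d, 0 < d & forall h : 'rV[R]_n, `|h| < d ->
    `|g (x + h) - g x - \sum_i h 0 i * 'D_(delta_mx 0 i) g x| <= e * `|h|.
Proof.
move=> dg e e0; have /eqaddoP/(_ e e0)/nbhs_ballP[d d0 hd] := diff_locally dg.
exists d => // h hltd; have := hd h; rewrite -ball_normE /= sub0r normrN => /(_ hltd).
by rewrite !fctE /= opprD addrA [h + x]addrC -deriveE// derive_coord.
Qed.

(** The mean value inequality for [F M - F N] bounds the difference of their increments by [|h|]
    times the distance of the partial derivatives, uniformly in [M]. Letting [M] grow replaces [F M]
    by [G], and the differentiability of the single function [F N] finishes. *)
Lemma differentiable_uniform_limit (F : nat -> 'rV[R]_n -> R) (G : 'rV[R]_n -> R)
    (g : 'I_n -> 'rV[R]_n -> R) :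
  (forall N y, differentiable (F N) y) ->
  (forall e : R, 0 < e -> exists N, forall M y, (N <= M)%N -> `|F M y - G y| <= e) ->
  (forall e : R, 0 < e -> exists N, forall M i y, (N <= M)%N ->
     `|'D_(delta_mx 0 i) (F M) y - g i y| <= e) ->
  forall x, differentiable G x /\ forall i, 'D_(delta_mx 0 i) G x = g i x.
Proof.
move=> dF FG Fg x; apply: (@is_diff_coords G (g^~ x)) => e e0.
(* The error budget: [2 n] for passing from [G] to [F N], [n] for the partial derivatives, [1] for
   the expansion of [F N]. *)
pose c : R := n%:R * 3 + 1; have c0 : 0 < c by rewrite ltr_pwDr// mulr_ge0.
have e'0 : 0 < e / c by rewrite divr_gt0.
have [N FgN] := Fg _ e'0.
have [d d0 hd] := diff_coords_epsilon (dF N x) e'0.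
exists d => // h /hd FNh.
have FGN : `|(G (x + h) - G x) - (F N (x + h) - F N x)| <= n%:R * `|h| * (e / c *+ 2).
  apply/ler_addgt0Pl => eta eta0.
  have [N' FGN'] := FG (eta / 2) (divr_gt0 eta0 (ltr0n _ 2)).
  pose M := maxn N N'.
  have FMN : `|(F M - F N) (x + h) - (F M - F N) x| <= n%:R * `|h| * (e / c *+ 2).
    apply: mean_value_le => [y|i t _]; first exact: differentiableB.
    rewrite deriveB; [|exact: diff_derivable|exact: diff_derivable].
    rewrite -[_ - _](subrKA (g i (x + t *: h))) mulr2n.
    apply: le_trans (ler_normD _ _) _; apply: lerD; first by rewrite FgN ?leq_maxl.
    by rewrite distrC FgN.
  rewrite [eta]splitr.
  rewrite (_ : _ - _ = (G (x + h) - F M (x + h)) + (F M x - G x) +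
    ((F M - F N) (x + h) - (F M - F N) x)); last by rewrite !fctE; ring.
  rewrite (le_trans (ler_normD _ _))// lerD// (le_trans (ler_normD _ _))// lerD//.
    by rewrite distrC FGN' ?leq_maxr.
  by rewrite FGN' ?leq_maxr.
have gN : `|\sum_i h 0 i * ('D_(delta_mx 0 i) (F N) x - g i x)| <= n%:R * `|h| * (e / c).
  apply: le_trans (ler_norm_sum _ _ _) _.
  apply: (@le_trans _ _ (\sum_(i < n) `|h| * (e / c))).
    by apply: ler_sum => i _; rewrite normrM ler_pM ?coord_le_norm ?FgN.
  by rewrite sumr_const card_ord -mulrA mulr_natl.
have -> : e * `|h| = n%:R * `|h| * (e / c *+ 2) + (e / c * `|h| + n%:R * `|h| * (e / c)).
  by rewrite /c; field; rewrite -/c gt_eqF.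
rewrite (_ : G (x + h) - G x - _ = (G (x + h) - G x - (F N (x + h) - F N x)) +
   ((F N (x + h) - F N x - \sum_i h 0 i * 'D_(delta_mx 0 i) (F N) x) +
   \sum_i h 0 i * ('D_(delta_mx 0 i) (F N) x - g i x))); last first.
  under [X in _ = _ + (_ + X)]eq_bigr do rewrite mulrBr.
  by rewrite sumrB; ring.
by rewrite (le_trans (ler_normD _ _))// lerD// (le_trans (ler_normD _ _))// lerD.
Qed.

End uniform_limits.

(** * Completeness of the Schwartz space *)

Section completeness.
Variables (R : realType).

Definition ctends (u : nat -> R[i]) (l : R[i]) := forall e : R, 0 < e ->
  exists N, forall M, (N <= M)%N -> normc (u M - l) <= e.

Lemma complex_cauchy_limit (u : nat -> R[i]) :
  (forall e : R, 0 < e -> exists N, forall M K, (N <= M)%N -> (N <= K)%N ->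
     normc (u M - u K) <= e) ->
  exists l, ctends u l.
Proof.
move=> cu.
have [a ua] : exists a, forall e : R, 0 < e -> exists N, forall M, (N <= M)%N ->
    `|complex.Re (u M) - a| <= e.
  apply: real_cauchy_limit => e /cu[N uN]; exists N => M K NM NK.
  by rewrite -ReB (le_trans (normc_Re_le _))// uN.
have [b ub] : exists b, forall e : R, 0 < e -> exists N, forall M, (N <= M)%N ->
    `|complex.Im (u M) - b| <= e.
  apply: real_cauchy_limit => e /cu[N uN]; exists N => M K NM NK.
  by rewrite -ImB (le_trans (normc_Im_le _))// uN.
exists (a +i* b)%C => e e0; have e20 : 0 < e / 2 by rewrite divr_gt0.
have [N uN] := ua _ e20; have [N' uN'] := ub _ e20.
exists (maxn N N') => M; rewrite geq_max => /andP[NM N'M].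
rewrite (le_trans (normc_le_ReIm _))// ReB ImB [e]splitr.
by rewrite lerD ?uN ?uN'.
Qed.

Lemma ctends_le (u : nat -> R[i]) l v (w c : R) N : 0 <= w -> ctends u l ->
  (forall M, (N <= M)%N -> w * normc (u M - v) <= c) -> w * normc (l - v) <= c.
Proof.
move=> w0 ul uv; apply/ler_addgt0Pr => e e0.
have w1 : 0 < w + 1 by rewrite ltr_wpDl.
have [N' ulN'] := ul (e / (w + 1)) (divr_gt0 e0 w1).
apply: (@le_trans _ _ (w * (normc (u (maxn N N') - v) + e / (w + 1)))).
  rewrite ler_wpM2l// [leRHS]addrC; apply: le_trans (normc_triangle _ _ (u (maxn N N'))) _.
  by rewrite lerD2r -normcN opprB ulN'// leq_maxr.
rewrite mulrDr lerD ?uv ?leq_maxl// mulrCA ger_pMr// ler_pdivrMr// mul1r.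
by rewrite lerDl.
Qed.

Variable n : nat.
Implicit Types psi : nat -> schwartzType R n.

Definition converges psi (chi : schwartzType R n) := forall s x,
  ctends (fun N => pderivs s (psi N) x) (pderivs s chi x).

Lemma wbound_converges a b psi chi N (rho : schwartzType R n) c : converges psi chi ->
  (forall M, (N <= M)%N -> wbound a b (psi M - rho : schwartzType R n) c) ->
  wbound a b (chi - rho : schwartzType R n) c.
Proof.
move=> pc h s x sb; rewrite pderivsB.
apply: (ctends_le (N := N) (weight_ge0 _ _) (pc s x)) => M NM.
by rewrite -pderivsB h.
Qed.

(** The order of the bounds grows with [N], so every iterated derivative converges uniformly from
    some index on; [differentiable_uniform_limit] identifies the limits of the derivatives as the
    derivatives of the limit. *)
Lemma schwartz_complete psi (r : nat -> R) :
  (forall e : R, 0 < e -> exists N, forall M, (N <= M)%N -> r M <= e) ->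
  (forall N M, (N <= M)%N -> wbound N N (psi M - psi N : schwartzType R n) (r N)) ->
  exists chi, converges psi chi.
Proof.
move=> r0 psir.
have bnd N M s x : (size s <= N <= M)%N ->
    normc (pderivs s (psi M) x - pderivs s (psi N) x) <= r N.
  move=> /andP[sN NM]; rewrite -pderivsB; apply: le_trans (psir N M NM s x sN).
  by rewrite ler_peMl ?normc_ge0// exprn_ege1// weight_ge1.
have /choice[G1 G1P] : forall p : seq 'I_n * 'rV[R]_n, exists l,
    ctends (fun N => pderivs p.1 (psi N) p.2) l.
  move=> [s x] /=; apply: complex_cauchy_limit => e e0.
  have [N rN] := r0 (e / 2) (divr_gt0 e0 (ltr0n _ 2)).
  exists (maxn N (size s)) => M K; rewrite !geq_max => /andP[NM sM] /andP[NK sK].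
  pose P := maxn N (size s).
  have rP : r P <= e / 2 by rewrite rN// leq_maxl.
  apply: le_trans (normc_triangle _ _ (pderivs s (psi P) x)) _.
  rewrite [e]splitr lerD//; first by rewrite (le_trans _ rP)// bnd// leq_maxr geq_max NM sM.
  by rewrite -normcN opprB (le_trans _ rP)// bnd// leq_maxr geq_max NK sK.
pose G s x := G1 (s, x).
have GP s x : ctends (fun N => pderivs s (psi N) x) (G s x) by exact: (G1P (s, x)).
have Gb m s x : (size s <= m)%N ->
    (1 + `|x|) ^+ m * normc (G s x - pderivs s (psi m) x) <= r m.
  move=> sm; apply: (ctends_le (N := m) (weight_ge0 _ _) (GP s x)) => M NM.
  by rewrite -pderivsB psir.
have Gu s (e : R) : 0 < e -> exists N, forall M x, (N <= M)%N ->
    normc (pderivs s (psi M) x - G s x) <= e.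
  move=> e0; have [N rN] := r0 e e0; exists (maxn N (size s)) => M x.
  rewrite geq_max => /andP[NM sM]; apply: le_trans (rN M NM).
  apply: le_trans (Gb M s x sM); rewrite -normcN opprB.
  by rewrite ler_peMl ?normc_ge0// exprn_ege1// weight_ge1.
have sp N := schwartz_fun_smooth (psi N).
have Gd s x : cdifferentiable (G s) x /\ forall i, pderiv i (G s) x = G (i :: s) x.
  have [] := @differentiable_uniform_limit _ _ (fun N => Rep (pderivs s (psi N)))
    (Rep (G s)) (fun i => Rep (G (i :: s))) _ _ _ x.
  - by move=> N y; case: (sp N s y).
  - move=> e /(Gu s)[N GN]; exists N => M y NM.
    by rewrite /Rep -ReB (le_trans (normc_Re_le _))// GN.
  - move=> e e0; have [N GN] : exists N, forall M i x, (N <= M)%N ->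
        normc (pderivs (i :: s) (psi M) x - G (i :: s) x) <= e.
      have /choice[Ni NiP] := fun i => Gu (i :: s) e e0.
      exists (\max_i Ni i) => M i y NM; apply: NiP; apply: leq_trans NM.
      exact: leq_bigmax.
    exists N => M i y NM; apply: le_trans (GN M i y NM).
    by apply: le_trans (normc_Re_le _); rewrite ReB.
  have [] := @differentiable_uniform_limit _ _ (fun N => Imp (pderivs s (psi N)))
    (Imp (G s)) (fun i => Imp (G (i :: s))) _ _ _ x.
  - by move=> N y; case: (sp N s y).
  - move=> e /(Gu s)[N GN]; exists N => M y NM.
    by rewrite /Imp -ImB (le_trans (normc_Im_le _))// GN.
  - move=> e e0; have [N GN] : exists N, forall M i x, (N <= M)%N ->
        normc (pderivs (i :: s) (psi M) x - G (i :: s) x) <= e.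
      have /choice[Ni NiP] := fun i => Gu (i :: s) e e0.
      exists (\max_i Ni i) => M i y NM; apply: NiP; apply: leq_trans NM.
      exact: leq_bigmax.
    exists N => M i y NM; apply: le_trans (GN M i y NM).
    by apply: le_trans (normc_Im_le _); rewrite ImB.
  move=> dI DI dR DR; split=> // i; rewrite /pderiv DR DI /Rep /Imp.
  by case: (G _ _).
have GE s : pderivs s (G [::]) = G s.
  by elim: s => //= i s ->; apply/funext => x; case: (Gd s x).
have sG : smooth (G [::]) by move=> s x; rewrite GE; case: (Gd s x).
have GS : G [::] \in @schwartz R n.
  apply: schwartz_of_wbound => // m.
  have [c pc] := wbound_schwartz m m (psi m).
  exists (r m + c) => s x sm; rewrite GE.
  apply: (@le_trans _ _ ((1 + `|x|) ^+ m * (normc (G s x - pderivs s (psi m) x) +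
     normc (pderivs s (psi m) x)))).
    rewrite ler_wpM2l ?weight_ge0//.
    by rewrite -{1}[G s x](subrK (pderivs s (psi m) x)) le_normcD.
  by rewrite mulrDr lerD ?Gb ?pc.
by exists (SchwartzFun GS) => s x; rewrite /= GE.
Qed.

End completeness.

(** * Uniform boundedness on the Schwartz space *)

Section banach_steinhaus.
Variables (R : realType) (n : nat).
Local Notation S := (schwartzType R n).

Definition seminorm (p : S -> R) :=
  (forall psi chi, p (psi + chi) <= p psi + p chi) /\
  (forall k psi, p (k *: psi) = normc k * p psi).

Definition bounded_by (m : nat) (C : R) (p : S -> R) :=
  forall (psi : S) k, wbound m m psi k -> p psi <= C * k.

Lemma seminormB p psi chi : seminorm p -> p psi <= p (psi - chi) + p chi.
Proof. by case=> pD _; rewrite -{1}[psi](subrK chi) pD. Qed.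

Lemma seminorm_ge0 p psi : seminorm p -> 0 <= p psi.
Proof.
move=> [pD pZ]; have := pD psi (-1 *: psi).
rewrite pZ normcN Normc.normc1 mul1r scaleN1r subrr.
have -> : p 0 = 0 by have := pZ 0 0; rewrite scaler0 Normc.normc0 mul0r.
by rewrite -mulr2n pmulrn_lge0.
Qed.

Lemma seminorm_real p (c : R) psi : seminorm p -> 0 <= c ->
  p (c%:C%C *: psi) = c * p psi.
Proof. by move=> [_ ->] c0; rewrite normc_real ger0_norm. Qed.

Lemma wboundZ a b (c k : R) (psi : S) : 0 <= c -> wbound a b psi k ->
  wbound a b (c%:C%C *: psi : S) (c * k).
Proof.
move=> c0 pk.
have h := wbound_lin c%:C%C (schwartz_fun_smooth psi) (schwartz_fun_smooth (0 : S)) pk.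
have /h : wbound a b (0 : S) 0.
  by move=> s x _; rewrite (_ : schwartz_fun 0 = 0)// pderivs0 Normc.normc0 mulr0.
by rewrite !addr0 normc_real ger0_norm.
Qed.

(** A ball around [rho] is moved to the origin: [p (a psi) <= p (a psi + rho) + p rho <= 2 K] as
    soon as [a psi] has size at most [c]. *)
Lemma bounded_of_ball (T : Type) (p : T -> S -> R) (V : set T) m (c K : R) (rho : S) :
  0 < c -> (forall t, V t -> seminorm (p t)) ->
  (forall t chi, V t -> wbound m m (chi - rho : S) c -> p t chi <= K) ->
  forall t, V t -> bounded_by m (2 * K / c) (p t).
Proof.
move=> c0 sp h t Vt psi k pk; apply/ler_addgt0Pr => e e0.
have k0 := wbound_ge0 pk.
have pr : p t rho <= K.
  apply: h => //; rewrite subrr => s x _.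
  by rewrite (_ : schwartz_fun 0 = 0)// pderivs0 Normc.normc0 mulr0 ltW.
have K0 : 0 <= K by apply: le_trans pr; exact/seminorm_ge0/sp.
(* [psi] is divided by [k + eta] since [k] may vanish; this [eta] costs at most [e] in the final
   bound. *)
pose eta := e * c / (2 * K + 1).
have D0 : 0 < 2 * K + 1 by rewrite ltr_wpDl// mulr_ge0.
have eta0 : 0 < eta by rewrite divr_gt0// mulr_gt0.
have ke0 : 0 < k + eta by rewrite ltr_wpDl.
pose a := c / (k + eta); have a0 : 0 < a by rewrite divr_gt0.
have pa : p t (a%:C%C *: psi) <= K + K.
  apply: le_trans (_ : _ <= p t (a%:C%C *: psi + rho) + p t rho) _.
    have := seminormB (a%:C%C *: psi) (- rho) (sp t Vt).
    rewrite opprK; congr (_ <= _ + _).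
    by rewrite -scaleN1r (proj2 (sp t Vt)) normcN Normc.normc1 mul1r.
  rewrite lerD// h// addrK; apply: (wbound_le (leqnn _) (leqnn _) _ (wboundZ (ltW a0) pk)).
  by rewrite /a mulrAC ler_pdivrMr// ler_wpM2l ?(ltW c0)// lerDl ltW.
rewrite (seminorm_real _ (sp t Vt) (ltW a0)) in pa.
apply: (@le_trans _ _ ((K + K) / a)); first by rewrite ler_pdivlMr// mulrC.
have -> : (K + K) / a = 2 * K / c * k + 2 * K / c * eta.
  by rewrite /a; field; rewrite !gt_eqF.
rewrite lerD2l /eta.
have -> : 2 * K / c * (e * c / (2 * K + 1)) = e * (2 * K / (2 * K + 1)).
  by field; rewrite !gt_eqF.
by rewrite ger_pMr// ler_pdivrMr// mul1r lerDl.
Qed.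

(* Baire category along a decreasing sequence of parameter sets: nested balls
   avoiding every [p t <= N on V N] would have a common point. *)
Lemma banach_steinhaus (T : Type) (p : T -> S -> R) (V : nat -> set T) :
  (forall t, V 0%N t -> seminorm (p t)) ->
  (forall t, V 0%N t -> exists m C, bounded_by m C (p t)) ->
  (forall N, V N `<=` V 0%N) ->
  (forall psi, exists N, forall t, V N t -> p t psi <= N%:R) ->
  exists N m C, forall t, V N t -> bounded_by m C (p t).
Proof.
move=> sp cp V0 pw; apply: contrapT => nH.
(* Were all [p t] with [t] in [V N] at most [N] on some ball, [bounded_of_ball] would give the
   conclusion; so every ball contains a violation. *)
have H N m (c : R) (rho : S) : 0 < c -> exists chi : S, exists2 t, V N t &
    wbound m m (chi - rho : S) c /\ N%:R < p t chi.
  move=> c0; apply: contrapT => nex; apply: nH; exists N, m, (2 * N%:R / c).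
  apply: (@bounded_of_ball _ p (V N) m c N%:R rho) => // [t /V0 /sp//|t chi Vt chir].
  by rewrite leNgt; apply/negP => lt; apply: nex; exists chi, t.
(* A state is a centre, an order and a radius; the next ball sits inside the current one, and some
   [p t] with [t] in [V N] exceeds [N] on all of it. *)
pose Q N (st st' : S * nat * R) := [/\ 0 < st'.2, st'.2 <= st.2 / 2, st'.2 <= N.+1%:R^-1,
  (maxn st.1.2 N.+1 <= st'.1.2)%N & wbound st.1.2 st.1.2 (st'.1.1 - st.1.1 : S) (st.2 / 2) /\
  exists2 t, V N t & forall psi : S,
    wbound st'.1.2 st'.1.2 (psi - st'.1.1 : S) st'.2 -> N%:R < p t psi].
have step (q : nat * (S * nat * R)) : exists st', 0 < q.2.2 -> Q q.1 q.2 st'.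
  case: q => N [[rho m] c] /=; have [c0|] := boolP (0 < c); last by exists (rho, m, c).
  have [chi [t Vt [chir ptchi]]] := H N m (c / 2) rho (divr_gt0 c0 (ltr0n _ 2)).
  have st := sp t (V0 _ _ Vt); have [m' [C pC]] := cp t (V0 _ _ Vt).
  (* Within radius [gap] the value of [p t] loses at most half of its excess over [N], hence stays
     above [N]. *)
  pose D := 2 * (`|C| + 1); have D0 : 0 < D by rewrite mulr_gt0// ltr_wpDl.
  pose gap := (p t chi - N%:R) / D.
  have gap0 : 0 < gap by rewrite divr_gt0// subr_gt0.
  pose c' := Num.min (c / 2) (Num.min N.+1%:R^-1 gap).
  exists (chi, maxn m' (maxn m N.+1), c') => _; split => //=.
  - by rewrite !lt_min gap0 divr_gt0//= invr_gt0 ltr0n.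
  - by rewrite ge_min lexx.
  - by rewrite !ge_min lexx orbT.
  - exact: leq_maxr.
  - split=> //; exists t => // psi psichi.
    have /pC : wbound m' m' (chi - psi : S) c'.
      have -> : chi - psi = (-1)%:C%C *: (psi - chi) by rewrite rmorphN1 scaleN1r opprB.
      move=> s x sm'; have := psichi s x (leq_trans sm' (leq_maxl _ _)).
      have -> : (-1)%:C%C *: (psi - chi) = (chi - psi) by rewrite rmorphN1 scaleN1r opprB.
      rewrite !pderivsB -normcN opprB; apply: le_trans.
      by rewrite ler_wpM2r ?normc_ge0// ler_weXn2l ?weight_ge1// leq_maxl.
    move=> h; have := seminormB chi psi st.
    have c'gap : c' <= gap by rewrite !ge_min lexx !orbT.
    have c'0 : 0 <= c'.
      by rewrite !le_min (ltW gap0) divr_ge0 ?(ltW c0)// invr_ge0 ler0n.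
    have : C * c' <= (p t chi - N%:R) / 2.
      apply: (@le_trans _ _ ((`|C| + 1) * gap)).
        by rewrite (le_trans (ler_norm _))// normrM ler_pM// ?lerDl// ger0_norm.
      have -> : (`|C| + 1) * gap = (p t chi - N%:R) / 2; last by [].
      by rewrite /gap /D; field; rewrite gt_eqF// ltr_wpDl.
    by move: ptchi h; lra.
have /choice[F FP] := step.
pose st := fix st N := if N is N'.+1 then F (N', st N') else (0 : S, 0%N, 1 : R).
have st_gt0 N : 0 < (st N).2.
  by elim: N => [//|N IH]; have [] := FP (N, st N) IH.
have stQ N : Q N (st N) (st N.+1) by exact: FP (N, st N) (st_gt0 N).
have stm N : (N <= (st N).1.2)%N.
  case: N => // N; have [_ _ _ + _] := stQ N; apply: leq_trans; exact: leq_maxr.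
(* The difference of the radii is the form that survives the induction; it is below the first
   radius, so later centres stay in earlier balls, and so does their limit. *)
have nested N M : (N <= M)%N -> ((st N).1.2 <= (st M).1.2)%N /\
    wbound (st N).1.2 (st N).1.2 ((st M).1.1 - (st N).1.1 : S) ((st N).2 - (st M).2).
  elim: M => [|M IH].
    rewrite leqn0 => /eqP ->; split=> // s x _.
    by rewrite !subrr (_ : schwartz_fun 0 = 0)// pderivs0 Normc.normc0 mulr0.
  rewrite leq_eqVlt => /orP[/eqP<-|].
    split=> // s x _.
    by rewrite !subrr (_ : schwartz_fun 0 = 0)// pderivs0 Normc.normc0 mulr0.
  move=> /IH[NM wNM]; have [_ c2 _ mM [wM _]] := stQ M; split.
    by apply: leq_trans NM _; apply: leq_trans mM; exact: leq_maxl.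
  rewrite -[(st M.+1).1.1](subrK (st M).1.1) -addrA.
  have -> : (st N).2 - (st M.+1).2 = ((st M).2 - (st M.+1).2) + ((st N).2 - (st M).2) by ring.
  apply: wboundD => //; apply: (wbound_le NM NM _ wM).
  by move: c2; lra.
have [chi chiP] : exists chi, converges (fun N => (st N).1.1) chi.
  apply: (@schwartz_complete _ _ _ (fun N => (st N).2)).
    move=> e e0; have [N eN] : exists N, N.+1%:R^-1 <= e.
      exists (Num.truncn e^-1); rewrite invf_ple ?posrE ?ltr0n//.
      by rewrite ltW// truncnS_gt.
    exists N.+1 => -[//|M]; rewrite ltnS => NM; have [_ _ + _ _] := stQ M.
    move=> /le_trans; apply; apply: le_trans eN.
    by rewrite lef_pV2 ?posrE ?ltr0n// ler_nat ltnS.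
  move=> N M /nested[_]; apply: wbound_le => //.
  by rewrite gerBl ltW.
have [N pN] := pw chi.
have [_ _ _ _ [_ [t Vt]]] := stQ N.
move=> /(_ chi) h; suff /h : wbound (st N.+1).1.2 (st N.+1).1.2
  (chi - (st N.+1).1.1 : S) (st N.+1).2 by rewrite ltNge pN.
apply: (wbound_converges (N := N.+1) chiP) => [M NM].
by have [_] := nested _ _ NM; apply: wbound_le => //; rewrite gerBl ltW.
Qed.

End banach_steinhaus.

(** * Rescaled test functions and the forward implication *)

Section rescaling.
Variables (R : realType) (n : nat).
Local Notation S := (schwartzType R n).
Implicit Types (psi chi phi : S) (x : 'rV[R]_n) (y e : R).

(** Growth of the order [m] bounds of [rescale psi x y]: one factor each for moving the weight, for
    the normalisation [y ^- n], and for at most [m] derivatives. *)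
Definition rescale_factor (m : nat) x y : R :=
  (1 + `|x| + y) ^+ m * y ^- n * (1 + y^-1) ^+ m.

Lemma wbound_rescale m psi c x y : 0 < y -> wbound m m psi c ->
  wbound m m (rescale psi x y) (rescale_factor m x y * c).
Proof.
move=> y0 pc s t sm; rewrite pderivs_rescale Normc.normcM normc_real.
have yV0 : 0 <= y^-1 by rewrite invr_ge0 ltW.
rewrite ger0_norm; last by rewrite mulr_ge0// invr_ge0 exprn_ge0// ltW.
have c0 := wbound_ge0 pc.
apply: (@le_trans _ _ ((1 + `|x| + y) ^+ m * (1 + `|y^-1 *: (t - x)|) ^+ m *
    (y ^- n * (1 + y^-1) ^+ m * normc (pderivs s psi (y^-1 *: (t - x)))))).
  apply: ler_pM; rewrite ?weight_ge0// ?mulr_ge0 ?normc_ge0 ?invr_ge0 ?exprn_ge0 ?(ltW y0)//.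
    rewrite -exprMn lerXn2r ?nnegrE ?(ltW (weight_gt0 _))//.
      by rewrite mulr_ge0// addr_ge0// ?(ltW y0)// addr_ge0.
    have := @weight_affine _ _ y^-1 x t; rewrite invr_eq0 gt_eqF// => /(_ isT).
    by rewrite ger0_norm// invrK.
  rewrite ler_wpM2r ?normc_ge0// ler_wpM2l ?invr_ge0 ?exprn_ge0 ?(ltW y0)//.
  rewrite -exprVn; apply: (@le_trans _ _ ((1 + y^-1) ^+ size s)).
    by rewrite lerXn2r ?nnegrE ?addr_ge0// lerDr.
  by rewrite ler_weXn2l// lerDl.
have := pc s (y^-1 *: (t - x)) sm.
move: (normc _) (1 + `|y^-1 *: _|) => u v uv.
rewrite [leLHS](_ : _ = rescale_factor m x y * (v ^+ m * u)); last first.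
  by rewrite mulrACA [v ^+ m * _]mulrC mulrA mulrA -mulrA [u * _]mulrC mulrA.
by rewrite ler_wpM2l// /rescale_factor !mulr_ge0 ?invr_ge0 ?exprn_ge0 ?addr_ge0 ?(ltW y0).
Qed.

Lemma rescale_factor_ge0 m x y : 0 < y -> 0 <= rescale_factor m x y.
Proof.
by move=> y0; rewrite !mulr_ge0 ?invr_ge0 ?exprn_ge0 ?addr_ge0 ?invr_ge0 ?(ltW y0).
Qed.

Lemma rescaleD psi chi x y : rescale (psi + chi) x y = rescale psi x y + rescale chi x y.
Proof.
by apply/val_inj/funext => t; rewrite /= !fctE mulrDr.
Qed.

Lemma rescaleZ k psi x y : rescale (k *: psi) x y = k *: rescale psi x y.
Proof.
by apply/val_inj/funext => t; rewrite /= !fctE mulrCA.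
Qed.

(** Makes the transform at [(x0 + e x, e y)] a pairing of the dilated functional with the test
    function [rescale phi x y]; both implications rest on this reading. *)
Lemma rescale_comp psi x y x0 e : e != 0 -> y != 0 ->
  rescale (rescale psi x y) x0 e = rescale psi (x0 + e *: x) (e * y).
Proof.
move=> e0 y0; apply/val_inj/funext => t /=.
rewrite mulrA -rmorphM/= exprMn [in RHS]invfM; congr (_ * psi _).
rewrite [e * y]mulrC invfM -scalerA; congr (_ *: _).
by rewrite opprD addrA [in RHS]scalerBr scalerA mulVf// scale1r.
Qed.

Variable E : completeNormedModType R[i].

Lemma rnormE (v : E) : `|v| = (rnorm v)%:C%C.
Proof.
rewrite /rnorm; have := normr_ge0 v; case: `|v| => a b.
by rewrite lecE/= => /andP[/eqP -> _].
Qed.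

Lemma rnorm_ge0 (v : E) : 0 <= rnorm v.
Proof. by have := normr_ge0 v; rewrite rnormE lecR. Qed.

Lemma rnormD (v w : E) : rnorm (v + w) <= rnorm v + rnorm w.
Proof. by rewrite -lecR rmorphD/= -!rnormE ler_normD. Qed.

Lemma rnormZ k (v : E) : rnorm (k *: v) = normc k * rnorm v.
Proof.
by apply: (@complexI R); rewrite -rnormE normrZ rnormE rmorphM/=.
Qed.

Variable f : {linear S -> E}.

Lemma seminorm_pairing x0 e (w : R) : 0 <= w ->
  seminorm (fun psi => rnorm (f (rescale psi x0 e)) / w).
Proof.
move=> w0; split=> [psi chi|k psi].
  by rewrite rescaleD linearD -mulrDl ler_wpM2r ?invr_ge0// rnormD.
by rewrite rescaleZ linearZ/= rnormZ mulrA.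
Qed.

Lemma continuous_bounded : continuous f ->
  exists m (C : R), 0 < C /\ bounded_by m C (fun psi => rnorm (f psi)).
Proof.
move=> /(_ 0)/cvgr_dist_lt/(_ 1 ltr01); rewrite linear0.
case=> m [d d0 hd]; exists m, (4 / d); split; first by rewrite divr_gt0.
move=> psi k pk; apply/ler_addgt0Pr => e e0.
have k0 := wbound_ge0 pk.
have [eta eta0 etae] : exists2 eta, 0 < eta & 4 / d * eta = e.
  by exists (d * e / 4); [rewrite divr_gt0// mulr_gt0|field; rewrite gt_eqF].
pose a := d / 2 / (k + eta).
have ke0 : 0 < k + eta by rewrite ltr_wpDl.
have a0 : 0 < a by rewrite !divr_gt0.
have : rnorm (f (a%:C%C *: psi)) <= 1.
  have /hd : (schwartz_seminorm m (a%:C%C *: psi - 0)%R < d%:E)%E.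
    rewrite subr0; apply: (@le_lt_trans _ _ (d / 2)%:E); last first.
      by rewrite lte_fin ltr_pdivrMr// ltr_pMr// ltr1n.
    apply: schwartz_seminorm_le => s x sm; rewrite lee_fin.
    apply: le_trans (wboundZ (ltW a0) pk x sm) _.
    rewrite /a mulrAC ler_pdivrMr// ler_wpM2l ?divr_ge0 ?(ltW d0)//.
    by rewrite lerDl ltW.
  by rewrite /= sub0r normrN rnormE -[1]/(1%:C)%C ltcR => /ltW.
rewrite linearZ rnormZ normc_real ger0_norm ?(ltW a0)// => h.
have -> : 4 / d * k + e = 4 / d * (k + eta) by rewrite mulrDr etae.
apply: (@le_trans _ _ (1 / a)); first by rewrite ler_pdivlMr// mulrC.
rewrite (_ : 1 / a = 2 / d * (k + eta)).
  by rewrite ler_wpM2r ?(ltW ke0)// ler_wpM2r ?invr_ge0 ?(ltW d0)// ler_nat.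
by rewrite /a; field; rewrite !gt_eqF.
Qed.

(** Continuity alone gives this polynomial bound; it serves where a ray leaves the range of the
    hypothesis. *)
Lemma phi_transform_bound phi : continuous f -> exists m (C : R), 0 < C /\
  forall x y, 0 < y -> rnorm (f (rescale phi x y)) <= C * rescale_factor m x y.
Proof.
move=> /continuous_bounded[m [C [C0 fC]]].
have [c pc] := wbound_schwartz m m phi.
exists m, (C * (c + 1)); split; first by rewrite mulr_gt0// ltr_wpDl// (wbound_ge0 pc).
move=> x y y0; apply: le_trans (fC _ _ (wbound_rescale x y0 pc)) _.
rewrite -mulrA ler_wpM2l ?(ltW C0)// mulrC ler_wpM2r ?rescale_factor_ge0//.
by rewrite lerDl.
Qed.

Lemma half_sphere_le (p : 'rV[R]_n * R) : half_sphere p -> `|p.1| <= 1 /\ p.2 <= 1.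
Proof.
case: p => x y [/= xy y0]; split; last first.
  rewrite -(ler_pXn2r (n := 2)) ?nnegrE ?(ltW y0)// expr1n -xy lerDr.
  by apply: sumr_ge0 => i _; exact: sqr_ge0.
rewrite [leLHS]mx_normrE; apply: bigmax_le => // -[i j] _ /=; rewrite ord1.
rewrite -(ler_pXn2r (n := 2)) ?nnegrE// expr1n -xy (bigD1 j)//= real_normK ?num_real//.
rewrite -addrA lerDl addr_ge0 ?sqr_ge0//.
by apply: sumr_ge0 => k _; exact: sqr_ge0.
Qed.

Lemma transform_bound_of_weak_bound phi x0 (w : R -> R) (V : nat -> set R) :
  continuous f ->
  (forall e, V 0%N e -> 0 < e /\ 0 < w e) -> (forall N, V N `<=` V 0%N) ->
  (forall psi, exists N, forall e, V N e ->
     rnorm (f (rescale psi x0 e)) / w e <= N%:R) ->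
  exists N k C, forall e p, V N e -> half_sphere p ->
    p.2 ^+ k / w e * rnorm (f (rescale phi (x0 + e *: p.1) (e * p.2))) <= C.
Proof.
move=> cf w0 V0 fw; have [m0 [C0 [C00 fC0]]] := continuous_bounded cf.
have := @banach_steinhaus R n R (fun e psi => rnorm (f (rescale psi x0 e)) / w e) V.
move=> [e /w0[_ /ltW]| e /w0[e0 we]| // | // |N [m [C BS]]].
- exact: seminorm_pairing.
- exists m0, (C0 * rescale_factor m0 x0 e / w e) => psi k pk.
  rewrite mulrAC ler_wpM2r ?invr_ge0 ?(ltW we)// -mulrA.
  exact/fC0/wbound_rescale.
have [c pc] := wbound_schwartz m m phi.
have c0 := wbound_ge0 pc.
(* The power [n + m] cancels [y ^- n] and turns [(1 + y^-1) ^+ m] into [(y + 1) ^+ m]; on the half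
   sphere the remaining factors are at most [3 ^+ m] and [2 ^+ m]. *)
exists N, (n + m)%N, (`|C| * (3 ^+ m * 2 ^+ m * c)) => e p Ve hp.
have [p1 p2] := half_sphere_le hp; have /= y0 := proj2 hp.
have [e0 we] := w0 _ (V0 _ _ Ve).
rewrite mulrAC -mulrA -rescale_comp ?gt_eqF//.
have := BS e Ve _ _ (wbound_rescale p.1 y0 pc).
set A := rnorm _ / _ => hA.
have yk0 : 0 <= p.2 ^+ (n + m) by rewrite exprn_ge0// ltW.
apply: le_trans (ler_wpM2l yk0 hA) _.
rewrite mulrCA [p.2 ^+ _ * _]mulrA.
have rf0 := rescale_factor_ge0 m p.1 y0.
apply: (@le_trans _ _ (`|C| * (p.2 ^+ (n + m) * rescale_factor m p.1 p.2 * c))).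
  by apply: ler_wpM2r (ler_norm _); exact: mulr_ge0 (mulr_ge0 yk0 rf0) c0.
rewrite ler_wpM2l//; apply: ler_wpM2r => //.
have -> : p.2 ^+ (n + m) * rescale_factor m p.1 p.2 = (1 + `|p.1| + p.2) ^+ m * (p.2 + 1) ^+ m.
  rewrite (_ : p.2 + 1 = p.2 * (1 + p.2^-1)); last by rewrite mulrDr mulr1 mulfV// gt_eqF.
  rewrite exprMn /rescale_factor exprD; have : p.2 ^+ n != 0 by rewrite expf_neq0// gt_eqF.
  by move: (p.2 ^+ n) => z z0; field.
by apply: ler_pM; rewrite ?exprn_ge0 ?addr_ge0 ?(ltW y0)//;
  rewrite lerXn2r ?nnegrE ?addr_ge0 ?(ltW y0)//; move: p1 p2; lra.
Qed.

End rescaling.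

(** * Riemann sums on the line with an explicit rate *)

Section one_dim_riemann.
Variable R : realType.
Local Notation mu := (@lebesgue_measure R).

Lemma normr_Rintegral_le (D : set (measurableTypeR R)) (F G : measurableTypeR R -> R) :
  measurable D -> mu.-integrable D (EFin \o F) -> mu.-integrable D (EFin \o G) ->
  (forall t, D t -> `|F t| <= G t) ->
  `|\int[mu]_(t in D) F t| <= \int[mu]_(t in D) G t.
Proof.
move=> mD iF iG FG; apply: le_trans (le_normr_Rintegral mD iF) _.
apply: le_Rintegral => //; first by have := integrable_abse iF.
Qed.

(** Two powers make sums and integrals finite; the third yields the factor [1 / l] on the tails
    beyond [l]. *)
Definition cubic_decay (t : R) : R := (1 + `|t|) ^- 3.

Lemma cubic_decay_gt0 t : 0 < cubic_decay t.
Proof. by rewrite invr_gt0 exprn_gt0// ltr_pwDl. Qed.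

Lemma oneDabs_ge1 (t : R) : 1 <= 1 + `|t|. Proof. by rewrite lerDl. Qed.

Lemma cubic_decay_le2 t : cubic_decay t <= (1 + `|t|) ^- 2.
Proof.
rewrite lef_pV2 ?posrE ?exprn_gt0 ?ltr_pwDl//.
by rewrite ler_weXn2l ?oneDabs_ge1.
Qed.

(* (1 + |t|)^-2 is the derivative of t / (1 + |t|). *)
Lemma decay_telescope (t h : R) : 0 < h <= 1 ->
  h * (1 + `|t|) ^- 2 <= 2 * ((t + h) / (1 + `|t + h|) - t / (1 + `|t|)).
Proof.
move=> /andP[h0 h1].
have [t0|t0] := lerP 0 t.
  have th0 : 0 <= t + h by rewrite addr_ge0// ltW.
  rewrite !ger0_norm// -subr_ge0.
  have -> : 2 * ((t + h) / (1 + (t + h)) - t / (1 + t)) - h * (1 + t) ^- 2 =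
    h * (1 + t - h) / ((1 + (t + h)) * (1 + t) ^+ 2).
    by field; rewrite !gt_eqF//; move: t0 th0; lra.
  rewrite divr_ge0 ?mulr_ge0 ?exprn_ge0//; move: t0 h0 h1; lra.
have [th0|th0] := lerP 0 (t + h).
  rewrite (ger0_norm th0) (ltr0_norm t0) -subr_ge0.
  have -> : 2 * ((t + h) / (1 + (t + h)) - t / (1 - t)) - h * (1 - t) ^- 2 =
     ((2 * (t + h) * (1 - t) - 2 * t * (1 + (t + h))) * (1 - t) - h * (1 + (t + h))) /
     ((1 + (t + h)) * (1 - t) ^+ 2).
    by field; rewrite !gt_eqF//; move: t0 th0; lra.
  apply: divr_ge0; last by rewrite mulr_ge0 ?exprn_ge0//; move: t0 th0; lra.
  nra.
rewrite (ltr0_norm th0) (ltr0_norm t0) -subr_ge0.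
have -> : 2 * ((t + h) / (1 - (t + h)) - t / (1 - t)) - h * (1 - t) ^- 2 =
   h * (2 * (1 - t) - (1 - (t + h))) / ((1 - (t + h)) * (1 - t) ^+ 2).
  by field; rewrite !gt_eqF//; move: t0 th0; lra.
by rewrite divr_ge0 ?mulr_ge0 ?exprn_ge0//; move: t0 th0 h0 h1; lra.
Qed.

Variable l : nat.
Hypothesis l0 : (0 < l)%N.
Let lR0 : 0 < l%:R :> R. Proof. by rewrite ltr0n. Qed.
Let h := l%:R^-1 : R.
Let h0 : 0 < h. Proof. by rewrite invr_gt0. Qed.
Let h1 : h <= 1. Proof. by rewrite invf_le1// ler1n. Qed.

(** Mesh [1 / l] starting at [- l]: with the range [2 * l * l] of [nodes], one parameter both
    refines the mesh and exhausts the line. *)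
Definition node (z : nat) : R := z%:R / l%:R - l%:R.

Definition nodes := [seq node z | z <- index_iota 0 (2 * l * l)].

Lemma nodeS z : node z.+1 = node z + h.
Proof. by rewrite /node -natr1 mulrDl mul1r addrAC. Qed.

(** Telescoping [t / (1 + |t|)], which stays in [[-1, 1]], leaves 2 times 2 for every [l]. *)
Lemma sum_nodes_le : \sum_(t <- nodes) h * (1 + `|t|) ^- 2 <= 4.
Proof.
rewrite /nodes big_map.
pose F (t : R) := t / (1 + `|t|).
have FE t : `|F t| <= 1.
  by rewrite normrM normfV (ger0_norm (addr_ge0 _ _))// ler_pdivrMr ?ltr_pwDl// mul1r lerDr.
apply: (@le_trans _ _ (\sum_(0 <= z < 2 * l * l) 2 * (F (node z.+1) - F (node z)))).
  by apply: ler_sum => z _; rewrite nodeS; apply: decay_telescope; rewrite h0.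
rewrite -mulr_sumr telescope_sumr//.
by have := FE (node (2 * l * l)); have := FE (node 0); rewrite !ler_norml; lra.
Qed.

Lemma sum_nodes_cubic : \sum_(t <- nodes) h * cubic_decay t <= 4.
Proof.
apply: le_trans sum_nodes_le; apply: ler_sum => t _.
by rewrite ler_wpM2l ?(ltW h0)// cubic_decay_le2.
Qed.

Definition decay_majorant (t : R) : R := (oneDsqr t)^-1.

Lemma integrable_decay : mu.-integrable setT (EFin \o decay_majorant).
Proof.
apply/integrableP; split.
  apply/measurable_EFinP; apply: continuous_measurable_fun; exact: continuous_oneDsqrV.
have d0 x : 0 <= decay_majorant x by rewrite invr_ge0.
under eq_integral do rewrite /= ger0_norm//.
rewrite ge0_symfun_integralT//.
- by rewrite -set_itvcy integral0y_oneDsqr -EFinM ltry.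
- exact: continuous_oneDsqrV.
- by move=> x; rewrite /decay_majorant /= /oneDsqr sqrrN.
Qed.

Lemma cubic_decay_le_majorant t : cubic_decay t <= (1 + `|t|)^-1 * decay_majorant t.
Proof.
rewrite /cubic_decay /decay_majorant -invfM lef_pV2 ?posrE ?mulr_gt0 ?exprn_gt0 ?ltr_pwDl//.
rewrite exprS ler_wpM2l// ?addr_ge0// /oneDsqr.
rewrite -(real_normK (num_real t)); by have := normr_ge0 t; nra.
exact: sqr_ge0.
Qed.

Variables (I : R -> R) (C : R).
Hypothesis IC : forall t, `|I t| <= C * cubic_decay t.
Hypothesis IL : forall t t', `|t - t'| <= 1 -> `|I t - I t'| <= C * `|t - t'| * cubic_decay t.

Let C0 : 0 <= C.
Proof.
have := le_trans (normr_ge0 _) (IC 0).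
by rewrite pmulr_lge0// cubic_decay_gt0.
Qed.

Lemma continuous_of_decay : continuous I.
Proof.
move=> t; apply/cvgrPdist_le => e e0; have C1 : 0 < C + 1 by rewrite ltr_wpDl.
apply/nbhs_ballP; exists (Num.min 1 (e / (C + 1))).
  by rewrite /= lt_min ltr01 divr_gt0.
move=> t' /=; rewrite lt_min => /andP[/ltW tt1 /ltW tt2].
apply: le_trans (IL tt1) _; rewrite -mulrA.
apply: (@le_trans _ _ ((C + 1) * (`|t - t'| * 1))).
  rewrite ler_pM ?mulr_ge0 ?(ltW (cubic_decay_gt0 _)) ?lerDl// ler_wpM2l//.
  by rewrite invf_le1 ?exprn_gt0 ?ltr_pwDl// exprn_ege1// oneDabs_ge1.
by rewrite mulr1 mulrC -ler_pdivlMr.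
Qed.

Lemma integrable_of_decay (D : set (measurableTypeR R)) :
  measurable D -> mu.-integrable D (EFin \o I).
Proof.
move=> mD; apply: (@integrableS _ _ _ _ setT) => //.
have := integrableZl measurableT C integrable_decay.
apply: le_integrable => //.
  apply/measurable_EFinP; apply: continuous_measurable_fun; exact: continuous_of_decay.
move=> t _; rewrite -EFinM /= lee_fin (le_trans (IC t))//.
rewrite ger0_norm ?mulr_ge0 ?invr_ge0// ler_wpM2l//.
rewrite (le_trans (cubic_decay_le_majorant t))// ler_piMl ?invr_ge0//.
by rewrite invf_le1 ?ltr_pwDl// oneDabs_ge1.
Qed.


Lemma integral_cell_le z :
  `|\int[mu]_(t in `](node z), (node z.+1)]) I t - h * I (node z)| <=
  C * h * (h * cubic_decay (node z)).
Proof.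
set D : set (measurableTypeR R) := `](node z), (node z.+1)]%classic.
have muD : fine (mu D) = h.
  rewrite lebesgue_measure_itv /= lte_fin nodeS ltrDl h0 /=.
  by rewrite addrAC subrr add0r.
have mD : measurable D by exact: measurable_itv.
have Dfin : (mu D < +oo)%E.
  by rewrite /D lebesgue_measure_itv /=; case: ifP => _; rewrite -?EFinB ltry.
have ic r : mu.-integrable D (EFin \o cst r).
  apply: measurable_bounded_integrable => //.
  exact: bounded_cst.
have -> : h * I (node z) = \int[mu]_(t in D) I (node z).
  by rewrite Rintegral_cst// muD mulrC.
rewrite -RintegralB//; last 2 first.
- exact: integrable_of_decay.
- exact: ic.
have iB : mu.-integrable D (EFin \o (fun t => I t - I (node z))).
  apply: (@integrableB _ _ _ mu D mD (EFin \o I) (EFin \o cst (I (node z)))).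
    exact: integrable_of_decay.
  exact: ic.
have -> : C * h * (h * cubic_decay (node z)) =
    \int[mu]_(t in D) (C * h * cubic_decay (node z)).
  by rewrite Rintegral_cst// muD; ring.
apply: normr_Rintegral_le => //; first exact: ic.
move=> t; rewrite /D/= in_itv/= => /andP[zt tz].
have zt1 : `|node z - t| <= h.
  by rewrite ltr0_norm ?subr_lt0//; move: zt tz; rewrite nodeS; lra.
rewrite distrC (le_trans (IL (le_trans zt1 h1)))//.
by rewrite ler_wpM2r ?(ltW (cubic_decay_gt0 _))// ler_wpM2l.
Qed.

Lemma node_mono z k : (z <= k)%N -> node z <= node k.
Proof. by move=> zk; rewrite lerD2r ler_wpM2r ?(ltW h0)// ler_nat. Qed.

Lemma integral_nodes k : \int[mu]_(t in `](node 0), (node k)]) I t =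
  \sum_(0 <= z < k) \int[mu]_(t in `](node z), (node z.+1)]) I t.
Proof.
elim: k => [|k IH].
  by rewrite big_geq// set_itv_ge ?bnd_simp ?ltxx// Rintegral_set0.
rewrite big_nat_recr//= -IH addrC; apply/eqP; rewrite -subr_eq; apply/eqP.
apply: Rintegral_itvB; rewrite ?bnd_simp ?node_mono//.
by apply: integrable_of_decay; exact: measurable_itv.
Qed.

Definition decay_mass : R := \int[mu]_t decay_majorant t.

Lemma tail_integral_le (D : set (measurableTypeR R)) :
  measurable D -> (forall t, D t -> l%:R <= `|t|) ->
  `|\int[mu]_(t in D) I t| <= C * h * decay_mass.
Proof.
move=> mD Dl; have iv E : measurable E -> mu.-integrable E (EFin \o decay_majorant).
  by move=> mE; apply: integrableS integrable_decay.
apply: (@le_trans _ _ (\int[mu]_(t in D) (C * h * decay_majorant t))).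
  apply: normr_Rintegral_le => //; first exact: integrable_of_decay.
    by have := integrableZl mD (C * h) (iv D mD).
  move=> t /Dl lt; apply: le_trans (IC t) _; rewrite -mulrA ler_wpM2l//.
  apply: le_trans (cubic_decay_le_majorant t) _.
  rewrite ler_wpM2r ?invr_ge0// lef_pV2 ?posrE ?ltr_pwDl//.
  by apply: le_trans lt _; rewrite lerDr.
rewrite RintegralZl ?iv// ler_wpM2l ?mulr_ge0 ?(ltW h0)//.
rewrite /decay_mass -(setUv D) Rintegral_setU ?setUv ?iv//.
- by rewrite lerDl; apply: Rintegral_ge0 => t _; rewrite invr_ge0.
- exact: measurableC.
- exact/disj_setPCl.
Qed.

(** On a cell of length [h] the function moves by at most [C * h] times [cubic_decay] of the node,
    and these weights sum to at most 4; [decay_mass] comes from the tails. *)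
Lemma riemann_sum1 : `|\sum_(t <- nodes) h * I t - \int[mu]_t I t| <= C * (4 + decay_mass) * h.
Proof.
pose D : set (measurableTypeR R) := `](node 0), (node (2 * l * l))]%classic.
have mD : measurable D by exact: measurable_itv.
have -> : \int[mu]_t I t = \int[mu]_(t in D) I t + \int[mu]_(t in ~` D) I t.
  rewrite -[in LHS](setUv D) Rintegral_setU//.
  - exact: measurableC.
  - by apply: integrable_of_decay; rewrite setUv.
  - exact/disj_setPCl.
rewrite opprD addrA mulrDr mulrDl; apply: le_trans (ler_normB _ _) _; apply: lerD; last first.
  rewrite mulrAC; apply: tail_integral_le; first exact: measurableC.
  move=> t; rewrite /D /= in_itv/= /node mul0r sub0r.
  have -> : (2 * l * l)%:R / l%:R - l%:R = l%:R :> R.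
    by rewrite !natrM; field; rewrite gt_eqF.
  move=> /negP; rewrite negb_and -leNgt -ltNge => /orP[tl|lt].
    by rewrite ler0_norm; move: tl lR0; lra.
  by rewrite ger0_norm; move: lt lR0; lra.
rewrite integral_nodes /nodes big_map -sumrB; apply: le_trans (ler_norm_sum _ _ _) _.
apply: (@le_trans _ _ (\sum_(0 <= z < 2 * l * l) C * h * (h * cubic_decay (node z)))).
  by apply: ler_sum => z _; rewrite distrC integral_cell_le.
rewrite -mulr_sumr mulrAC ler_wpM2r ?(ltW h0)// ler_wpM2l//.
by have := sum_nodes_cubic; rewrite /nodes big_map.
Qed.

End one_dim_riemann.

(** * Invariance of the line integral under reflection *)

Section reflection.
Variable R : realType.
Local Notation mu := (@lebesgue_measure R).

Let reflect (c : R) (t : measurableTypeR R) : measurableTypeR R := c - t.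

Let measurable_reflect c : measurable_fun setT (reflect c).
Proof. by apply: measurable_funB => //; exact: measurable_id. Qed.

HB.instance Definition _ c := isMeasurableFun.Build _ _ _ _ (reflect c) (measurable_reflect c).

(** By uniqueness of Lebesgue measure on half-open intervals: reflection exchanges the open and the
    closed end, which leaves the length unchanged. *)
Lemma lebesgue_measure_reflect (c : R) (A : set (measurableTypeR R)) : measurable A ->
  pushforward mu (reflect c) A = mu A.
Proof.
move=> mA; apply/esym/lebesgue_measure_unique => //= _ [[a b]] _ <-.
rewrite /pushforward.
have -> : reflect c @^-1` [set` (`]a, b] : interval R)] = [set` `[c - b, c - a[].
  by rewrite /reflect; apply/seteqP; split => t /=; rewrite !in_itv/= => /andP[u v];
    apply/andP; split; move: u v; lra.
rewrite !lebesgue_measure_itv/= !lte_fin ltrD2l ltrN2; case: ifP => // _.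
by rewrite -!EFinB; congr EFin; ring.
Qed.

Lemma Rintegral_reflect (c : R) (I : R -> R) : continuous I ->
  mu.-integrable setT (EFin \o (fun t => I (c - t))) ->
  \int[mu]_t I (c - t) = \int[mu]_t I t.
Proof.
move=> cI iI; congr fine.
have mI : measurable_fun setT (EFin \o I : measurableTypeR R -> \bar R).
  by apply/measurable_EFinP; apply: continuous_measurable_fun.
have -> : (\int[mu]_t (I t)%:E = \int[pushforward mu (reflect c)]_t (I t)%:E)%E.
  by apply: eq_measure_integral => //= A mA _; exact/esym/lebesgue_measure_reflect.
rewrite (@integral_pushforward _ _ _ _ _ (reflect c) _ _ _ (EFin \o I))//=.
Qed.

End reflection.

(** * Riemann sums for the iterated integral *)

Section riemann_sums.
Variable R : realType.

(** A product over coordinates, so that fixing the first coordinate of a [decaying] function leaves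
    a [decaying] slice whose constant is multiplied by [cubic_decay] of that coordinate. *)
Definition decay n (x : 'rV[R]_n) : R := \prod_i cubic_decay (x 0 i).

Definition decaying n (C : R) (g : 'rV[R]_n -> R) :=
  (forall x, `|g x| <= C * decay x) /\
  (forall x y, `|x - y| <= 1 -> `|g x - g y| <= C * `|x - y| * decay x).

Fixpoint grid n (l : nat) : seq 'rV[R]_n :=
  if n is n'.+1 then [seq row_mx t%:M x | t <- nodes R l, x <- grid n' l] else [:: 0].

Definition riemann n l (g : 'rV[R]_n -> R) : R := \sum_(x <- grid n l) l%:R ^- n * g x.

Definition slice n (g : 'rV[R]_n.+1 -> R) (t : R) (x : 'rV[R]_n) : R :=
  g (row_mx t%:M x).

Lemma decay_gt0 n (x : 'rV[R]_n) : 0 < decay x.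
Proof. by apply: prodr_gt0 => i _; exact: cubic_decay_gt0. Qed.

Lemma row_mx_head n (a : R) (x : 'rV[R]_n) :
  (row_mx a%:M x : 'rV[R]_n.+1) 0 ord0 = a.
Proof.
by rewrite mxE; case: splitP => // j _; rewrite !ord1 mxE eqxx.
Qed.

Lemma row_mx_tail n (a : R) (x : 'rV[R]_n) i :
  (row_mx a%:M x : 'rV[R]_n.+1) 0 (lift ord0 i) = x 0 i.
Proof.
rewrite mxE; case: splitP => j /=; first by rewrite ord1.
by rewrite /bump /= => /addnI/val_inj <-.
Qed.

Lemma decay_row n t (x : 'rV[R]_n) :
  decay (row_mx t%:M x : 'rV[R]_n.+1) = cubic_decay t * decay x.
Proof.
rewrite /decay big_ord_recl row_mx_head; congr (_ * _).
by apply: eq_bigr => i _; rewrite row_mx_tail.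
Qed.

Lemma norm_le_coord n (x : 'rV[R]_n) (c : R) : 0 <= c ->
  (forall i, `|x 0 i| <= c) -> `|x| <= c.
Proof.
move=> c0 xc; rewrite [leLHS]mx_normrE; apply: bigmax_le => // -[i j] _ /=.
by rewrite ord1.
Qed.

Lemma norm_row_mx n (a : R) (x : 'rV[R]_n) :
  `|row_mx a%:M x : 'rV[R]_n.+1| = Num.max `|a| `|x|.
Proof.
apply/eqP; rewrite eq_le; apply/andP; split.
  apply: norm_le_coord; first by rewrite le_max normr_ge0.
  move=> i; case: (unliftP ord0 i) => [j|] ->.
    by rewrite row_mx_tail le_max coord_le_norm orbT.
  by rewrite row_mx_head le_max lexx.
rewrite ge_max; apply/andP; split.
  by rewrite -{1}(row_mx_head a x) coord_le_norm.
by apply: norm_le_coord => // i; rewrite -(row_mx_tail a x i) coord_le_norm.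
Qed.

Lemma row_mxB n (a b : R) (x y : 'rV[R]_n) :
  (row_mx a%:M x : 'rV[R]_n.+1) - row_mx b%:M y = row_mx (a - b)%:M (x - y).
Proof. 
apply/rowP => i; rewrite [LHS]mxE [X in _ + X]mxE.
case: (unliftP ord0 i) => [j|] ->; first by rewrite !row_mx_tail !mxE.
by rewrite !row_mx_head.
Qed.

Lemma norm_row0 n (t t' : R) (x : 'rV[R]_n) :
  `|(row_mx t%:M x : 'rV[R]_n.+1) - row_mx t'%:M x| = `|t - t'|.
Proof. by rewrite row_mxB norm_row_mx subrr normr0 max_l. Qed.

Lemma riemannS n l g : riemann l g = \sum_(t <- nodes R l) l%:R^-1 * @riemann n l (slice g t).
Proof.
rewrite /riemann /= big_allpairs_dep; apply: eq_bigr => t _.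
by rewrite mulr_sumr; apply: eq_bigr => x _; rewrite exprS invfM mulrA.
Qed.

Lemma riemann_decay n l : (0 < l)%N -> riemann l (@decay n) <= 4 ^+ n.
Proof.
move=> l0; elim: n => [|n IH].
  by rewrite /riemann /= big_seq1 /decay big_ord0 !expr0 invr1 mulr1.
rewrite riemannS exprS; apply: le_trans (_ : _ <= (\sum_(t <- nodes R l) l%:R^-1 * cubic_decay t) * 4 ^+ n) _; last first.
  by rewrite ler_wpM2r ?exprn_ge0// sum_nodes_cubic.
rewrite mulr_suml; apply: ler_sum => t _; rewrite -mulrA ler_wpM2l ?invr_ge0//.
apply: (@le_trans _ _ (cubic_decay t * riemann l (@decay n))); last first.
  by rewrite ler_wpM2l// ltW// cubic_decay_gt0.
rewrite /riemann mulr_sumr; apply: ler_sum => x _.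
by rewrite /slice decay_row mulrCA.
Qed.

Lemma riemann_le n l g (C : R) : (0 < l)%N -> 0 <= C ->
  (forall x, `|g x| <= C * decay x) -> `|@riemann n l g| <= C * 4 ^+ n.
Proof.
move=> l0 C0 gC; apply: le_trans (ler_norm_sum _ _ _) _.
apply: (@le_trans _ _ (C * riemann l (@decay n))); last by rewrite ler_wpM2l// riemann_decay.
rewrite /riemann mulr_sumr; apply: ler_sum => x _.
by rewrite normrM ger0_norm ?invr_ge0 ?exprn_ge0// mulrCA ler_wpM2l ?invr_ge0 ?exprn_ge0.
Qed.

Lemma riemannB n l g g' : @riemann n l g - riemann l g' = riemann l (fun x => g x - g' x).
Proof. by rewrite /riemann -sumrB; apply: eq_bigr => x _; rewrite mulrBr. Qed.

Lemma decaying_ge0 n C g : @decaying n C g -> 0 <= C.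
Proof.
move=> [gC _]; have := le_trans (normr_ge0 _) (gC 0).
by rewrite pmulr_lge0// decay_gt0.
Qed.

Lemma decaying_slice n C g t : @decaying n.+1 C g ->
  decaying (C * cubic_decay t) (slice g t).
Proof.
move=> [gC gL]; split=> [x|x y xy]; first by rewrite -mulrA -decay_row gC.
have e : `|(row_mx t%:M x : 'rV[R]_n.+1) - row_mx t%:M y| = `|x - y|.
  by rewrite row_mxB norm_row_mx subrr normr0 max_r.
have := gL (row_mx t%:M x) (row_mx t%:M y); rewrite e decay_row => /(_ xy).
by rewrite /slice mulrA [C * _ * cubic_decay t]mulrAC.
Qed.

(** The rate constant [K] disappears from the bound, so it may be as bad as convenient. *)
Lemma le_of_riemann (a B K : R) (u : nat -> R) : (forall l, `|u l.+1 - a| <= K / l.+1%:R) ->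
  (forall l, `|u l.+1| <= B) -> `|a| <= B.
Proof.
move=> ua uB; apply/ler_addgt0Pr => e e0.
have K0 : 0 <= K by have := le_trans (normr_ge0 _) (ua 0%N); rewrite divr1.
pose l := Num.truncn (K / e).
apply: (@le_trans _ _ (`|u l.+1| + `|u l.+1 - a|)).
  by rewrite -{1}[a](subKr (u l.+1)) ler_normB.
apply: lerD => //; apply: le_trans (ua l) _.
by rewrite ler_pdivrMr ?ltr0n// mulrC -ler_pdivrMr// ltW// truncnS_gt.
Qed.

(** Two errors add up: those of the inner integrals, summed over the nodes with total weight at most
    4, and that of the one-dimensional sum of the inner integral, whose decay constant carries
    [4 ^+ n']. *)
Fixpoint riemann_rate n : R :=
  if n is n'.+1 then 4 * riemann_rate n' + 4 ^+ n' * (4 + decay_mass R) else 0.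

Lemma riemann_rate_ge0 n : 0 <= riemann_rate n.
Proof.
elim: n => //= n IH; rewrite addr_ge0 ?mulr_ge0 ?exprn_ge0 ?addr_ge0//.
by apply: Rintegral_ge0 => t _; rewrite invr_ge0.
Qed.

(* The regularity in [t] of the inner integral is read off its Riemann sums. *)
Lemma inner_integral_decay n C g :
  (forall C' (g' : 'rV[R]_n -> R) l, decaying C' g' ->
    `|riemann l.+1 g' - rV_integral g'| <= C' * riemann_rate n / l.+1%:R) ->
  @decaying n.+1 C g ->
  (forall t, `|rV_integral (slice g t)| <= C * 4 ^+ n * cubic_decay t) /\
  (forall t t', `|t - t'| <= 1 -> `|rV_integral (slice g t) - rV_integral (slice g t')| <=
     C * 4 ^+ n * `|t - t'| * cubic_decay t).
Proof.
move=> IH dg; have C0 := decaying_ge0 dg; have [gC gL] := dg.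
split=> [t|t t' tt].
  apply: (le_of_riemann (u := fun l => riemann l (slice g t))
    (fun l => IH _ _ l (decaying_slice t dg))) => k.
  rewrite mulrAC; apply: riemann_le => //; first by rewrite mulr_ge0// ltW// cubic_decay_gt0.
  by case: (decaying_slice t dg).
pose K := C * (cubic_decay t + cubic_decay t') * riemann_rate n.
  apply: (@le_of_riemann _ _ K (fun l => riemann l (slice g t) - riemann l (slice g t'))) => k.
    rewrite (_ : _ - _ - _ = (riemann k.+1 (slice g t) - rV_integral (slice g t)) -
      (riemann k.+1 (slice g t') - rV_integral (slice g t'))); last by ring.
    apply: le_trans (ler_normB _ _) _; rewrite /K mulrDr !mulrDl.
    by apply: lerD; apply: IH; exact: decaying_slice.
  rewrite riemannB (_ : C * _ * _ * _ = C * `|t - t'| * cubic_decay t * 4 ^+ n); last by ring.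
  apply: riemann_le => //; first by rewrite !mulr_ge0// ltW// cubic_decay_gt0.
  move=> x; rewrite -mulrA -decay_row -(norm_row0 t t' x) /slice gL// norm_row0//.
Qed.

Lemma riemann_rV_integral n C g l : @decaying n C g ->
  `|riemann l.+1 g - rV_integral g| <= C * riemann_rate n / l.+1%:R.
Proof.
elim: n C g l => [|n IH] C g l dg.
  by rewrite /riemann /= big_seq1 expr0 invr1 mul1r subrr normr0 mulr0 mul0r.
have C0 := decaying_ge0 dg; have [gC gL] := dg.
pose I t := rV_integral (slice g t).
have [IC IL] := inner_integral_decay IH dg.
rewrite riemannS.
have -> : rV_integral g = \int[@lebesgue_measure R]_t I t by [].
rewrite -[X in `|X|](subrKA (\sum_(t <- nodes R l.+1) l.+1%:R^-1 * I t)).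
apply: le_trans (ler_normD _ _) _; rewrite [riemann_rate _]/= mulrDr mulrDl; apply: lerD; last first.
  rewrite mulrA; exact: riemann_sum1.
rewrite -sumrB; apply: le_trans (ler_norm_sum _ _ _) _.
apply: (@le_trans _ _ (C * riemann_rate n / l.+1%:R *
   \sum_(t <- nodes R l.+1) l.+1%:R^-1 * cubic_decay t)); last first.
  rewrite mulrAC ler_wpM2r ?invr_ge0// [4 * _]mulrC mulrA ler_wpM2l ?sum_nodes_cubic//.
  by rewrite mulr_ge0// riemann_rate_ge0.
rewrite mulr_sumr; apply: ler_sum => t _.
rewrite -mulrBr normrM ger0_norm ?invr_ge0// mulrCA ler_wpM2l ?invr_ge0//.
apply: le_trans (IH _ _ _ (decaying_slice t dg)) _.
by rewrite le_eqVlt; apply/orP; left; apply/eqP; ring.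
Qed.

Lemma cubic_decay_reflect (a t : R) : cubic_decay (a - t) <= (1 + `|a|) ^+ 3 * cubic_decay t.
Proof.
rewrite /cubic_decay -exprVn -[(1 + `|t|) ^- 3]exprVn -exprMn lerXn2r ?nnegrE ?mulr_ge0 ?invr_ge0//.
rewrite ler_pdivlMr ?ltr_pwDl// mulrC ler_pdivrMr ?ltr_pwDl//.
apply: (@le_trans _ _ (1 + (`|a| + `|a - t|))).
  by rewrite lerD2l -{1}[t](subKr a) ler_normB.
have := mulr_ge0 (normr_ge0 a) (normr_ge0 (a - t)); lra.
Qed.

(** One coordinate at a time: induction reflects the inner integral, and [inner_integral_decay]
    makes it regular enough for the reflection on the line. This is the source of the commutativity
    of convolution. *)
Lemma rV_integral_reflect n C g (x : 'rV[R]_n) : decaying C g ->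
  rV_integral (fun z => g (x - z)) = rV_integral g.
Proof.
elim: n C g x => [|n IH] C g x dg.
  by rewrite /= subr0; congr g; apply/rowP => -[].
have [a [y ->]] : exists a (y : 'rV[R]_n), x = row_mx a%:M y.
  exists (x 0 ord0), (\row_i x 0 (lift ord0 i)); apply/rowP => i.
  case: (unliftP ord0 i) => [j|] ->; last by rewrite row_mx_head.
  by rewrite row_mx_tail mxE.
pose I t := rV_integral (slice g t).
have [IC IL] := inner_integral_decay (@riemann_rV_integral n) dg.
have C0 := decaying_ge0 dg.
rewrite [LHS](_ : _ = \int[@lebesgue_measure R]_t I (a - t)); last first.
  apply: eq_Rintegral => t _; rewrite /I -(IH _ _ y (decaying_slice (a - t) dg)).
  by congr rV_integral; apply/funext => z; rewrite /slice row_mxB.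
apply: Rintegral_reflect.
- by apply: (@continuous_of_decay _ _ (C * 4 ^+ n)).
pose K := C * 4 ^+ n * (1 + `|a|) ^+ 3.
have M0 : 0 <= C * 4 ^+ n by rewrite mulr_ge0// exprn_ge0.
apply: (@integrable_of_decay _ (fun t => I (a - t)) K) => //.
- move=> t; apply: le_trans (IC _) _; rewrite /K -[leRHS]mulrA ler_wpM2l//.
  exact: cubic_decay_reflect.
- move=> t t' tt.
  have e : a - t - (a - t') = t' - t by ring.
  have := IL (a - t) (a - t'); rewrite e distrC => /(_ tt) h; apply: le_trans h _.
  have -> : K * `|t - t'| * cubic_decay t =
    C * 4 ^+ n * `|t - t'| * ((1 + `|a|) ^+ 3 * cubic_decay t) by rewrite /K; ring.
  rewrite ler_wpM2l ?(mulr_ge0 M0)//.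
  exact: cubic_decay_reflect.
Qed.

End riemann_sums.

(** * Discrete convolutions of Schwartz functions *)

Section discrete_convolution.
Variables (R : realType) (n : nat).
Local Notation S := (schwartzType R n).
Implicit Types (psi chi phi : S) (x y z : 'rV[R]_n).

Lemma weight_shift x y : 1 + `|x| <= (1 + `|y|) * (1 + `|x - y|).
Proof.
apply: (@le_trans _ _ (1 + (`|y| + `|x - y|))).
  by rewrite lerD2l -{1}[x](subrK y) addrC ler_normD.
have := mulr_ge0 (normr_ge0 y) (normr_ge0 (x - y)); lra.
Qed.

Lemma weight_shift_exp a x y :
  (1 + `|x|) ^+ a <= (1 + `|y|) ^+ a * (1 + `|x - y|) ^+ a.
Proof.
rewrite -exprMn lerXn2r ?nnegrE ?(ltW (weight_gt0 _)) ?mulr_ge0 ?(ltW (weight_gt0 _))//.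
exact: weight_shift.
Qed.

Lemma weight_near a x y : `|x - y| <= 1 -> (1 + `|x|) ^+ a <= 2 ^+ a * (1 + `|y|) ^+ a.
Proof.
move=> xy; apply: le_trans (weight_shift_exp a x y) _.
rewrite mulrC ler_wpM2r ?exprn_ge0 ?addr_ge0//.
by rewrite lerXn2r ?nnegrE ?addr_ge0//; move: xy; lra.
Qed.

(** Each of the [n] factors of [decay] costs three powers of the norm, which is where every [3 * n]
    below comes from. *)
Lemma inv_weight_le_decay z : (1 + `|z|) ^- (3 * n) <= decay z.
Proof.
rewrite exprM -exprVn -[n in _ ^+ n](card_ord n) -prodr_const /decay.
apply: ler_prod => i _; rewrite invr_ge0 exprn_ge0 ?addr_ge0//=.
rewrite lef_pV2 ?posrE ?exprn_gt0 ?ltr_pwDl//.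
by rewrite lerXn2r ?nnegrE ?addr_ge0// lerD2l coord_le_norm.
Qed.

Lemma wbound_decay a b psi c s z : wbound (a + 3 * n) b psi c -> (size s <= b)%N ->
  (1 + `|z|) ^+ a * normc (pderivs s psi z) <= c * decay z.
Proof.
move=> pc sb; have w0 : 0 < (1 + `|z|) ^+ (3 * n) by rewrite exprn_gt0// weight_gt0.
apply: (@le_trans _ _ (c * (1 + `|z|) ^- (3 * n))); last first.
  by rewrite ler_wpM2l ?(wbound_ge0 pc)// inv_weight_le_decay.
by rewrite ler_pdivlMr// mulrAC -exprD pc.
Qed.

Lemma schwartz_lipschitz a b psi c s x y : wbound a b.+1 psi c -> (size s <= b)%N ->
  `|x - y| <= 1 -> (1 + `|x|) ^+ a * normc (pderivs s psi x - pderivs s psi y) <=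
    2 * n%:R * 2 ^+ a * c * `|x - y|.
Proof.
move=> pc sb xy; have w0 : 0 < (1 + `|x|) ^+ a by rewrite exprn_gt0// weight_gt0.
have := @cmean_value_le R n (pderivs s psi) x (y - x) (2 ^+ a * c * (1 + `|x|) ^- a).
rewrite [x + (y - x)]addrC subrK -normcN opprB [`|y - x|]distrC => h.
have {h} : normc (pderivs s psi x - pderivs s psi y) <=
    2 * (n%:R * `|x - y| * (2 ^+ a * c * (1 + `|x|) ^- a)).
  apply: h => [z|i t /andP[t0 t1]]; first exact: schwartz_fun_smooth.
  rewrite ler_pdivlMr// mulrC.
  have xt : `|x - (x + t *: (y - x))| <= 1.
    rewrite opprD addrA subrr add0r normrN normrZ ger0_norm// distrC.
    by rewrite mulr_ile1.
  apply: le_trans (ler_wpM2r (normc_ge0 _) (weight_near a xt)) _.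
  rewrite -mulrA ler_wpM2l ?exprn_ge0//; exact: (pc (i :: s)).
rewrite -(ler_pM2l w0) => /le_trans; apply.
rewrite le_eqVlt; apply/orP; left; apply/eqP.
by move: ((1 + `|x|) ^+ a) w0 => w w0; field; rewrite gt_eqF.
Qed.

(** The weight at [x] is shared between the two factors by [weight_shift_exp], and [phi] supplies
    [3 * n] more powers for [decay]; the Riemann sums thus converge at a rate that itself decays in
    [x]. *)
Lemma decaying_product a phi psi : exists C : R, 0 <= C /\ forall x,
  decaying (C / (1 + `|x|) ^+ a) (fun z => complex.Re (phi z * psi (x - z))) /\
  decaying (C / (1 + `|x|) ^+ a) (fun z => complex.Im (phi z * psi (x - z))).
Proof.
have [c pc] := wbound_schwartz (a + 3 * n) 1 phi.
have [d pd] := wbound_schwartz a 1 psi.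
have c0 := wbound_ge0 pc; have d0 := wbound_ge0 pd.
pose A := 2 * n%:R * 2 ^+ (a + 3 * n) : R; pose B := 2 * n%:R * 2 ^+ a : R.
have A0 : 0 <= A by rewrite !mulr_ge0 ?exprn_ge0.
have B0 : 0 <= B by rewrite !mulr_ge0 ?exprn_ge0.
pose D := 2 ^+ (a + 3 * n) : R; have D0 : 0 <= D by rewrite exprn_ge0.
(* [1] accounts for the size of the product, [A] for the variation of [phi], and [B * D] for that of
   [psi] times the size of [phi] at the neighbouring point [z']. *)
pose C := c * d * (1 + A + B * D).
have C0 : 0 <= C by rewrite !mulr_ge0 ?addr_ge0 ?mulr_ge0.
exists C; split=> // x; have w0 : 0 < (1 + `|x|) ^+ a by rewrite exprn_gt0// weight_gt0.
have bnd z : normc (phi z * psi (x - z)) <= C / (1 + `|x|) ^+ a * decay z.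
  rewrite mulrAC ler_pdivlMr// mulrC Normc.normcM.
  apply: (@le_trans _ _ (((1 + `|z|) ^+ a * normc (phi z)) * ((1 + `|x - z|) ^+ a * normc (psi (x - z))))).
    by rewrite mulrACA ler_wpM2r ?mulr_ge0 ?normc_ge0// weight_shift_exp.
  apply: (@le_trans _ _ (c * decay z * d)).
    rewrite ler_pM ?mulr_ge0 ?weight_ge0 ?normc_ge0//; last exact: (pd [::]).
    exact: (wbound_decay (s := [::]) z pc).
  rewrite mulrAC ler_wpM2r ?(ltW (decay_gt0 _))// /C ler_peMr ?mulr_ge0//.
  by rewrite -addrA lerDl addr_ge0// mulr_ge0.
have lip z z' : `|z - z'| <= 1 ->
    normc (phi z * psi (x - z) - phi z' * psi (x - z')) <=
    C / (1 + `|x|) ^+ a * `|z - z'| * decay z.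
  move=> zz; have wz0 : 0 < (1 + `|z|) ^+ a by rewrite exprn_gt0// weight_gt0.
  have wz3 : 0 < (1 + `|z|) ^+ (3 * n) by rewrite exprn_gt0// weight_gt0.
  have e1 : (1 + `|z|) ^+ a * normc (phi z - phi z') <= A * c * `|z - z'| * decay z.
    apply: (@le_trans _ _ (A * c * `|z - z'| * (1 + `|z|) ^- (3 * n))).
      by rewrite ler_pdivlMr// mulrAC -exprD (schwartz_lipschitz (s := [::]) pc).
    by rewrite ler_wpM2l ?mulr_ge0// inv_weight_le_decay.
  have e2 : (1 + `|z|) ^+ a * normc (phi z') <= D * c * decay z.
    apply: (@le_trans _ _ (D * c * (1 + `|z|) ^- (3 * n))).
      rewrite ler_pdivlMr// mulrAC -exprD.
      apply: le_trans (ler_wpM2r (normc_ge0 _) (weight_near _ zz)) _.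
      by rewrite -mulrA ler_wpM2l//; exact: (pc [::]).
    by rewrite ler_wpM2l ?mulr_ge0// inv_weight_le_decay.
  have e3 : (1 + `|x - z|) ^+ a * normc (psi (x - z)) <= d by exact: (pd [::]).
  have e4 : (1 + `|x - z|) ^+ a * normc (psi (x - z) - psi (x - z')) <= B * d * `|z - z'|.
    have xz : `|x - z - (x - z')| = `|z - z'|.
      by rewrite opprB addrC subrKA distrC.
    by rewrite -xz (schwartz_lipschitz (s := [::]) pd)// xz.
  rewrite (_ : C / _ * _ * _ = C * `|z - z'| * decay z / (1 + `|x|) ^+ a); last by ring.
  rewrite ler_pdivlMr// mulrC.
  apply: le_trans (ler_wpM2r (normc_ge0 _) (weight_shift_exp a x z)) _.
  rewrite (_ : phi z * _ - _ = (phi z - phi z') * psi (x - z) +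
    phi z' * (psi (x - z) - psi (x - z'))); last by ring.
  apply: le_trans (ler_wpM2l _ (le_normcD _ _)) _; first by rewrite mulr_ge0 ?weight_ge0.
  rewrite !Normc.normcM mulrDr.
  apply: (@le_trans _ _ (A * c * `|z - z'| * decay z * d + D * c * decay z * (B * d * `|z - z'|))).
    by apply: lerD; rewrite mulrACA ler_pM ?mulr_ge0 ?weight_ge0 ?normc_ge0.
  rewrite (_ : _ + _ = c * d * (A + B * D) * `|z - z'| * decay z); last by ring.
  rewrite ler_wpM2r ?(ltW (decay_gt0 _))// ler_wpM2r// /C -addrA [1 + _]addrC.
  by rewrite ler_wpM2l ?mulr_ge0// lerDl.
split; split=> [z|z z' zz].
- exact: le_trans (normc_Re_le _) (bnd z).
- by rewrite -ReB; apply: le_trans (normc_Re_le _) (lip z z' zz).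
- exact: le_trans (normc_Im_le _) (bnd z).
- by rewrite -ImB; apply: le_trans (normc_Im_le _) (lip z z' zz).
Qed.

Lemma decaying_schwartz phi : exists C : R,
  decaying C (Rep phi) /\ decaying C (Imp phi).
Proof.
have [c pc] := wbound_schwartz (0 + 3 * n) 1 phi; have c0 := wbound_ge0 pc.
pose A := 2 * n%:R * 2 ^+ (0 + 3 * n) : R.
have A0 : 0 <= A by rewrite !mulr_ge0 ?exprn_ge0.
have bnd z : normc (phi z) <= (1 + A) * c * decay z.
  apply: (@le_trans _ _ (c * decay z)).
    by have := wbound_decay (s := [::]) z pc isT; rewrite expr0 mul1r.
  rewrite ler_wpM2r ?(ltW (decay_gt0 _))// mulrDl mul1r lerDl mulr_ge0//.
have lip z z' : `|z - z'| <= 1 ->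
    normc (phi z - phi z') <= (1 + A) * c * `|z - z'| * decay z.
  move=> zz; have wz3 : 0 < (1 + `|z|) ^+ (3 * n) by rewrite exprn_gt0// weight_gt0.
  apply: (@le_trans _ _ (A * c * `|z - z'| * (1 + `|z|) ^- (3 * n))).
    by rewrite ler_pdivlMr// mulrC (schwartz_lipschitz (s := [::]) pc).
  apply: ler_pM; rewrite ?inv_weight_le_decay ?mulr_ge0 ?invr_ge0 ?(ltW wz3)//.
  by do 2! apply: ler_wpM2r => //; rewrite lerDr.
exists ((1 + A) * c); split; split=> [z|z z' zz].
- exact: le_trans (normc_Re_le _) (bnd z).
- by rewrite /Rep -ReB; apply: le_trans (normc_Re_le _) (lip z z' zz).
- exact: le_trans (normc_Im_le _) (bnd z).
- by rewrite /Imp -ImB; apply: le_trans (normc_Im_le _) (lip z z' zz).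
Qed.

Lemma ReD (u v : R[i]) : complex.Re (u + v) = complex.Re u + complex.Re v.
Proof. by case: u; case: v. Qed.

Lemma ImD (u v : R[i]) : complex.Im (u + v) = complex.Im u + complex.Im v.
Proof. by case: u; case: v. Qed.

Lemma Re_riemann l (g : 'rV[R]_n -> R[i]) :
  complex.Re (\sum_(z <- grid R n l) (l%:R ^- n)%:C%C * g z) =
  riemann l (fun z => complex.Re (g z)).
Proof.
rewrite /riemann; elim/big_rec2: _ => // z u v _ <-; rewrite ReD; congr (_ + _).
by case: (g z) => a b /=; rewrite mul0r subr0.
Qed.

Lemma Im_riemann l (g : 'rV[R]_n -> R[i]) :
  complex.Im (\sum_(z <- grid R n l) (l%:R ^- n)%:C%C * g z) =
  riemann l (fun z => complex.Im (g z)).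
Proof.
rewrite /riemann; elim/big_rec2: _ => // z u v _ <-; rewrite ImD; congr (_ + _).
by case: (g z) => a b /=; rewrite mul0r addr0.
Qed.

Lemma inv_nat_small (K e : R) : 0 < e -> exists N, forall l, (N <= l)%N -> K / l.+1%:R <= e.
Proof.
move=> e0; exists (Num.truncn (`|K| / e)) => l Nl.
apply: (@le_trans _ _ (`|K| / l.+1%:R)); first by rewrite ler_wpM2r ?invr_ge0// ler_norm.
rewrite ler_pdivrMr ?ltr0n// mulrC -ler_pdivrMr//.
by apply: le_trans (ltW (truncnS_gt _)) _; rewrite ler_nat ltnS.
Qed.

Definition mass l phi : R[i] := \sum_(z <- grid R n l) (l%:R ^- n)%:C%C * phi z.

Lemma mass_tends phi (e : R) : 0 < e -> exists N, forall l, (N <= l)%N ->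
  normc (mass l.+1 phi - cintegral phi) <= e.
Proof.
move=> e0; have [C [dR dI]] := decaying_schwartz phi.
have [N NK] := inv_nat_small (C * riemann_rate R n) (divr_gt0 e0 (ltr0n _ 2)).
exists N => l Nl; apply: le_trans (normc_le_ReIm _) _.
rewrite ReB ImB Re_riemann Im_riemann [e]splitr; apply: lerD.
  exact: le_trans (riemann_rV_integral l dR) (NK l Nl).
exact: le_trans (riemann_rV_integral l dI) (NK l Nl).
Qed.

(** A Riemann sum of the convolution, sampled in [phi]: every derivative falls on a translate of
    [psi], and exchanging the arguments changes the sum. *)
Definition dconv l phi psi : S :=
  \sum_(z <- grid R n l) ((l%:R ^- n)%:C%C * phi z) *: rescale psi z 1.

Lemma pderivs_translate s psi z x : pderivs s (rescale psi z 1) x = pderivs s psi (x - z).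
Proof. by rewrite pderivs_rescale !expr1n !invr1 mulr1 scale1r mul1r. Qed.

Lemma pderivs_dconv s l phi psi x : pderivs s (dconv l phi psi) x =
  \sum_(z <- grid R n l) (l%:R ^- n)%:C%C * phi z * pderivs s psi (x - z).
Proof.
by rewrite pderivs_sum; apply: eq_bigr => z _; rewrite pderivs_translate.
Qed.

Lemma sum_grid_le l (F : 'rV[R]_n -> R) (C : R) : (0 < l)%N -> 0 <= C ->
  (forall z, F z <= C * decay z) -> \sum_(z <- grid R n l) l%:R ^- n * F z <= C * 4 ^+ n.
Proof.
move=> l0 C0 FC; apply: (@le_trans _ _ (C * riemann l (@decay R n))).
  rewrite /riemann mulr_sumr; apply: ler_sum => z _.
  by rewrite mulrCA ler_wpM2l ?invr_ge0 ?exprn_ge0.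
by rewrite ler_wpM2l// riemann_decay.
Qed.

Lemma wbound_dconv a b phi psi c d l : (0 < l)%N ->
  wbound (a + 3 * n) 0 phi c -> wbound a b psi d ->
  wbound a b (dconv l phi psi) (c * d * 4 ^+ n).
Proof.
move=> l0 pc pd s x sb; rewrite pderivs_dconv.
have c0 := wbound_ge0 pc; have d0 := wbound_ge0 pd.
apply: le_trans (ler_wpM2l (weight_ge0 _ _) (normc_sum _ _)) _.
rewrite mulr_sumr.
apply: (@le_trans _ _ (\sum_(z <- grid R n l) l%:R ^- n *
   ((1 + `|x|) ^+ a * (normc (phi z) * normc (pderivs s psi (x - z)))))).
  apply: ler_sum => z _; rewrite !Normc.normcM normc_real ger0_norm ?invr_ge0 ?exprn_ge0//.
  by rewrite -mulrA mulrCA.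
apply: sum_grid_le; rewrite ?mulr_ge0// => z.
apply: (@le_trans _ _ (((1 + `|z|) ^+ a * normc (phi z)) *
    ((1 + `|x - z|) ^+ a * normc (pderivs s psi (x - z))))).
  by rewrite mulrACA ler_wpM2r ?mulr_ge0 ?normc_ge0// weight_shift_exp.
rewrite [c * d * _]mulrAC ler_pM ?mulr_ge0 ?weight_ge0 ?normc_ge0//; last exact: (pd s _ sb).
exact: (wbound_decay (s := [::]) z pc).
Qed.

(** Both sums approach the same integral, since [rV_integral_reflect] exchanges [z] and [x - z]. *)
Lemma dconv_commute a phi psi : exists K : R, 0 <= K /\ forall l,
  wbound a 0 (dconv l.+1 phi psi - dconv l.+1 psi phi : S) (K / l.+1%:R).
Proof.
have [C [C0 dC]] := decaying_product a phi psi.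
have [C' [C'0 dC']] := decaying_product a psi phi.
pose K := 2 * (C + C') * riemann_rate R n.
have rr0 := riemann_rate_ge0 R n.
exists K; split; first by rewrite !mulr_ge0// addr_ge0.
move=> l s x; rewrite leqn0 size_eq0 => /eqP ->; rewrite pderivsB !pderivs_dconv /=.
have w0 : 0 < (1 + `|x|) ^+ a by rewrite exprn_gt0// weight_gt0.
under eq_bigr do rewrite -mulrA.
under [X in _ - X]eq_bigr do rewrite -mulrA.
have [dR dI] := dC x; have [dR' dI'] := dC' x.
have part (u v I B B' : R) : `|u - I| <= B * riemann_rate R n / l.+1%:R ->
    `|v - I| <= B' * riemann_rate R n / l.+1%:R ->
    `|u - v| <= (B + B') * riemann_rate R n / l.+1%:R.
  move=> h; rewrite distrC => h'; rewrite -(subrKA I) !mulrDl.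
  exact: le_trans (ler_normD _ _) (lerD h h').
rewrite -ler_pdivlMl//; apply: le_trans (normc_le_ReIm _) _.
rewrite ReB ImB !Re_riemann !Im_riemann.
have -> : ((1 + `|x|) ^+ a)^-1 * (K / l.+1%:R) =
  (C / (1 + `|x|) ^+ a + C' / (1 + `|x|) ^+ a) * riemann_rate R n / l.+1%:R +
  (C / (1 + `|x|) ^+ a + C' / (1 + `|x|) ^+ a) * riemann_rate R n / l.+1%:R.
  by rewrite /K; ring.
apply: lerD.
  apply: (part _ _ _ _ _ (riemann_rV_integral l dR)).
  have -> : rV_integral (fun z => complex.Re (phi z * psi (x - z))) =
      rV_integral (fun z => complex.Re (psi z * phi (x - z))).
    rewrite -(rV_integral_reflect x dR'); congr rV_integral.
    by apply/funext => z; rewrite subKr mulrC.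
  exact: riemann_rV_integral.
apply: (part _ _ _ _ _ (riemann_rV_integral l dI)).
have -> : rV_integral (fun z => complex.Im (phi z * psi (x - z))) =
    rV_integral (fun z => complex.Im (psi z * phi (x - z))).
  rewrite -(rV_integral_reflect x dI'); congr rV_integral.
  by apply/funext => z; rewrite subKr mulrC.
exact: riemann_rV_integral.
Qed.

(** A Landau-Kolmogorov inequality: the mean value theorem on a segment of length at most [tau]
    finds a point where the derivative is at most [2 A / tau], and second derivatives carry this to
    [x] at the cost [n tau B]. *)
Lemma derive_interpolation (g : 'rV[R]_n -> R) i x (tau A B : R) :
  (forall y, differentiable g y) ->
  (forall y, differentiable ('D_(delta_mx 0 i) g) y) -> 0 < tau <= 1 ->
  (forall y, `|y - x| <= 1 -> `|g y| <= A) ->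
  (forall j y, `|y - x| <= 1 -> `|'D_(delta_mx 0 j) ('D_(delta_mx 0 i) g) y| <= B) ->
  `|'D_(delta_mx 0 i) g x| <= 2 * A / tau + n%:R * tau * B.
Proof.
move=> dg ddg /andP[tau0 tau1] gA gB.
pose e : 'rV[R]_n := delta_mx 0 i.
have e1 : `|e| <= 1.
  apply: norm_le_coord => // j; rewrite /e mxE eqxx /=.
  by case: (_ == _); rewrite ?normr1 ?normr0.
have [t /andP[t0 t1]] := MVT_line x (tau *: e) dg.
have near (u : R) : 0 <= u <= 1 -> `|x + u *: (tau *: e) - x| <= 1.
  move=> /andP[u0 u1]; rewrite addrAC subrr add0r !normrZ !ger0_norm ?(ltW tau0)//.
  by rewrite mulr_ile1 ?mulr_ge0 ?(ltW tau0)// mulr_ile1 ?(ltW tau0).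
have -> : 'D_(tau *: e) g (x + t *: (tau *: e)) = tau * 'D_e g (x + t *: (tau *: e)).
  by rewrite !deriveE// linearZ.
move=> E.
have B0 : 0 <= B.
  by apply: le_trans (normr_ge0 _) (gB i x _); rewrite subrr normr0.
have D1 : `|'D_e g (x + t *: (tau *: e))| <= 2 * A / tau.
  rewrite ler_pdivlMr// mulrC -{1}(ger0_norm (ltW tau0)) -normrM -E mulr2n mulrDl mul1r.
  apply: le_trans (ler_normB _ _) _; apply: lerD; apply: gA.
    by have := near 1; rewrite scale1r; apply; rewrite ler01 lexx.
  by rewrite subrr normr0.
have D2 : `|'D_e g (x + t *: (tau *: e)) - 'D_e g x| <= n%:R * tau * B.
  have := @mean_value_le _ _ ('D_e g) x (t *: (tau *: e)) B ddg.
  move=> /(_ _)/le_trans; apply.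
    move=> j u /andP[u0 u1]; apply: gB; rewrite scalerA; apply: near.
    by rewrite mulr_ge0//= mulr_ile1.
  rewrite ler_wpM2r// ler_wpM2l// !normrZ !ger0_norm ?(ltW tau0)// mulrCA ler_piMr ?(ltW tau0)//.
  by rewrite mulr_ile1.
rewrite -[X in `|X|](subKr ('D_e g (x + t *: (tau *: e)))).
by apply: le_trans (ler_normB _ _) (lerD D1 D2).
Qed.

Lemma wbound_interpolation a b chi (tau c d : R) : 0 < tau <= 1 ->
  wbound a b chi c -> wbound a b.+2 chi d ->
  wbound a b.+1 chi (c + 2 * (2 * (2 ^+ a * c) / tau + n%:R * tau * (2 ^+ a * d))).
Proof.
move=> tau01 pc pd; have /andP[tau0 tau1] := tau01.
have c0 := wbound_ge0 pc; have d0 := wbound_ge0 pd.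
set X := 2 * (2 ^+ a * c) / tau + _.
have X0 : 0 <= X by rewrite /X addr_ge0 ?divr_ge0 ?mulr_ge0 ?exprn_ge0 ?(ltW tau0).
move=> s x; rewrite leq_eqVlt ltnS => /orP[|sb]; last first.
  by apply: le_trans (pc s x sb) _; rewrite lerDl mulr_ge0.
case: s => // i s sb; have {}sb : (size s <= b)%N by rewrite -ltnS -(eqP sb).
have w0 : 0 < (1 + `|x|) ^+ a by rewrite exprn_gt0// weight_gt0.
have sp := schwartz_fun_smooth chi.
have near y (u v : R) : `|y - x| <= 1 -> 0 <= u -> (1 + `|y|) ^+ a * u <= v ->
    u <= 2 ^+ a * v / (1 + `|x|) ^+ a.
  move=> yx u0 uv; rewrite ler_pdivlMr// mulrC.
  have := weight_near a (_ : `|x - y| <= 1); rewrite distrC => /(_ yx) h.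
  by apply: le_trans (ler_wpM2r u0 h) _; rewrite -mulrA ler_wpM2l ?exprn_ge0.
have gA y : `|y - x| <= 1 -> normc (pderivs s chi y) <= 2 ^+ a * c / (1 + `|x|) ^+ a.
  by move=> yx; apply: (near y) => //; [exact: normc_ge0|exact: pc].
have gB j y : `|y - x| <= 1 ->
    normc (pderivs (j :: i :: s) chi y) <= 2 ^+ a * d / (1 + `|x|) ^+ a.
  by move=> yx; apply: (near y) => //; [exact: normc_ge0|exact: pd].
have := @derive_interpolation (Rep (pderivs s chi)) i x tau _ _ _ _ tau01
  (fun y h => le_trans (normc_Re_le _) (gA y h))
  (fun j y h => le_trans (normc_Re_le (pderivs (j :: i :: s) chi y)) (gB j y h)).
move=> /(_ (fun y => proj1 (sp s y)) (fun y => proj1 (sp (i :: s) y))) hR.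
have := @derive_interpolation (Imp (pderivs s chi)) i x tau _ _ _ _ tau01
  (fun y h => le_trans (normc_Im_le _) (gA y h))
  (fun j y h => le_trans (normc_Im_le (pderivs (j :: i :: s) chi y)) (gB j y h)).
move=> /(_ (fun y => proj2 (sp s y)) (fun y => proj2 (sp (i :: s) y))) hI.
apply: (@le_trans _ _ (2 * X)); last by rewrite lerDr.
rewrite -ler_pdivlMl//; apply: le_trans (normc_le_ReIm _) _.
apply: le_trans (lerD hR hI) _.
by rewrite le_eqVlt; apply/orP; left; apply/eqP; rewrite /X; field; rewrite !gt_eqF.
Qed.

(** Order [b + 1] is interpolated between order [b], small by induction, and order [b + 2], which is
    merely bounded. *)
Lemma wbound_small a b (chi : nat -> S) :
  (forall b, exists d, forall l, wbound a b (chi l) d) ->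
  (forall e : R, 0 < e -> exists N, forall l, (N <= l)%N -> wbound a 0 (chi l) e) ->
  forall e : R, 0 < e -> exists N, forall l, (N <= l)%N -> wbound a b (chi l) e.
Proof.
move=> bnd small; elim: b => // b IH e e0.
have [d bd] := bnd b.+2; have d0 := wbound_ge0 (bd 0%N).
pose A : R := 2 ^+ a; have A0 : 0 < A by rewrite exprn_gt0.
(* [tau] is chosen first, through [D], so that the second-derivative term is at most [e / 2]; then
   [G] collects the factor of the lower order bound, and the induction hypothesis makes that term
   [e / 2]. *)
pose D := 4 * (n%:R * (A * d) + 1).
have nAd : 0 <= n%:R * (A * d) by rewrite !mulr_ge0// ltW.
have D0 : 0 < D by rewrite mulr_gt0// ltr_wpDl.
pose tau := Num.min 1 (e / D).
have tau0 : 0 < tau by rewrite lt_min ltr01 divr_gt0.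
have tau1 : tau <= 1 by rewrite ge_min lexx.
have tauD : tau * D <= e by rewrite -ler_pdivlMr// ge_min lexx orbT.
pose G := 1 + 4 * A / tau; have G0 : 0 < G by rewrite ltr_wpDr// divr_ge0 ?(ltW tau0) ?mulr_ge0 ?(ltW A0).
have [N hN] := IH (e / (2 * G)) (divr_gt0 e0 (mulr_gt0 (ltr0n _ 2) G0)).
exists N => l Nl; have := wbound_interpolation _ (hN l Nl) (bd l).
move=> /(_ tau); rewrite tau0 tau1 => /(_ isT); apply: wbound_le => //.
set c := e / _.
rewrite [leLHS](_ : _ = c * G + 2 * (n%:R * tau * (A * d))); last first.
  by rewrite /G /A; field; rewrite gt_eqF.
have -> : c * G = e / 2 by rewrite /c; field; rewrite gt_eqF.
have : 2 * (n%:R * tau * (A * d)) <= tau * D / 2.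
  have -> : tau * D / 2 = 2 * (n%:R * tau * (A * d)) + 2 * tau by rewrite /D; field.
  by rewrite lerDl mulr_ge0// ltW.
move: tauD; lra.
Qed.

(** Derivatives fall on [psi] in one sum and on [phi] in the other, so [dconv_commute] covers order
    0 only; interpolation with the bounds of [wbound_dconv], uniform in [l], replaces an integration
    by parts. *)
Lemma dconv_swap a b phi psi (e : R) : 0 < e -> exists N, forall l, (N <= l)%N ->
  wbound a b (dconv l.+1 phi psi - dconv l.+1 psi phi : S) e.
Proof.
apply: (@wbound_small a b (fun l => dconv l.+1 phi psi - dconv l.+1 psi phi)).
  move=> b'; have [c pc] := wbound_schwartz (a + 3 * n) b' phi.
  have [d pd] := wbound_schwartz (a + 3 * n) b' psi.
  exists (c * d * 4 ^+ n + d * c * 4 ^+ n) => l; apply: wboundB; apply: wbound_dconv => //;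
    [apply: wbound_le pc|apply: wbound_le pd|apply: wbound_le pd|apply: wbound_le pc] => //;
    exact: leq_addr.
move=> {}e e0; have [K [_ hK]] := dconv_commute a phi psi.
have [N hN] := inv_nat_small K e0.
by exists N => l Nl; apply: wbound_le (hK l) => //; exact: hN.
Qed.

End discrete_convolution.

(** * Decomposition of a test function over dyadic scales *)

Section multiscale.
Variables (R : realType) (n : nat).
Local Notation S := (schwartzType R n).
Implicit Types (psi chi phi : S) (x y z : 'rV[R]_n).

(* Riemann sum of the convolution of [psi] with the dilate of [phi] to scale [s]:
   a finite combination of the functions [rescale phi x s]. *)
Definition approximant phi s (I : seq (R[i] * 'rV[R]_n)) : S :=
  \sum_(p <- I) p.1 *: rescale phi p.2 s.

(* The same sum with the translations moved to [psi], which commutes with derivatives. *)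
Definition averaged l s phi psi : S :=
  \sum_(z <- grid R n l) ((l%:R ^- n)%:C%C * phi z) *: rescale psi (s *: z) 1.

Lemma pderivs_averaged w l s phi psi x : pderivs w (averaged l s phi psi) x =
  \sum_(z <- grid R n l) (l%:R ^- n)%:C%C * phi z * pderivs w psi (x - s *: z).
Proof.
by rewrite pderivs_sum; apply: eq_bigr => z _; rewrite pderivs_translate.
Qed.

Lemma rescale_sum (J : Type) (r : seq J) (k : J -> R[i]) (F : J -> S) x (y : R) :
  rescale (\sum_(j <- r) k j *: F j) x y = \sum_(j <- r) k j *: rescale (F j) x y.
Proof.
elim: r => [|j r IH]; last by rewrite !big_cons rescaleD rescaleZ IH.
by rewrite !big_nil -(scale0r (0 : S)) rescaleZ !scale0r.
Qed.

(** Seen at unit scale, [averaged] and the approximant of the next lemma are discrete convolutions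
    of the same two functions in opposite orders, which [dconv_swap] compares. *)
Lemma averaged_rescale l (s : R) phi psi : s != 0 ->
  averaged l s phi psi = rescale (dconv l phi (rescale psi 0 s^-1)) 0 s.
Proof.
move=> s0; rewrite rescale_sum; apply: eq_bigr => z _; congr (_ *: _).
rewrite rescale_comp ?oner_neq0// mulr1 add0r rescale_comp ?invr_eq0//.
by rewrite scaler0 addr0 mulfV.
Qed.

Lemma approximant_rescale l (s : R) phi psi : s != 0 ->
  approximant phi s [seq ((l%:R ^- n)%:C%C * rescale psi 0 s^-1 z, s *: z) | z <- grid R n l] =
  rescale (dconv l (rescale psi 0 s^-1) phi) 0 s.
Proof.
move=> s0; rewrite rescale_sum /approximant big_map; apply: eq_bigr => z _ /=.
by rewrite rescale_comp ?oner_neq0// mulr1 add0r.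
Qed.

(** [psi] minus its average is [1 - mass l phi] times [psi] plus an average of differences of [psi]
    at [x] and [x - s z]. The hypothesis on [e] covers both the crude bound on these and the bound
    by [s] times a derivative; the latter needs the weight [a.+1] in [z]. *)
Lemma averaged_error a b phi psi l (s c d e mu : R) : (0 < l)%N ->
  wbound (a.+1 + 3 * n) 0 phi d -> wbound a b psi c -> normc (1 - mass l phi) <= mu ->
  0 <= e ->
  (forall w x z, (size w <= b)%N -> (1 + `|x|) ^+ a *
     normc (pderivs w psi x - pderivs w psi (x - s *: z)) <= e * (1 + `|z|) ^+ a.+1) ->
  wbound a b (psi - averaged l s phi psi : S) (mu * c + e * d * 4 ^+ n).
Proof.
move=> l0 pd pc hmu e0 he w x wb.
have c0 := wbound_ge0 pc; have d0 := wbound_ge0 pd.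
rewrite pderivsB pderivs_averaged.
have -> : pderivs w psi x - \sum_(z <- grid R n l)
      (l%:R ^- n)%:C%C * phi z * pderivs w psi (x - s *: z) =
    (1 - mass l phi) * pderivs w psi x + \sum_(z <- grid R n l)
      (l%:R ^- n)%:C%C * phi z * (pderivs w psi x - pderivs w psi (x - s *: z)).
  under [X in _ = _ + X]eq_bigr do rewrite mulrBr.
  by rewrite sumrB -mulr_suml -/(mass l phi); ring.
apply: le_trans (ler_wpM2l (weight_ge0 _ _) (le_normcD _ _)) _.
rewrite mulrDr; apply: lerD.
  by rewrite Normc.normcM mulrCA ler_pM ?mulr_ge0 ?weight_ge0 ?normc_ge0 ?pc.
apply: le_trans (ler_wpM2l (weight_ge0 _ _) (normc_sum _ _)) _.
rewrite mulr_sumr.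
apply: (@le_trans _ _ (\sum_(z <- grid R n l) l%:R ^- n * (normc (phi z) *
   ((1 + `|x|) ^+ a * normc (pderivs w psi x - pderivs w psi (x - s *: z)))))).
  apply: ler_sum => z _; rewrite !Normc.normcM normc_real ger0_norm ?invr_ge0 ?exprn_ge0//.
  by rewrite -[l%:R ^- n * _ * _]mulrA mulrCA [(1 + _) ^+ a * (_ * _)]mulrCA.
apply: sum_grid_le; rewrite ?mulr_ge0// => z.
apply: le_trans (ler_wpM2l (normc_ge0 _) (he w x z wb)) _.
rewrite mulrCA -mulrA ler_wpM2l// mulrC.
exact: (wbound_decay (s := [::]) z pd).
Qed.

Lemma scale_norm_le (s : R) z : 0 <= s <= 1 -> `|s *: z| <= `|z|.
Proof. by move=> /andP[s0 s1]; rewrite normrZ ger0_norm// ler_piMl. Qed.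

Lemma weight_shift_scale a x z (s : R) : 0 <= s <= 1 ->
  (1 + `|x|) ^+ a <= (1 + `|z|) ^+ a * (1 + `|x - s *: z|) ^+ a.
Proof.
move=> s01; apply: le_trans (weight_shift_exp a x (s *: z)) _.
rewrite ler_wpM2r ?weight_ge0// lerXn2r ?nnegrE ?addr_ge0// lerD2l.
exact: scale_norm_le.
Qed.

Lemma translate_bound a b psi (s c : R) w x z : 0 <= s <= 1 -> wbound a b psi c ->
  (size w <= b)%N -> (1 + `|x|) ^+ a *
    normc (pderivs w psi x - pderivs w psi (x - s *: z)) <= 2 * c * (1 + `|z|) ^+ a.+1.
Proof.
move=> s01 pc wb; have c0 := wbound_ge0 pc.
apply: (@le_trans _ _ (2 * c * (1 + `|z|) ^+ a)); last first.
  by rewrite ler_wpM2l ?mulr_ge0// ler_weXn2l// weight_ge1.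
have z1 : 1 <= (1 + `|z|) ^+ a by rewrite exprn_ege1// weight_ge1.
rewrite [2 * c]mulr_natl mulr2n mulrDl.
apply: le_trans (ler_wpM2l (weight_ge0 _ _) (le_normcD _ _)) _.
rewrite normcN mulrDr; apply: lerD.
  by apply: le_trans (pc w x wb) _; rewrite ler_peMr.
apply: le_trans (ler_wpM2r (normc_ge0 _) (weight_shift_scale a x z s01)) _.
by rewrite -mulrA mulrC ler_wpM2r ?exprn_ge0 ?addr_ge0// pc.
Qed.

Lemma translate_lipschitz a b psi (s c : R) w x z : 0 <= s <= 1 -> wbound a b.+1 psi c ->
  (size w <= b)%N -> (1 + `|x|) ^+ a *
    normc (pderivs w psi x - pderivs w psi (x - s *: z)) <=
    2 * n%:R * s * c * (1 + `|z|) ^+ a.+1.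
Proof.
move=> /andP[s0 s1] pc wb; have c0 := wbound_ge0 pc.
have wx0 : 0 < (1 + `|x|) ^+ a by rewrite exprn_gt0// weight_gt0.
have wz0 : 0 < (1 + `|z|) ^+ a by rewrite exprn_gt0// weight_gt0.
have h : normc (pderivs w psi (x - s *: z) - pderivs w psi x) <=
    2 * (n%:R * `|- (s *: z)| * (c * (1 + `|z|) ^+ a / (1 + `|x|) ^+ a)).
  apply: cmean_value_le => [y|i t /andP[t0 t1]]; first exact: schwartz_fun_smooth.
  rewrite scalerN scalerA ler_pdivlMr// mulrC.
  have ts : 0 <= t * s <= 1 by rewrite mulr_ge0//= mulr_ile1.
  apply: le_trans (ler_wpM2r (normc_ge0 _) (weight_shift_scale a x z ts)) _.
  by rewrite -mulrA mulrC ler_wpM2r ?(ltW wz0)//; exact: (pc (i :: w)).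
rewrite -normcN opprB.
apply: le_trans (ler_wpM2l (ltW wx0) h) _.
rewrite normrN normrZ ger0_norm//.
rewrite [leLHS](_ : _ = 2 * n%:R * s * c * ((1 + `|z|) ^+ a * `|z|)); last first.
  by move: ((1 + `|x|) ^+ a) wx0 => u u0; field; rewrite gt_eqF.
by rewrite ler_wpM2l ?mulr_ge0// exprSr ler_wpM2l ?(ltW wz0)// lerDr.
Qed.

(** Since [1 + |s z| >= s (1 + |z|)], making the samples of [psi] at [s z] summable in [z] costs
    [s ^- (3 * n)]. *)
Lemma approximant_coefficients q a phi psi l (s c : R) : (0 < l)%N -> 0 < s <= 1 ->
  (q + 3 * n <= a)%N -> wbound a 0 psi c ->
  \sum_(p <- [seq ((l%:R ^- n)%:C%C * rescale psi 0 s^-1 z, s *: z) | z <- grid R n l])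
    normc p.1 * (1 + `|p.2|) ^+ q <= 4 ^+ n * c * s ^- (3 * n).
Proof.
move=> l0 /andP[s0 s1] qa pc; have c0 := wbound_ge0 pc.
rewrite big_map.
apply: (@le_trans _ _ (\sum_(z <- grid R n l) l%:R ^- n *
    (normc (psi (s *: z)) * (1 + `|s *: z|) ^+ q))).
  apply: ler_sum => z _; cbn [fst snd]; rewrite Normc.normcM normc_real -mulrA.
  rewrite ger0_norm ?invr_ge0 ?exprn_ge0// ler_wpM2l ?invr_ge0 ?exprn_ge0//.
  rewrite ler_wpM2r ?weight_ge0// [schwartz_fun _ _]/= subr0 invrK Normc.normcM normc_real.
  rewrite ger0_norm ?invr_ge0 ?exprn_ge0 ?invr_ge0 ?(ltW s0)// -exprVn invrK.
  by rewrite ler_piMl ?normc_ge0// exprn_ile1// ltW.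
rewrite -mulrA mulrC; apply: sum_grid_le => // [|z].
  by rewrite mulr_ge0// invr_ge0 exprn_ge0// ltW.
have w0 : 0 < (1 + `|s *: z|) ^+ (3 * n) by rewrite exprn_gt0// weight_gt0.
apply: (@le_trans _ _ (c * (1 + `|s *: z|) ^- (3 * n))).
  rewrite ler_pdivlMr// -mulrA -exprD mulrC.
  exact: (wbound_le qa (leqnn 0) (lexx c) pc (s := [::])).
rewrite -mulrA ler_wpM2l//; apply: le_trans (_ : _ <= s ^- (3 * n) * (1 + `|z|) ^- (3 * n)) _.
  rewrite -invfM -exprMn lef_pV2 ?posrE ?exprn_gt0 ?mulr_gt0 ?weight_gt0//.
  rewrite lerXn2r ?nnegrE ?mulr_ge0 ?addr_ge0 ?(ltW s0)//.
  by rewrite normrZ ger0_norm ?(ltW s0)// mulrDr mulr1 lerD2r.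
by rewrite ler_wpM2l ?inv_weight_le_decay// invr_ge0 exprn_ge0// ltW.
Qed.

(* One step of the decomposition: [C] depends neither on [psi] nor on the
   number [b] of derivatives. *)
Lemma approximation_step a phi : cintegral phi = 1 -> exists C : R, 1 <= C /\
  forall psi B (s delta : R), 0 < s <= 1 -> 0 < delta -> exists I,
  [/\ forall b c, (b <= B)%N -> wbound a b psi c ->
       wbound a b (psi - approximant phi s I : S) (C * c + delta),
     forall b c, (b <= B)%N -> wbound a b psi c -> wbound a b.+1 psi c ->
       wbound a b (psi - approximant phi s I : S) (C * s * c + delta) &
     forall q c, (q + 3 * n <= a)%N -> wbound a 0 psi c ->
       \sum_(p <- I) normc p.1 * (1 + `|p.2|) ^+ q <= C * c * s ^- (3 * n)].
Proof.
move=> phi1; have [d pd] := wbound_schwartz (a.+1 + 3 * n) 0 phi.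
have d0 := wbound_ge0 pd.
(* The middle term covers the crude bound [2 d 4 ^ n] and the Lipschitz bound [2 n d 4 ^ n], the
   last one the coefficients. Only the order 0 bound [d] of [phi] enters, whence the independence of
   [b]. *)
pose C := 1 + 2 * (n%:R + 1) * d * 4 ^+ n + 4 ^+ n.
have p4 : 0 <= 4 ^+ n :> R by rewrite exprn_ge0.
have X0 : 0 <= 2 * (n%:R + 1) * d * 4 ^+ n by rewrite !mulr_ge0.
exists C; split; first by rewrite /C -addrA lerDl addr_ge0.
move=> psi B s delta s01 delta0; have /andP[s0 s1] := s01.
have s01' : 0 <= s <= 1 by rewrite (ltW s0).
have [k pk] := wbound_schwartz a B psi; have k0 := wbound_ge0 pk.
(* The errors that depend on [psi], from the defect of the mass and from the exchange of roles, are
   made at most [delta / 2] each by refining the mesh, which keeps them out of [C]. *)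
pose mu := delta / 2 / (k + 1).
have k1 : 0 < k + 1 by rewrite ltr_wpDl.
have mu0 : 0 < mu by rewrite !divr_gt0.
have muk : mu * k <= delta / 2.
  by rewrite /mu mulrAC ler_pdivrMr// ler_wpM2l ?divr_ge0 ?(ltW delta0)// lerDl.
have [N1 hN1] := mass_tends phi mu0.
pose m := maxn a B; pose rf := rescale_factor m (0 : 'rV[R]_n) s.
have rf0 : 0 <= rf by exact: rescale_factor_ge0.
have [N2 hN2] := dconv_swap m m phi (rescale psi 0 s^-1)
  (divr_gt0 (divr_gt0 delta0 (ltr0n _ 2)) (ltr_wpDl rf0 ltr01)).
pose l := (maxn N1 N2).+1.
have hmu : normc (1 - mass l phi) <= mu.
  by rewrite -normcN opprB -phi1 hN1// leq_maxl.
pose I := [seq ((l%:R ^- n)%:C%C * rescale psi 0 s^-1 z, s *: z) | z <- grid R n l].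
have sw b : (b <= B)%N -> wbound a b (averaged l s phi psi - approximant phi s I : S) (delta / 2).
  move=> bB; rewrite averaged_rescale ?gt_eqF// approximant_rescale ?gt_eqF//.
  have -> : rescale (dconv l phi (rescale psi 0 s^-1)) 0 s -
      rescale (dconv l (rescale psi 0 s^-1) phi) 0 s =
      rescale (dconv l phi (rescale psi 0 s^-1) - dconv l (rescale psi 0 s^-1) phi) 0 s.
    by rewrite -[in RHS]scaleN1r rescaleD rescaleZ scaleN1r.
  have := wbound_rescale 0 s0 (hN2 _ (leq_maxr N1 N2)); rewrite -/rf.
  apply: wbound_le; rewrite ?leq_maxl//; first by rewrite leq_max bB orbT.
  by rewrite mulrA ler_pdivrMr ?ltr_wpDl// mulrC ler_wpM2l ?divr_ge0 ?(ltW delta0)// lerDl.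
have split b c e : (b <= B)%N -> wbound a b psi c -> 0 <= e ->
    (forall w x z, (size w <= b)%N -> (1 + `|x|) ^+ a *
     normc (pderivs w psi x - pderivs w psi (x - s *: z)) <= e * (1 + `|z|) ^+ a.+1) ->
    wbound a b (psi - approximant phi s I : S) (e * d * 4 ^+ n + delta).
  move=> bB pc e0 he.
  have pk' : wbound a b psi k by exact: wbound_le pk.
  have := wboundD (averaged_error (ltn0Sn _) pd pk' hmu e0 he) (sw b bB).
  rewrite subrKA; apply: wbound_le => //; move: muk; lra.
exists I; split=> [b c bB pc|b c bB pc pc'|q c qa pc].
- have c0 := wbound_ge0 pc.
  apply: wbound_le (split b c _ bB pc (mulr_ge0 (ler0n _ 2) c0) _) => //; last first.
    by move=> w x z wb; exact: (translate_bound x z s01' pc wb).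
  rewrite lerD2r (_ : C * c = 2 * c * d * 4 ^+ n +
    (2 * n%:R * d * 4 ^+ n + 1 + 4 ^+ n) * c); last by rewrite /C; ring.
  by rewrite lerDl mulr_ge0// addr_ge0// addr_ge0// !mulr_ge0.
- have c0 := wbound_ge0 pc.
  apply: wbound_le (split b c (2 * n%:R * s * c) bB pc _ _) => //; last 2 first.
  + by rewrite !mulr_ge0// ltW.
  + by move=> w x z wb; exact: (translate_lipschitz x z s01' pc' wb).
  rewrite lerD2r (_ : C * s * c = 2 * n%:R * s * c * d * 4 ^+ n +
    (2 * d * 4 ^+ n + 1 + 4 ^+ n) * (s * c)); last by rewrite /C; ring.
  by rewrite lerDl mulr_ge0 ?mulr_ge0 ?(ltW s0)// addr_ge0// addr_ge0// !mulr_ge0.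
- have c0 := wbound_ge0 pc.
  apply: le_trans (approximant_coefficients phi (ltn0Sn _) s01 qa pc) _.
  rewrite ler_wpM2r ?invr_ge0 ?exprn_ge0 ?(ltW s0)// ler_wpM2r//.
  by rewrite /C lerDr addr_ge0.
Qed.

Lemma seminorm_approximant (p : S -> R) q phi (s A : R) I : seminorm p ->
  (forall x, p (rescale phi x s) <= (1 + `|x|) ^+ q * A) ->
  p (approximant phi s I) <= (\sum_(i <- I) normc i.1 * (1 + `|i.2|) ^+ q) * A.
Proof.
move=> sp pA; have [pD pZ] := sp; rewrite /approximant.
elim: I => [|i I IH].
  by rewrite !big_nil mul0r -(scale0r (0 : S)) pZ Normc.normc0 mul0r.
rewrite !big_cons mulrDl; apply: le_trans (pD _ _) _; apply: lerD => //.
by rewrite pZ -mulrA ler_wpM2l ?normc_ge0.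
Qed.

(** [K] is the same for all [p]: the constant in [bounded_by] may depend on [p], as it only
    multiplies a remainder that tends to 0, while the terms of the series are bounded by the last
    hypothesis. *)
Lemma multiscale_bound q m phi : cintegral phi = 1 -> forall psi, exists K : R,
  forall p : S -> R, seminorm p -> (exists C, bounded_by m C p) ->
  (forall x s, 0 < s <= 1 -> p (rescale phi x s) <= (1 + `|x|) ^+ q * s ^- q) ->
  p psi <= K.
Proof.
move=> phi1 psi; pose a := maxn m (q + 3 * n).
have [C [C1 step]] := approximation_step a phi1.
have C0 : 0 <= C by apply: le_trans C1.
pose rho := C + 1; have rho1 : 1 <= rho by rewrite /rho lerDr.
have rho0 : 0 <= rho by apply: le_trans rho1.
pose h : R := 2^-1.
have h0 : 0 < h by rewrite invr_gt0.
have h1 : h <= 1 by rewrite invf_le1// ler1n.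
have hX (j : nat) : 0 < h ^+ j <= 1 by rewrite exprn_gt0//= exprn_ile1// ltW.
have h2 (j : nat) : h ^+ j * 2 ^+ j = 1 by rewrite -exprMn mulVf ?expr1n.
(* Bounds grow like [rho ^ j] if no derivative is spent and behave like [(rho h ^ M) ^ j] after [M]
   of them. The exponent pays [3 n] for the coefficients, [q] for the bound on [p], and 1 for a
   convergent geometric series. *)
have [M hM] : exists M, rho * h ^+ M <= h ^+ (3 * n + q + 1).
  pose M0 := Num.truncn rho; exists (M0.+1 + (3 * n + q + 1))%N.
  rewrite exprD mulrA ler_piMl ?(ltW (andP (hX _)).1)//.
  rewrite -(h2 M0.+1) mulrC ler_wpM2l ?(ltW (andP (hX _)).1)//.
  apply: le_trans (ltW (truncnS_gt _)) _.
  by rewrite -natrX ler_nat ltnW// ltn_expl.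
have dX j : 0 < (h ^+ M) ^+ j by rewrite exprn_gt0// (andP (hX _)).1.
(* The accuracy [h ^ (M j)] of step [j] lies below the rate [(rho h ^ i) ^ j] of every level
   [i <= M], so it is absorbed by the 1 in [rho = C + 1]. *)
have /choice[F FP] := fun jp : nat * S =>
  step jp.2 (m + M)%N (h ^+ jp.1) ((h ^+ M) ^+ jp.1) (hX _) (dX _).
pose ps := fix ps j := if j is j'.+1 then
  ps j' - approximant phi (h ^+ j') (F (j', ps j')) else psi.
have psS j : ps j.+1 = ps j - approximant phi (h ^+ j) (F (j, ps j)) by [].
have [k pk] := wbound_schwartz a (m + M) psi.
pose K0 := 1 + k; have K01 : 1 <= K0 by rewrite lerDl (wbound_ge0 pk).
have K00 : 0 <= K0 by apply: le_trans K01.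
have M1 i : 1 <= (2 ^+ M) ^+ i :> R by rewrite exprn_ege1// exprn_ege1// ler1n.
(* Spending the [i]-th derivative improves the rate by the Lipschitz estimate applied at level
   [i - 1]. The factor [(2 ^ M) ^ i] compensates the passage from [j] to [j + 1], where one more
   [h ^ i] is claimed than was gained. *)
have level i : (i <= M)%N -> forall j,
    wbound a (m + (M - i)) (ps j) (K0 * (2 ^+ M) ^+ i * (rho * h ^+ i) ^+ j).
  elim: i => [_|i IHi iM].
    elim=> [|j IHj].
      by rewrite subn0 !expr0 !mulr1; apply: wbound_le pk => //; rewrite lerDr.
    have [/(_ _ _ _ IHj)/(_ _)] := FP (j, ps j).
    rewrite subn0 leqnn => /(_ isT) st _ _; apply: wbound_le st => //.
    rewrite !expr0 !mulr1 exprS.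
    have : (h ^+ M) ^+ j <= K0 * rho ^+ j.
      apply: le_trans (_ : _ <= 1) _; last by rewrite mulr_ege1// exprn_ege1.
      by rewrite exprn_ile1 ?(ltW (andP (hX _)).1)// (andP (hX _)).2.
    have -> : K0 * (rho * rho ^+ j) = C * (K0 * rho ^+ j) + K0 * rho ^+ j.
      by rewrite {1}/rho; ring.
    by rewrite lerD2l.
  have {}IHi := IHi (ltnW iM).
  have r0 : 0 <= rho * h ^+ i.+1 by rewrite mulr_ge0// ltW// (andP (hX _)).1.
  case=> [|j].
    rewrite expr0 mulr1; apply: wbound_le pk => //.
      by rewrite leq_add2l leq_subr.
    by rewrite (le_trans (_ : k <= K0))// ?lerDr// ler_peMr.
  have e : (m + (M - i))%N = (m + (M - i.+1)).+1 by rewrite -addnS subnSK.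
  have bj1 := IHi j; rewrite e in bj1.
  have bj := wbound_le (leqnn a) (leqnSn _) (lexx _) bj1.
  have [_ /(_ _ _ _ bj bj1)/(_ _) st _] := FP (j, ps j).
  apply: wbound_le (st _) => //; last by rewrite leq_add2l leq_subr.
  set X := K0 * (2 ^+ M) ^+ i * (rho * h ^+ i.+1) ^+ j.
  have X0 : 0 <= X by rewrite !mulr_ge0 ?exprn_ge0.
  have -> : C * h ^+ j * (K0 * (2 ^+ M) ^+ i * (rho * h ^+ i) ^+ j) = C * X.
    rewrite /X; have -> : rho * h ^+ i.+1 = h * (rho * h ^+ i) by rewrite exprS; ring.
    by rewrite [(h * _) ^+ j]exprMn; ring.
  have dle : (h ^+ M) ^+ j <= X.
    rewrite /X; apply: (@le_trans _ _ ((rho * h ^+ i.+1) ^+ j)); last first.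
      by rewrite ler_peMl ?exprn_ge0// mulr_ege1.
    rewrite lerXn2r ?nnegrE ?(ltW (andP (hX _)).1)//.
    apply: (@le_trans _ _ (h ^+ i.+1)); last by rewrite ler_peMl ?(ltW (andP (hX _)).1).
    by rewrite ler_wiXn2l// ltW.
  apply: (@le_trans _ _ (rho * X)); first by rewrite /rho mulrDl mul1r lerD2l.
  rewrite (_ : K0 * _ * _ = (2 ^+ M * h ^+ i.+1) * (rho * X)); last first.
    rewrite /X; move: (h ^+ i.+1) => v; move: (2 ^+ M) => u.
    by rewrite [u ^+ i.+1]exprS [(rho * v) ^+ j.+1]exprS; ring.
  have Mh : 1 <= 2 ^+ M * h ^+ i.+1.
    rewrite -[leLHS](h2 i.+1) mulrC ler_wpM2r ?(ltW (andP (hX _)).1)//.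
    by rewrite ler_weXn2l// ler1n.
  by apply: ler_peMl => //; exact: mulr_ge0.
pose K1 := K0 * (2 ^+ M) ^+ M.
have K10 : 0 <= K1 by rewrite mulr_ge0// exprn_ge0// exprn_ge0.
pose theta := rho * h ^+ M.
have theta0 : 0 <= theta by rewrite mulr_ge0// ltW// (andP (hX _)).1.
have final j : wbound a m (ps j) (K1 * theta ^+ j).
  by have := level M (leqnn M) j; rewrite subnn addn0.
(* A bound for the sum of the terms [C * K1 * h ^+ j], fixed before [p] is introduced. *)
exists (2 * C * K1) => p sp [C' pC'] pphi.
have pstep j : p (ps j) <= p (ps j.+1) + C * K1 * h ^+ j.
  have -> : ps j = ps j.+1 + approximant phi (h ^+ j) (F (j, ps j)).
    by rewrite psS subrK.
  apply: le_trans (sp.1 _ _) _; rewrite lerD2l.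
  apply: le_trans (seminorm_approximant _ sp (fun x => pphi x _ (hX j))) _.
  have [_ _ /(_ q (K1 * theta ^+ j))] := FP (j, ps j).
  rewrite leq_maxr => /(_ isT (wbound_le (leqnn _) (leq0n _) (lexx _) (final j))) hs.
  have hq : 0 <= (h ^+ j) ^- q by rewrite invr_ge0 exprn_ge0// ltW// (andP (hX _)).1.
  apply: le_trans (ler_wpM2r hq hs) _.
  have hj0 : h ^+ j != 0 by rewrite gt_eqF// (andP (hX _)).1.
  have -> : C * (K1 * theta ^+ j) * (h ^+ j) ^- (3 * n) * (h ^+ j) ^- q =
      C * K1 * (theta ^+ j * (h ^+ j) ^- (3 * n + q)).
    by rewrite [(h ^+ j) ^+ (3 * n + q)]exprD invfM; ring.
  rewrite ler_wpM2l ?mulr_ge0// ler_pdivrMr ?exprn_gt0//.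
  apply: le_trans (lerXn2r j _ _ hM) _; rewrite ?nnegrE//.
    by rewrite exprn_ge0// ltW.
  by rewrite -exprM -exprM -exprD addn1 mulSn [(_ * j)%N]mulnC.
have psum J : p psi <= p (ps J) + \sum_(0 <= j < J) C * K1 * h ^+ j.
  elim: J => [|J IH]; first by rewrite big_geq// addr0.
  apply: le_trans IH _; rewrite big_nat_recr//; move: (\sum_(0 <= j < J) _) => sJ.
  rewrite (_ : _ + (sJ + _) = (p (ps J.+1) + C * K1 * h ^+ J) + sJ); last first.
    by rewrite addrCA addrC.
  by rewrite lerD2r; exact: pstep.
have geo J : \sum_(0 <= j < J) C * K1 * h ^+ j <= 2 * C * K1.
  rewrite -mulr_sumr (_ : 2 * C * K1 = C * K1 * 2); last by ring.
  rewrite ler_wpM2l ?mulr_ge0//.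
  have : \sum_(0 <= j < J) h ^+ j = 2 - 2 * h ^+ J.
    elim: J => [|J IH]; first by rewrite big_geq// expr0 mulr1 subrr.
    by rewrite big_nat_recr//= IH exprS /h; field.
  by move=> ->; rewrite gerBl mulr_ge0// ltW// (andP (hX _)).1.
(* The remainder: [C'] depends on [p], but [theta <= 1 / 2] drives [p (ps N)] below any [e]. *)
apply/ler_addgt0Pr => e e0.
have [N hN] := inv_nat_small (`|C'| * K1) e0.
apply: le_trans (psum N) _; rewrite addrC; apply: lerD => //.
apply: le_trans (pC' _ _ (wbound_le (leq_maxl _ _) (leqnn _) (lexx _) (final N))) _.
apply: le_trans (hN N (leqnn N)); rewrite mulrA.
apply: (@le_trans _ _ (`|C'| * K1 * theta ^+ N)).
  by rewrite ler_wpM2r ?exprn_ge0// ler_wpM2r// ler_norm.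
rewrite ler_wpM2l ?mulr_ge0//.
have thetah : theta <= h.
  by apply: le_trans hM _; rewrite addn1 exprS ler_piMr ?(ltW h0)// (andP (hX _)).2.
apply: le_trans (_ : _ <= h ^+ N) _; first by rewrite lerXn2r ?nnegrE// ltW.
rewrite /h exprVn lef_pV2 ?posrE ?exprn_gt0 ?ltr0n//.
by rewrite -natrX ler_nat ltn_expl.
Qed.

End multiscale.

(** * Dilations of Lebesgue measurable sets *)

Section lebesgue_scaling.
Variable R : realType.
Local Open Scope ereal_scope.
Local Notation lam := ((@wlength R idfun)^*)%mu.

Definition dilate (c : R) (X : set R) : set R := [set x | X (c * x)%R].

Lemma dilate_itv (c a b : R) : (0 < c)%R ->
  dilate c `]a, b] = `](c^-1 * a)%R, (c^-1 * b)%R]%classic.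
Proof.
move=> c0; apply/seteqP; split => x; rewrite /dilate/= !in_itv/=.
  by rewrite ltr_pdivrMl// ler_pdivlMl.
by rewrite ltr_pdivrMl// ler_pdivlMl.
Qed.

Lemma outer_measure_dilate_le c X : (0 < c)%R -> c%:E * lam (dilate c X) <= lam X.
Proof.
move=> c0; apply: le_ereal_inf_tmp => _ [F [mF XF] <-].
rewrite -lee_pdivlMl//.
have scale k : wlength idfun (dilate c (F k)) = (c^-1)%R%:E * wlength idfun (F k).
  have [[a b] _ <-] := mF k; rewrite dilate_itv// /= !wlength_itv /= !lte_fin.
  rewrite ltr_pM2l ?invr_gt0//; case: ifP => _; last by rewrite mule0.
  by rewrite -!EFinB -EFinM mulrBr.
apply: ereal_inf_lbound => /=; exists (fun k => dilate c (F k)).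
  split=> [k|x Xx]; last by have [k _ Fk] := XF _ Xx; exists k.
  have [[a b] _ <-] := mF k; rewrite dilate_itv//; exact: is_ocitv.
under eq_eseriesr do rewrite scale.
by rewrite nneseriesZl// => k _; exact: wlength_ge0.
Qed.

Lemma dilateK (c : R) X : c != 0%R -> dilate (c^-1)%R (dilate c X) = X.
Proof. by move=> c0; apply/seteqP; split => x; rewrite /dilate/= mulVKf. Qed.

Lemma outer_measure_dilate c X : (0 < c)%R -> lam X = c%:E * lam (dilate c X).
Proof.
move=> c0; apply/eqP; rewrite eq_le outer_measure_dilate_le// andbT.
rewrite -lee_pdivrMl//.
have := @outer_measure_dilate_le (c^-1)%R (dilate c X).
by rewrite invr_gt0 dilateK ?gt_eqF//; apply.
Qed.

(** Lebesgue sets are not stable under continuous preimages in general; for a dilation, both sides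
    of the Caratheodory criterion scale by the same factor. *)
Lemma measurable_dilate c (A : set (lebesgueR R)) : (0 < c)%R ->
  measurable A -> measurable (dilate c A : set (lebesgueR R)).
Proof.
move=> c0 mA; have {}mA : caratheodory_measurable lam A := mA.
suff : caratheodory_measurable lam (dilate c A) by [].
move=> X; have c0' : (c^-1)%R != 0%R by rewrite invr_eq0 gt_eqF.
have XE : X = dilate c (dilate (c^-1)%R X) by rewrite -{1}(invrK c) dilateK.
have dE Y : lam (dilate c Y) = (c^-1)%R%:E * lam Y.
  by rewrite [in RHS](outer_measure_dilate Y c0) muleA -EFinM mulVf ?mul1e// gt_eqF.
rewrite {1 2 3}XE.
have -> : dilate c (dilate (c^-1)%R X) `&` dilate c A = dilate c (dilate (c^-1)%R X `&` A) by [].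
have -> : dilate c (dilate (c^-1)%R X) `&` ~` dilate c A = dilate c (dilate (c^-1)%R X `&` ~` A) by [].
rewrite !dE -ge0_muleDr ?outer_measure_ge0//; congr (_ * _).
exact: mA.
Qed.

Lemma measurable_itv_lebesgue (i : interval R) : measurable ([set` i] : set (lebesgueR R)).
Proof.
apply: sub_caratheodory.
exact: (@measurable_itv R i).
Qed.

Lemma lebesgue_itv_cc (a b : R) : (a < b)%R -> lam `[a, b] = (b - a)%:E.
Proof.
move=> ab; have := @lebesgue_measure_itv R `[a, b]; rewrite /= lte_fin ab -EFinB => <-.
by [].
Qed.

End lebesgue_scaling.

(** * Uniform bounds for slowly varying functions *)

Section uniform_convergence.
Variable R : realType.
Local Notation lam := ((@wlength R idfun)^*)%mu.
Local Notation T := (lebesgueR R).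

Let mu : {measure set T -> \bar R} := @completed_lebesgue_measure R.

(** Every point lies in all late [P j], so the increasing sets [V k] exhaust [[a, b]] and their
    measures tend to its length. *)
Lemma eventually_large_measure (a b : R) (P : nat -> set R) : a < b ->
  (forall j, measurable (P j : set T)) ->
  (forall x, a <= x <= b -> exists N, forall j, (N <= j)%N -> P j x) ->
  forall e : R, 0 < e -> exists N, forall j, (N <= j)%N ->
    ((b - a - e)%:E < lam (`[a, b] `&` P j))%E.
Proof.
move=> ab mP Pev e e0.
have mab : measurable (`[a, b]%classic : set T) by exact: measurable_itv_lebesgue.
pose V k : set T := `[a, b] `&` \bigcap_(j >= k) P j.
have mV k : measurable (V k).
  by apply: measurableI => //; apply: bigcap_measurable => [|j _]; [by exists k => /=|exact: mP].
have ndV : nondecreasing_seq V.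
  move=> k k' kk'; apply/subsetPset => x [abx hx]; split=> // j /= kj; apply: hx => /=.
  exact: leq_trans kj.
have VE : \bigcup_k V k = `[a, b]%classic.
  apply/seteqP; split => [x [k _ []//]|x abx].
  have [|N hN] := Pev x; first by move: abx; rewrite /= in_itv.
  by exists N.
have := nondecreasing_cvg_mu (mu := mu) mV (bigcup_measurable (fun k _ => mV k)) ndV.
rewrite VE (_ : mu _ = (b - a)%:E); last exact: lebesgue_itv_cc.
have lt : ((b - a - e)%:E < (b - a)%:E)%E by rewrite lte_fin gtrDl oppr_lt0.
move=> /(_ _ (open_ereal_gt' lt))[N _ hN]; exists N => j /hN /= h.
apply: lt_le_trans h _; apply: le_outer_measure => x [abx h]; split => //.
by apply: h => /=.
Qed.

Definition comparable_within (c x y : R) := x <= c * y /\ y <= c * x.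

(* Csiszar-Erdos: the sets of ratios at which [L] is well behaved near [e j] and
   near [u j * e j] are eventually too large to be disjoint. *)
Lemma slow_variation_overlap (L : R -> R) (D : set T) (e u : nat -> R) :
  measurable D -> measurable_fun D L ->
  (forall j, 0 < e j) -> (forall j, 1 <= u j <= 2) ->
  (forall j a, 1 <= a <= 4 -> D (e j * a)) ->
  (forall a, 1 <= a <= 4 -> exists N, forall j, (N <= j)%N ->
     comparable_within 2 (L (e j * a)) (L (e j))) ->
  (forall b, 1 <= b <= 2 -> exists N, forall j, (N <= j)%N ->
     comparable_within 2 (L (u j * e j * b)) (L (u j * e j))) ->
  exists j, comparable_within 4 (L (u j * e j)) (L (e j)).
Proof.
move=> mD mL e0 u12 De Le Lu.
pose G (y : R) : set T := D `&` L @^-1` `[y / 2, 2 * y].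
have mG y : measurable (G y) by apply: mL => //; exact: measurable_itv.
have GP (y x : R) : D x -> comparable_within 2 (L x) y -> G y x.
  move=> Dx [h1 h2]; split=> //=; rewrite in_itv/= h1 andbT.
  by rewrite ler_pdivrMr// mulrC.
have GP' (y x : R) : G y x -> comparable_within 2 (L x) y.
  by move=> [_ /=]; rewrite in_itv/= ler_pdivrMr// => /andP[h1 h2]; split=> //; rewrite mulrC.
have u0 j : 0 < u j by have /andP[h _] := u12 j; apply: lt_le_trans h.
pose P j := dilate (e j) (G (L (e j))).
pose Q j := dilate (u j * e j) (G (L (u j * e j))).
have mP j : measurable (P j : set T) by exact: measurable_dilate.
have mQ j : measurable (Q j : set T) by apply: measurable_dilate; rewrite ?mulr_gt0.
have half0 : 0 < 2^-1 :> R by rewrite invr_gt0.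
have [N1 hN1] : exists N, forall j, (N <= j)%N ->
    ((4 - 1 - 2^-1)%:E < lam (`[1%R, 4%R] `&` P j))%E.
  apply: eventually_large_measure => //; first by rewrite ltr1n.
  move=> a a14; have [N hN] := Le a a14; exists N => j Nj.
  by apply: GP; [exact: De|exact: hN].
have [N2 hN2] : exists N, forall j, (N <= j)%N ->
    ((2 - 1 - 2^-1)%:E < lam (`[1%R, 2%R] `&` Q j))%E.
  apply: eventually_large_measure => //; first by rewrite ltr1n.
  move=> b b12; have [N hN] := Lu b b12; exists N => j Nj.
  apply: GP; last exact: hN.
  have /andP[b1 b2] := b12; have /andP[u1 u2] := u12 j.
  rewrite [u j * e j]mulrC -mulrA; apply: De.
  by apply/andP; split; nra.
pose k := maxn N1 N2; exists k.
pose V : set T := `[1, 4] `&` P k; pose W : set T := `[1, 2] `&` Q k.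
have mV : measurable V by apply: measurableI => //; exact: measurable_itv_lebesgue.
have mW : measurable W by apply: measurableI => //; exact: measurable_itv_lebesgue.
pose W' : set T := dilate (u k)^-1 W.
have uV0 : 0 < (u k)^-1 by rewrite invr_gt0.
have mW' : measurable W' by exact: measurable_dilate.
(* [V] has measure above [5 / 2], and [W'] above [1 / 2] since stretching by [u k >= 1] does not
   shrink [W]; both lie in [[1, 4]], of length 3. *)
have VW : exists x, V x /\ W' x.
  apply: contrapT => nVW.
  have dVW : V `&` W' = set0 by apply/seteqP; split => // x [Vx W'x]; apply: nVW; exists x.
  have lV : ((5 / 2)%:E < mu V)%E.
    have -> : 5 / 2 = 4 - 1 - 2^-1 :> R by field.
    by apply: hN1; exact: leq_maxl.
  have lW : ((1 / 2)%:E < mu W')%E.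
    apply: lt_le_trans (_ : (_ < lam W)%E) _.
      have -> : 1 / 2 = 2 - 1 - 2^-1 :> R by field.
      by apply: hN2; exact: leq_maxr.
    rewrite (outer_measure_dilate W uV0) gee_pMl ?outer_measure_ge0//.
    by rewrite lee_fin invf_le1 ?u0//; case/andP: (u12 k).
  have : (mu (V `|` W') <= (3 : R)%:E)%E.
    have <- : lam `[1, 4] = (3 : R)%:E.
      by rewrite lebesgue_itv_cc ?ltr1n//; congr EFin; ring.
    apply: le_outer_measure => x [[]//|].
    rewrite /W' /dilate /W /= !in_itv/= => -[+ _].
    have /andP[u1 u2] := u12 k.
    rewrite mulrC ler_pdivlMr// ler_pdivrMr// mul1r => /andP[xu ux].
    by apply/andP; split; [exact: le_trans xu|apply: le_trans ux _; nra].
  rewrite measureU// leNgt => /negP; apply.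
  have -> : (3 : R)%:E = ((5 / 2)%:E + (1 / 2)%:E)%E by rewrite -EFinD; congr EFin; field.
  by apply: lteD.
have [x [[_ Px] [_ Qx]]] := VW.
have {Px} [h1 h2] := GP' _ _ Px.
have {Qx} [h3 h4] := GP' _ _ Qx.
have ee : u k * e k * ((u k)^-1 * x) = e k * x.
  by field; rewrite gt_eqF.
rewrite ee in h3 h4; split; move: h1 h2 h3 h4; lra.
Qed.

(** Each doubling costs a factor 4, and the least [i] with [t <= 2 ^ i] has [4 ^ i <= 4 t ^ 2].
    Convexity of [D] keeps the chain of doublings in the domain. *)
Lemma potter_bound (L : R -> R) (D : R -> Prop) :
  (forall x y z, D x -> D z -> x <= y <= z -> D y) ->
  (forall x, D x -> 0 < x /\ 0 < L x) ->
  (forall e u, D e -> D (u * e) -> 1 <= u <= 2 -> comparable_within 4 (L (u * e)) (L e)) ->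
  forall e r t, D e -> D r -> r <= t * e -> e <= t * r -> L r <= 4 * t ^+ 2 * L e.
Proof.
move=> cD pD dbl.
have chain i : forall e r, D e -> D r -> e <= r -> r <= 2 ^+ i * e ->
    comparable_within (4 ^+ i) (L r) (L e).
  elim: i => [|i IH] e r De Dr er re.
    have -> : r = e by apply/eqP; rewrite eq_le er andbT; move: re; rewrite expr0 mul1r.
    by split; rewrite expr0 mul1r.
  have [e0 Le0] := pD _ De; have [r0 Lr0] := pD _ Dr.
  have p4 : 1 <= 4 ^+ i :> R by rewrite exprn_ege1// ler1n.
  have [r2|r2] := lerP r (2 * e).
    have rE : r / e * e = r by rewrite divfK// gt_eqF.
    have := dbl e (r / e) De; rewrite rE => /(_ Dr).
    rewrite ler_pdivlMr// mul1r er ler_pdivrMr// r2 => /(_ isT)[h1 h2].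
    split; rewrite exprS.
      by apply: le_trans h1 _; rewrite ler_wpM2r ?(ltW Le0)// ler_peMr.
    by apply: le_trans h2 _; rewrite ler_wpM2r ?(ltW Lr0)// ler_peMr.
  have e2r : e <= 2 * e <= r by rewrite (ltW r2) andbT; move: e0; lra.
  have D2 : D (2 * e) by exact: cD De Dr e2r.
  have [] := dbl e 2 De D2; first by rewrite lexx ler1n.
  move=> h1 h2; have [|h3 h4] := IH _ _ D2 Dr (ltW r2).
    by move: re; rewrite exprSr mulrA.
  split; rewrite exprS.
    by apply: le_trans h3 _; rewrite [4 * _]mulrC -mulrA ler_wpM2l ?(le_trans _ p4).
  apply: le_trans h2 _; rewrite -mulrA ler_wpM2l//.
have pow2 (t : R) : 1 <= t -> exists i, t <= 2 ^+ i /\ 4 ^+ i <= 4 * t ^+ 2 :> R.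
  move=> t1.
  have ex : exists i, t <= 2 ^+ i.
    exists (Num.truncn t).+1; apply: le_trans (ltW (truncnS_gt _)) _.
    by rewrite -natrX ler_nat ltnW// ltn_expl.
  case: (ex_minnP ex) => i ti imin; exists i; split=> //.
  case: i ti imin => [|i] ti imin; first by rewrite expr0; move: t1; nra.
  have lt : 2 ^+ i <= t.
    by rewrite leNgt; apply/negP => /ltW /imin; rewrite ltnn.
  have -> : 4 ^+ i.+1 = 4 * (2 ^+ i) ^+ 2 :> R.
    by rewrite exprS -exprM mulnC exprM; congr (_ * _ ^+ _); ring.
  by rewrite ler_wpM2l// lerXn2r ?nnegrE// (le_trans _ t1).
move=> e r t De Dr ret ert.
have [e0 Le0] := pD _ De; have [r0 Lr0] := pD _ Dr.
have t1 : 1 <= t.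
  rewrite leNgt; apply/negP => tlt.
  have : t * e < e by rewrite gtr_pMl.
  have : t * r < r by rewrite gtr_pMl.
  by move: ret ert; lra.
have [i [ti i4]] := pow2 t t1.
have [er|/ltW er] := lerP e r.
  have [h _] := chain i e r De Dr er (le_trans ret (ler_wpM2r (ltW e0) ti)).
  by apply: le_trans h _; rewrite ler_wpM2r// ltW.
have [_ h] := chain i r e Dr De er (le_trans ert (ler_wpM2r (ltW r0) ti)).
by apply: le_trans h _; rewrite ler_wpM2r// ltW.
Qed.

Lemma comparable_of_ratio (x y : R) : 0 < y -> `|1 - x / y| <= 2^-1 ->
  comparable_within 2 x y.
Proof.
move=> y0; rewrite ler_norml => /andP[h1 h2].
have hx : x = x / y * y by rewrite divfK// gt_eqF.
have half : 2 * 2^-1 = 1 :> R by rewrite mulfV.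
by split; rewrite {1}hx; move: h1 h2 y0; set q := x / y => *; nra.
Qed.

(** Potter's inequality with exponent 2, the form in which slow variation enters the Tauberian
    argument. *)
Definition slowly_comparable (L : R -> R) (D : R -> Prop) :=
  (forall x, D x -> 0 < x /\ 0 < L x) /\
  forall e r t, D e -> D r -> r <= t * e -> e <= t * r -> L r <= 4 * t ^+ 2 * L e.

(** Failure of the doubling bound on every []0, B]] yields points [e j -> 0] and ratios [u j] in
    [[1, 2]] violating it, which [slow_variation_overlap] excludes; [potter_bound] then reaches all
    ratios. *)
Lemma slowly_varying0_bound (L : R -> R) : slowly_varying0 L ->
  exists2 A : R, 0 < A & slowly_comparable L (fun e => 0 < e <= A).
Proof.
move=> [A A0 [mL L0 Ll]].
have cmp (a : R) : 0 < a -> exists2 d, 0 < d & forall e, 0 < e < d ->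
    comparable_within 2 (L (a * e)) (L e).
  move=> a0; have /cvgrPdist_le/(_ 2^-1) := Ll a a0.
  rewrite invr_gt0 ltr0n => /(_ isT)[d /= d0 hd].
  exists (Num.min d A); first by rewrite lt_min d0.
  move=> e; rewrite lt_min => /andP[e0 /andP[ed eA]].
  apply: comparable_of_ratio; first by rewrite L0// e0 ltW.
  by apply: hd => //=; rewrite sub0r normrN gtr0_norm.
have small (d : R) : 0 < d -> exists N, forall j, (N <= j)%N -> j.+1%:R^-1 < d.
  move=> d0; exists (Num.truncn d^-1) => j Nj; rewrite invf_plt ?posrE ?ltr0n//.
  by apply: lt_le_trans (truncnS_gt _) _; rewrite ler_nat ltnS.
have [B B0 hB] : exists2 B : R, 0 < B & forall e u : R, 0 < e <= B -> 1 <= u <= 2 ->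
    comparable_within 4 (L (u * e)) (L e).
  apply: contrapT => nB.
  have /choice[eu euP] : forall j : nat, exists p : R * R, [/\ 0 < p.1,
      p.1 <= A / 4, p.1 <= j.+1%:R^-1, 1 <= p.2 <= 2 &
      ~ comparable_within 4 (L (p.2 * p.1)) (L p.1)].
    move=> j; apply: contrapT => nj; apply: nB.
    (* [A / 4] keeps [e * a] in the domain for all ratios [a <= 4], and the other term drives the
       counterexamples to 0. *)
    exists (Num.min (A / 4) j.+1%:R^-1); first by rewrite lt_min divr_gt0//= invr_gt0 ltr0n.
    move=> e u; rewrite le_min => /andP[e0 /andP[eA ej]] u12.
    by apply: contrapT => h; apply: nj; exists (e, u).
  have [j] : exists j, comparable_within 4 (L ((eu j).2 * (eu j).1)) (L (eu j).1).
    apply: (@slow_variation_overlap L `]0, A] (fun j => (eu j).1) (fun j => (eu j).2)) => //.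
    - exact: measurable_itv_lebesgue.
    - by move=> j; have [] := euP j.
    - by move=> j; have [] := euP j.
    - move=> j a /andP[a1 a4]; have [e0 eA _ _ _] := euP j.
      by rewrite /= in_itv/=; apply/andP; split; [rewrite mulr_gt0//; lra|nra].
    - move=> a /andP[a1 a4]; have a0 : 0 < a by lra.
      have [d d0 hd] := cmp a a0; have [N hN] := small d d0.
      exists N => j Nj; have [e0 _ ej _ _] := euP j.
      by rewrite mulrC; apply: hd; rewrite e0 (le_lt_trans ej)// hN.
    - move=> a /andP[a1 a4]; have a0 : 0 < a by lra.
      have [d d0 hd] := cmp a a0; have [N hN] := small (d / 2) (divr_gt0 d0 (ltr0n _ 2)).
      exists N => j Nj; have [e0 _ ej /andP[u1 u2] _] := euP j.
      have := le_lt_trans ej (hN j Nj); rewrite ltr_pdivlMr// => ed.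
      rewrite mulrC; apply: hd; apply/andP; split; first by rewrite mulr_gt0//; lra.
      by apply: le_lt_trans ed; rewrite mulrC ler_pM2l.
  by have [_ _ _ _ nc] := euP j.
exists (Num.min A B); first by rewrite lt_min A0.
have pD (x : R) : 0 < x <= Num.min A B -> 0 < x /\ 0 < L x.
  by rewrite le_min => /andP[x0 /andP[xA _]]; split=> //; rewrite L0// x0.
split=> //; apply: potter_bound => //.
  move=> x y z /andP[x0 _] /andP[_ zA] /andP[xy yz].
  by rewrite (lt_le_trans x0 xy) (le_trans yz zA).
by move=> e u; rewrite le_min => /andP[e0 /andP[_ eB]] _ u12; apply: hB; rewrite ?e0.
Qed.

Lemma slowly_varyingy_bound (L : R -> R) : slowly_varyingy L ->
  exists2 A : R, 0 < A & slowly_comparable L (fun e => A <= e).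
Proof.
move=> [A A0 [mL L0 Ll]].
have cmp (a : R) : 0 < a -> exists2 d, 0 < d & forall e, d < e ->
    comparable_within 2 (L (a * e)) (L e).
  move=> a0; have /cvgrPdist_le/(_ 2^-1) := Ll a a0.
  rewrite invr_gt0 ltr0n => /(_ isT)[d /= [_ hd]].
  exists (Num.max d A); first by rewrite lt_max A0 orbT.
  move=> e; rewrite gt_max => /andP[de Ae].
  by apply: comparable_of_ratio; [rewrite L0// ltW|exact: hd].
have large (d : R) : exists N, forall j, (N <= j)%N -> d < j.+1%:R.
  exists (Num.truncn d) => j Nj.
  by apply: lt_le_trans (truncnS_gt _) _; rewrite ler_nat ltnS.
have [B B0 hB] : exists2 B : R, 0 < B & forall e u : R, B <= e -> 1 <= u <= 2 ->
    comparable_within 4 (L (u * e)) (L e).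
  apply: contrapT => nB.
  have /choice[eu euP] : forall j : nat, exists p : R * R, [/\
      A <= p.1, j.+1%:R <= p.1, 1 <= p.2 <= 2 &
      ~ comparable_within 4 (L (p.2 * p.1)) (L p.1)].
    move=> j; apply: contrapT => nj; apply: nB.
    exists (Num.max A j.+1%:R); first by rewrite lt_max A0.
    move=> e u; rewrite ge_max => /andP[eA ej] u12.
    by apply: contrapT => h; apply: nj; exists (e, u).
  have [j] : exists j, comparable_within 4 (L ((eu j).2 * (eu j).1)) (L (eu j).1).
    apply: (@slow_variation_overlap L `[A, +oo[ (fun j => (eu j).1) (fun j => (eu j).2)) => //.
    - exact: measurable_itv_lebesgue.
    - by move=> j; have [eA _ _ _] := euP j; apply: lt_le_trans eA.
    - by move=> j; have [] := euP j.
    - move=> j a /andP[a1 a4]; have [eA _ _ _] := euP j.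
      by rewrite /= in_itv/= andbT; nra.
    - move=> a /andP[a1 a4]; have a0 : 0 < a by lra.
      have [d d0 hd] := cmp a a0; have [N hN] := large d.
      exists N => j Nj; have [_ ej _ _] := euP j.
      by rewrite mulrC; apply: hd; apply: lt_le_trans (hN j Nj) ej.
    - move=> a /andP[a1 a4]; have a0 : 0 < a by lra.
      have [d d0 hd] := cmp a a0; have [N hN] := large d.
      exists N => j Nj; have [eA ej /andP[u1 u2] _] := euP j.
      have := lt_le_trans (hN j Nj) ej => ed.
      rewrite mulrC; apply: hd; apply: lt_le_trans ed _.
      by rewrite ler_peMl// (le_trans (ltW A0)).
  by have [_ _ _ nc] := euP j.
exists (Num.max A B); first by rewrite lt_max A0.
have pD (x : R) : Num.max A B <= x -> 0 < x /\ 0 < L x.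
  by rewrite ge_max => /andP[xA _]; split; [exact: lt_le_trans xA|rewrite L0].
split=> //; apply: potter_bound => //.
  by move=> x y z Ax _ /andP[xy _]; apply: le_trans xy.
by move=> e u; rewrite ge_max => /andP[_ eB] _ u12; apply: hB.
Qed.

End uniform_convergence.

(** * From bounds on the half sphere to weak bounds *)

Section tauberian.
Variables (R : realType) (n : nat) (E : completeNormedModType R[i]).
Local Notation S := (schwartzType R n).
Implicit Types (psi phi : S) (x : 'rV[R]_n) (e r s t : R).

Definition euclid x s : R := Num.sqrt (\sum_(i < n) x 0 i ^+ 2 + s ^+ 2).

Let sum_sqr_ge0 x : 0 <= \sum_(i < n) x 0 i ^+ 2.
Proof. by apply: sumr_ge0 => i _; exact: sqr_ge0. Qed.

Lemma euclid_sqr x s : euclid x s ^+ 2 = \sum_(i < n) x 0 i ^+ 2 + s ^+ 2.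
Proof. by rewrite sqr_sqrtr// addr_ge0 ?sqr_ge0. Qed.

Lemma euclid_ge x s : 0 < s -> s <= euclid x s /\ `|x| <= euclid x s.
Proof.
move=> s0; have r0 : 0 <= euclid x s by exact: sqrtr_ge0.
split.
  by rewrite -(ler_pXn2r (n := 2)) ?nnegrE ?(ltW s0)// euclid_sqr lerDr.
apply: norm_le_coord => // j.
rewrite -(ler_pXn2r (n := 2)) ?nnegrE// euclid_sqr real_normK ?num_real//.
rewrite (bigD1 j)//= -addrA lerDl addr_ge0 ?sqr_ge0//.
by apply: sumr_ge0 => i _; exact: sqr_ge0.
Qed.

Lemma euclid_le x s : 0 < s <= 1 -> euclid x s <= n.+1%:R * (1 + `|x|).
Proof.
move=> /andP[s0 s1]; have w1 := weight_ge1 x.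
rewrite -(ler_pXn2r (n := 2)) ?nnegrE ?sqrtr_ge0 ?mulr_ge0 ?(le_trans _ w1)//.
rewrite euclid_sqr; apply: (@le_trans _ _ (n.+1%:R * (1 + `|x|) ^+ 2)); last first.
  rewrite exprMn ler_wpM2r ?sqr_ge0// expr2 ler_peMr// ler1n//.
rewrite -natr1 mulrDl mul1r; apply: lerD.
  apply: (@le_trans _ _ (\sum_(i < n) (1 + `|x|) ^+ 2)).
    apply: ler_sum => i _; rewrite -real_normK ?num_real// lerXn2r ?nnegrE ?addr_ge0//.
    by apply: le_trans (coord_le_norm x i) _; rewrite lerDr.
  by rewrite sumr_const card_ord mulr_natl.
by rewrite lerXn2r ?nnegrE ?addr_ge0 ?(ltW s0)// (le_trans s1).
Qed.

Lemma half_sphere_normalize x s : 0 < s ->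
  half_sphere ((euclid x s)^-1 *: x, (euclid x s)^-1 * s).
Proof.
move=> s0; have [sr _] := euclid_ge x s0; have r0 := lt_le_trans s0 sr.
split => /=; last by rewrite mulr_gt0// invr_gt0.
under eq_bigr do rewrite mxE exprMn.
by rewrite -mulr_sumr exprMn -mulrDr -euclid_sqr -exprMn mulVf ?expr1n// gt_eqF.
Qed.

Variable f : {linear S -> E}.

(* Scaling along the ray through (x, s) moves the hypothesis on the half sphere
   at radius [e r] to the point (e x, e s); where [e r] leaves the range [V] of
   the hypothesis, continuity of [f] alone gives a polynomial bound. *)
Lemma weak_bound_of_transform_bound phi x0 (w : R -> R) (V W : set R) k (C : R) :
  cintegral phi = 1 -> continuous f ->
  (forall e, V e -> 0 < e /\ 0 < w e) -> W `<=` V ->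
  (forall e p, V e -> half_sphere p ->
     p.2 ^+ k / w e * rnorm (f (rescale phi (x0 + e *: p.1) (e * p.2))) <= C) ->
  (exists (K : R) a, forall e r t, W e -> V (e * r) -> 0 < r -> r <= t -> r^-1 <= t ->
     w (e * r) <= K * t ^+ a * w e) ->
  (exists (K : R) b, forall e x s r t, W e -> 0 < s <= 1 -> ~ V (e * r) ->
     `|x| <= r -> s <= r -> 1 <= t -> 1 + `|x| <= t -> r <= t -> s^-1 <= t ->
     [/\ 1 + `|x0 + e *: x| + e * s <= K * t ^+ b, (e * s)^-1 <= K * t ^+ b &
         (w e)^-1 <= K * t ^+ b]) ->
  forall psi, exists K : R, forall e, W e -> rnorm (f (rescale psi x0 e)) <= K * w e.
Proof.
move=> phi1 cf Vpos WV hC [K1 [a ratio]] [K2 [b far]] psi.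
have [m0 [C0 [C00 fC0]]] := continuous_bounded cf.
have [m [C1 [C10 fC1]]] := phi_transform_bound phi cf.
(* [k] undoes the weight on the half sphere and [a] is the price of changing the radius; in the far
   range the factors of [rescale_factor] have exponents [m], [n], [m], and one more power bounds the
   inverse of [w]. *)
pose q := (k + a + b * (m + n + m + 1))%N.
pose K3 := 1 + `|K2|; have K30 : 0 <= K3 by rewrite addr_ge0.
have K31 : 1 <= K3 by rewrite lerDl.
pose Z := `|C| * `|K1| + C1 * (K3 ^+ m * K3 ^+ n * (K3 *+ 2) ^+ m * K3) + 1.
have Z1 : 0 <= `|C| * `|K1| by rewrite mulr_ge0.
have Z2 : 0 <= C1 * (K3 ^+ m * K3 ^+ n * (K3 *+ 2) ^+ m * K3).
  by rewrite !mulr_ge0 ?exprn_ge0 ?mulrn_wge0// ltW.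
have Z0 : 0 < Z by rewrite /Z ltr_wpDl// addr_ge0.
(* [K] is fixed before [e]: the seminorms to which it applies share the order [m0], and only their
   domination constants depend on [e]. *)
have [K hK] := multiscale_bound q m0 phi1 psi.
have key e x s : W e -> 0 < s <= 1 ->
    rnorm (f (rescale phi (x0 + e *: x) (e * s))) / w e <=
    Z * (n.+1%:R * ((1 + `|x|) / s)) ^+ q.
  move=> We s01; have /andP[s0 s1] := s01; have [e0 we0] := Vpos _ (WV _ We).
  (* [t] dominates [1 + |x|], [1 / s] and [r], hence also [1 / r], so that every loss becomes a
     power of [t]. *)
  set r := euclid x s; set t := n.+1%:R * _.
  have [sr xr] := euclid_ge x s0; have r0 : 0 < r by exact: lt_le_trans sr.
  have n1 : 1 <= n.+1%:R :> R by rewrite ler1n.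
  have w1 := weight_ge1 x; have sV1 : 1 <= s^-1 by rewrite invf_ge1.
  have tx : 1 + `|x| <= t.
    rewrite /t; apply: (@le_trans _ _ ((1 + `|x|) / s)); first by rewrite ler_peMr// (le_trans _ w1).
    by rewrite ler_peMl// mulr_ge0 ?invr_ge0 ?(ltW s0)// (le_trans _ w1).
  have t1 : 1 <= t by exact: le_trans w1 tx.
  have ts : s^-1 <= t.
    rewrite /t; apply: (@le_trans _ _ ((1 + `|x|) / s)); first by rewrite ler_peMl// invr_ge0 ltW.
    by rewrite ler_peMl// mulr_ge0 ?invr_ge0 ?(ltW s0)// (le_trans _ w1).
  have tr : r <= t.
    apply: le_trans (euclid_le x s01) _; rewrite /t ler_wpM2l// ler_peMr// (le_trans _ w1)//.
  have tq j : (j <= q)%N -> t ^+ j <= t ^+ q by move=> jq; rewrite ler_weXn2l.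
  have t0 : 0 <= t by exact: le_trans t1.
  rewrite ler_pdivrMr//.
  have [Ver|nVer] := pselect (V (e * r)).
    have [er0 wer0] := Vpos _ Ver.
    have := hC _ _ Ver (half_sphere_normalize x s0); rewrite /= -/r.
    have e1 : e * r * r^-1 = e by rewrite mulfK// gt_eqF.
    have e2 : e * r * (r^-1 * s) = e * s by rewrite mulrA e1.
    rewrite scalerA e1 e2.
    set Y := rnorm _ => hY.
    have rs0 : 0 < (r^-1 * s) ^+ k by rewrite exprn_gt0// mulr_gt0// invr_gt0.
    have {hY} hY : Y <= `|C| * ((r / s) ^+ k * w (e * r)).
      apply: (@le_trans _ _ (C * ((r / s) ^+ k * w (e * r)))); last first.
        rewrite ler_wpM2r ?ler_norm// mulr_ge0 ?(ltW wer0)// exprn_ge0// divr_ge0 ?(ltW s0) ?(ltW r0)//.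
      have -> : (r / s) ^+ k = ((r^-1 * s) ^+ k)^-1.
        by rewrite -exprVn; congr (_ ^+ _); field; rewrite !gt_eqF.
      rewrite [_^-1 * w _]mulrC -ler_pdivrMr ?divr_gt0//.
      by rewrite invf_div mulrC.
    have rst : (r / s) ^+ k <= t ^+ k.
      rewrite lerXn2r ?nnegrE ?divr_ge0 ?(ltW s0) ?(ltW r0)//.
      rewrite /t mulrA; apply: ler_wpM2r (euclid_le x s01); rewrite invr_ge0 ltW//.
    have wr : w (e * r) <= `|K1| * t ^+ a * w e.
      apply: le_trans (ratio e r t We Ver r0 tr _) _.
        by apply: le_trans ts; rewrite lef_pV2.
      by rewrite ler_wpM2r ?(ltW we0)// ler_wpM2r ?exprn_ge0// ler_norm.
    apply: le_trans hY _.
    apply: (@le_trans _ _ (`|C| * (t ^+ k * (`|K1| * t ^+ a * w e)))).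
      rewrite ler_wpM2l// ler_pM ?exprn_ge0 ?divr_ge0 ?(ltW s0) ?(ltW r0) ?(ltW wer0)//.
    rewrite (_ : _ * (_ * _) = `|C| * `|K1| * t ^+ (k + a) * w e); last by rewrite exprD; ring.
    rewrite ler_wpM2r ?(ltW we0)// ler_pM ?exprn_ge0//.
      by rewrite /Z -addrA lerDl addr_ge0.
    by rewrite tq// leq_addr.
  have [h1 h2 h3] := far e x s r t We s01 nVer xr sr t1 tx tr ts.
  have T1 : 1 <= t ^+ b by rewrite exprn_ege1.
  have T0 : 0 <= t ^+ b by rewrite exprn_ge0.
  pose U := K3 * t ^+ b; have U1 : 1 <= U by rewrite mulr_ege1.
  have U0 : 0 <= U by exact: le_trans U1.
  have KU : K2 * t ^+ b <= U.
    by rewrite ler_wpM2r// (le_trans (ler_norm _))// lerDr.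
  have es0 : 0 < e * s by rewrite mulr_gt0.
  have fb : rnorm (f (rescale phi (x0 + e *: x) (e * s))) <=
      C1 * (U ^+ m * U ^+ n * (U *+ 2) ^+ m).
    apply: le_trans (fC1 _ _ es0) _; rewrite ler_wpM2l ?(ltW C10)// /rescale_factor.
    apply: ler_pM; rewrite ?exprn_ge0 ?mulr_ge0 ?invr_ge0 ?exprn_ge0 ?addr_ge0 ?invr_ge0 ?(ltW es0)//.
      apply: ler_pM; rewrite ?exprn_ge0 ?invr_ge0 ?exprn_ge0 ?addr_ge0 ?(ltW es0)//.
        by rewrite lerXn2r ?nnegrE ?addr_ge0 ?(ltW es0)// (le_trans h1).
      by rewrite -exprVn lerXn2r ?nnegrE ?invr_ge0 ?(ltW es0)// (le_trans h2).
    rewrite lerXn2r ?nnegrE ?addr_ge0 ?invr_ge0 ?mulrn_wge0 ?(ltW es0)//.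
    by rewrite mulr2n lerD// (le_trans h2).
  have wU : 1 <= U * w e by rewrite -ler_pdivrMr// mul1r (le_trans h3).
  apply: le_trans fb _.
  apply: (@le_trans _ _ (C1 * (U ^+ m * U ^+ n * (U *+ 2) ^+ m) * (U * w e))).
    by rewrite ler_peMr// !mulr_ge0 ?exprn_ge0 ?mulrn_wge0 ?(ltW C10).
  rewrite mulrA ler_wpM2r ?(ltW we0)//.
  have -> : C1 * (U ^+ m * U ^+ n * (U *+ 2) ^+ m) * U =
     C1 * (K3 ^+ m * K3 ^+ n * (K3 *+ 2) ^+ m * K3) * t ^+ (b * (m + n + m + 1)).
    rewrite /U -!mulrnAl [t ^+ (b * _)%N]exprM !exprD expr1 !exprMn; ring.
  rewrite ler_pM ?exprn_ge0//.
    by rewrite /Z [X in _ <= X + 1]addrC -addrA lerDl addr_ge0.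
  by rewrite tq// leq_addl.
pose Zn := Z * n.+1%:R ^+ q; have Zn0 : 0 < Zn by rewrite mulr_gt0// exprn_gt0// ltr0n.
exists (K * Zn) => e We; have [e0 we0] := Vpos _ (WV _ We).
have wZ0 : 0 < w e * Zn by rewrite mulr_gt0.
rewrite -mulrA [Zn * _]mulrC -ler_pdivrMr//.
apply: (hK (fun psi => rnorm (f (rescale psi x0 e)) / (w e * Zn))).
- exact/seminorm_pairing/ltW.
- exists (C0 * rescale_factor m0 x0 e / (w e * Zn)) => chi c cc.
  rewrite mulrAC ler_wpM2r ?invr_ge0 ?(ltW wZ0)// -mulrA.
  exact/fC0/wbound_rescale.
move=> x s s01; have /andP[s0 _] := s01.
rewrite rescale_comp ?gt_eqF// invfM mulrA ler_pdivrMr//.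
apply: le_trans (key e x s We s01) _.
by rewrite /Zn !exprMn exprVn [leLHS]mulrA [leLHS]mulrC.
Qed.

Lemma powR_le_pow (alpha r t : R) : 0 < r -> r <= t -> r^-1 <= t ->
  r `^ alpha <= t ^+ (Num.truncn `|alpha|).+1.
Proof.
move=> r0 rt rVt; set a := _.+1; have t0 : 0 < t by exact: lt_le_trans rt.
have t1 : 1 <= t.
  rewrite leNgt; apply/negP => tlt.
  have : 1 < r^-1 by rewrite invf_gt1// (le_lt_trans rt).
  by move: rVt; lra.
have aa : `|alpha| <= a%:R by rewrite ltW// truncnS_gt.
have pow_t (b : R) : 0 <= b -> b <= a%:R -> t `^ b <= t ^+ a.
  by move=> b0 ba; rewrite -powR_mulrn ?(ltW t0)//; exact: ler_powR.
have [a0|a0] := lerP 0 alpha.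
  apply: le_trans (pow_t alpha a0 _); last by rewrite (le_trans _ aa)// ler_norm.
  by apply: ge0_ler_powR; rewrite ?nnegrE ?(ltW r0) ?(ltW t0).
have -> : r `^ alpha = (r^-1) `^ (- alpha).
  by rewrite -powR_inv1 ?(ltW r0)// -powRrM mulN1r opprK.
apply: le_trans (pow_t (- alpha) _ _); last 2 first.
- by rewrite oppr_ge0 ltW.
- by rewrite (le_trans _ aa)// -normrN ler_norm.
by apply: ge0_ler_powR; rewrite ?nnegrE ?invr_ge0 ?(ltW r0) ?(ltW t0)// oppr_ge0 ltW.
Qed.

Section growth.
Variables (L : R -> R) (alpha : R) (D : R -> Prop).
Hypothesis LD : slowly_comparable L D.
Let w (e : R) := e `^ alpha * L e.
Let a := (Num.truncn `|alpha|).+1.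

Lemma growth_pos e : D e -> 0 < e /\ 0 < w e.
Proof.
by case: LD => pD _ /pD[e0 Le0]; split=> //; rewrite mulr_gt0// powR_gt0.
Qed.

Lemma growth_ratio e r t : D e -> D (e * r) -> 0 < r -> r <= t -> r^-1 <= t ->
  w (e * r) <= 4 * t ^+ (a + 2) * w e.
Proof.
case: LD => pD cL De Der r0 rt rVt; have [e0 Le0] := pD _ De; have [er0 Ler0] := pD _ Der.
have h1 : L (e * r) <= 4 * t ^+ 2 * L e.
  apply: cL => //; first by rewrite mulrC ler_wpM2r// ltW.
  by rewrite mulrCA ler_peMr ?(ltW e0)// -ler_pdivrMr// div1r.
have h2 := powR_le_pow alpha r0 rt rVt.
rewrite /w powRM ?(ltW e0) ?(ltW r0)//.
rewrite (_ : 4 * t ^+ (a + 2) * (e `^ alpha * L e) = (e `^ alpha * t ^+ a) * (4 * t ^+ 2 * L e)).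
  apply: ler_pM; rewrite ?mulr_ge0 ?powR_ge0 ?(ltW Ler0)//.
  by rewrite ler_wpM2l ?powR_ge0.
by rewrite exprD; ring.
Qed.

(** Potter's inequality between [e] and the reference point [A] bounds [L e] from below, hence the
    inverse of the growth function polynomially. *)
Lemma growth_inv A e u : D A -> D e -> e <= u -> e^-1 <= u -> A <= u * e -> e <= u * A ->
  (w e)^-1 <= 4 / L A * u ^+ (a + 2).
Proof.
case: LD => pD cL DA De eu eVu Aue euA; have [e0 Le0] := pD _ De; have [A0 LA0] := pD _ DA.
have h1 := cL e A u De DA Aue euA.
have h2 := @powR_le_pow (- alpha) e u e0 eu eVu; rewrite normrN -/a in h2.
rewrite /w invfM -powRN.
have h3 : (L e)^-1 <= 4 * u ^+ 2 / L A.
  by rewrite ler_pdivlMr// mulrC ler_pdivrMr.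
rewrite (_ : 4 / L A * u ^+ (a + 2) = u ^+ a * (4 * u ^+ 2 / L A)); last by rewrite exprD; ring.
by rewrite ler_pM ?powR_ge0// invr_ge0 ltW.
Qed.

End growth.

Section filters.
Variable F : set_system R.

Lemma limf_esup_lty (T : Type) (h : R -> T -> R) (P : set T) :
  (limf_esup (fun e => ereal_sup [set (h e p)%:E | p in P]) F < +oo)%E <->
  exists V (C : R), F V /\ forall e p, V e -> P p -> h e p <= C.
Proof.
split.
  move=> /ereal_inf_lt[_ [V FV <-] sup_lt].
  have ub e p : V e -> P p ->
      ((h e p)%:E <= ereal_sup ((fun e => ereal_sup [set (h e p)%:E | p in P]) @` V))%E.
    move=> Ve Pp; apply: (@le_trans _ _ (ereal_sup [set (h e p)%:E | p in P])).
      by apply: ereal_sup_ubound; exists p.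
    by apply: ereal_sup_ubound; exists e.
  move: sup_lt ub; case: ereal_sup => [C| |] // _ ub.
    by exists V, C; split=> // e p Ve Pp; have := ub e p Ve Pp; rewrite lee_fin.
  (* A supremum equal to -oo means that there is no pair [(e, p)], so any constant will do. *)
  by exists V, 0; split=> // e p Ve Pp; have := ub e p Ve Pp.
move=> [V [C [FV hC]]]; apply: le_lt_trans (ltry C).
apply: (@le_trans _ _ (ereal_sup ((fun e => ereal_sup [set (h e p)%:E | p in P]) @` V))).
  by apply: ereal_inf_lbound; exists V.
apply: ge_ereal_sup => _ [e Ve <-]; apply: ge_ereal_sup => _ [p Pp <-].
by rewrite lee_fin hC.
Qed.

End filters.

(** Treats both regimes at once: the [V N] form a countable decreasing base of the filter, the form
    that [banach_steinhaus] takes, and what distinguishes the origin from infinity is confined to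
    the far estimate assumed last. *)
Lemma transform_characterization phi x0 (F : set_system R) (FF : Filter F)
    (V : nat -> set R) (L : R -> R) (alpha : R) (D : R -> Prop) :
  cintegral phi = 1 -> continuous f ->
  slowly_comparable L D -> (forall N, V N `<=` D) -> (forall N M, (N <= M)%N -> V M `<=` V N) ->
  (forall N, F (V N)) -> (forall U, F U -> exists N, V N `<=` U) ->
  (forall N, exists M (K : R) b, (N <= M)%N /\ forall e x s r t, V M e -> 0 < s <= 1 ->
     ~ V N (e * r) -> `|x| <= r -> s <= r -> 1 <= t -> 1 + `|x| <= t -> r <= t ->
     s^-1 <= t ->
     [/\ 1 + `|x0 + e *: x| + e * s <= K * t ^+ b, (e * s)^-1 <= K * t ^+ b &
         (e `^ alpha * L e)^-1 <= K * t ^+ b]) ->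
  (forall psi, (fun e => rnorm (affine_pairing f x0 e psi)) =O_ (FilterType F FF)
     (fun e => e `^ alpha * L e)) <->
  exists k : nat, (limf_esup (fun e : R => ereal_sup
     [set (p.2 ^+ k / (e `^ alpha * L e) *
       rnorm (phi_transform phi f (x0 + e *: p.1) (e * p.2)))%:E
     | p in @half_sphere R n]) F < +oo)%E.
Proof.
move=> phi1 cf LD VD dV FV baseV far.
have pos e : D e -> 0 < e /\ 0 < e `^ alpha * L e by exact: growth_pos.
split.
  move=> fO.
  have [|N|psi|N [k [C h]]] := @transform_bound_of_weak_bound R n E f phi x0
    (fun e => e `^ alpha * L e) V cf.
  - by move=> e /VD; exact: pos.
  - exact: dV.
  - have /eqO_exP[c c0 /baseV[N hN]] := fO psi.
    exists (maxn N (Num.truncn c).+1) => e Ve.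
    have [e0 we0] := pos e (VD _ _ Ve).
    have := hN e (dV _ _ (leq_maxl _ _) _ Ve).
    rewrite /= ger0_norm ?rnorm_ge0// gtr0_norm// => h.
    rewrite ler_pdivrMr//; apply: le_trans h _; rewrite ler_wpM2r ?(ltW we0)//.
    apply: le_trans (ltW (truncnS_gt _)) _; rewrite ler_nat; exact: leq_maxr.
  - by exists k; apply/limf_esup_lty; exists (V N), C.
move=> [k /limf_esup_lty[U [C [/baseV[N NU] hC]]]] psi.
have [M [K [b [NM hfar]]]] := far N.
have [|||||K' hK'] := @weak_bound_of_transform_bound phi x0 (fun e => e `^ alpha * L e)
  (V N) (V M) k C phi1 cf _ _ _ _ _ psi.
- by move=> e /VD; exact: pos.
- exact: dV.
- by move=> e p /NU Ue hp; exact: hC.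
- exists 4, ((Num.truncn `|alpha|).+1 + 2)%N => e r t /VD De /VD Der.
  exact: (growth_ratio alpha LD De Der).
- by exists K, b.
apply/eqO_exP; exists (`|K'| + 1); first by rewrite ltr_wpDl.
apply: filterS (FV M) => e Ve; have [e0 we0] := pos e (VD _ _ Ve).
rewrite /= ger0_norm ?rnorm_ge0// (gtr0_norm we0).
apply: le_trans (hK' e Ve) _; rewrite ler_wpM2r ?(ltW we0)//.
by rewrite (le_trans (ler_norm _))// lerDl.
Qed.

End tauberian.

(** * Rays that leave the range of the hypothesis *)

Section two_regimes.
Variables (R : realType) (n : nat) (L : R -> R) (alpha A : R).
Implicit Types (x : 'rV[R]_n) (e s r t : R).
Let a := (Num.truncn `|alpha|).+1.

(** Leaving the range means [e r > B], so [1 / e < r / B <= t / B]: a small [e] forces a large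
    radius, and every quantity is polynomial in [t]. *)
Lemma far_bound0 x0 B : slowly_comparable L (fun e => 0 < e <= A) -> 0 < A ->
  0 < B <= 1 -> B <= A -> exists K : R, forall e x s r t, 0 < e <= B -> 0 < s <= 1 ->
    ~ 0 < e * r <= B -> s <= r -> 1 <= t -> 1 + `|x| <= t -> r <= t -> s^-1 <= t ->
    [/\ 1 + `|x0 + e *: x| + e * s <= K * t ^+ (a + 2), (e * s)^-1 <= K * t ^+ (a + 2) &
        (e `^ alpha * L e)^-1 <= K * t ^+ (a + 2)].
Proof.
move=> LD A0 /andP[B0 B1] BA.
have LA0 : 0 < L A by have [] := proj1 LD A; rewrite ?A0 ?lexx.
(* With this [c] the product [c t] dominates [e], [1 / e], [A / e] and [e / A] at once, as
   [growth_inv] asks of [u]. *)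
pose c := 1 + A / B + B^-1.
have AB0 : 0 <= A / B by rewrite divr_ge0 ?(ltW A0) ?(ltW B0).
have BV0 : 0 <= B^-1 by rewrite invr_ge0 ltW.
have c0 : 0 <= c by rewrite !addr_ge0.
pose K := (2 + `|x0|) + B^-1 + 4 / L A * c ^+ (a + 2).
have K30 : 0 <= 4 / L A * c ^+ (a + 2).
  by rewrite mulr_ge0 ?exprn_ge0 ?divr_ge0 ?(ltW LA0).
have Ks : [/\ 2 + `|x0| <= K, B^-1 <= K & 4 / L A * c ^+ (a + 2) <= K].
  by split; move: K30 BV0 (normr_ge0 x0); rewrite /K; lra.
have [K1 K2 K3] := Ks; exists K => e x s r t /andP[e0 eB] /andP[s0 s1] nV sr t1 xt rt st.
have r0 : 0 < r by exact: lt_le_trans sr.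
have erB : B < e * r.
  by rewrite ltNge; apply/negP => h; apply: nV; rewrite mulr_gt0.
have e1 : e <= 1 by exact: le_trans B1.
have eA : e <= A by exact: le_trans BA.
have eV : e^-1 <= B^-1 * t.
  have h : B / e <= t.
    by rewrite ler_pdivrMr// mulrC (le_trans (ltW erB))// ler_wpM2l// ltW.
  by rewrite -[e^-1](mulKf (x := B)) ?gt_eqF// ler_wpM2l.
have t0 : 0 <= t by exact: le_trans t1.
have tq j : (j <= a + 2)%N -> t ^+ j <= t ^+ (a + 2) by move=> ja; rewrite ler_weXn2l.
have tq0 : 0 <= t ^+ (a + 2) by rewrite exprn_ge0.
split.
- apply: (@le_trans _ _ ((2 + `|x0|) * t ^+ (a + 2))).
    have t1a := tq 1%N (leq_trans (leqnSn 1) (leq_addl _ _)); rewrite expr1 in t1a.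
    apply: le_trans (_ : _ <= (2 + `|x0|) * t) _; last by rewrite ler_wpM2l// addr_ge0.
    have h1 : `|x0 + e *: x| <= `|x0| + `|x|.
      apply: le_trans (ler_normD _ _) _; rewrite lerD2l normrZ gtr0_norm//.
      by rewrite ler_piMl.
    have h2 : e * s <= 1 by rewrite mulr_ile1// ltW.
    have h3 : `|x0| <= `|x0| * t by rewrite ler_peMr.
    by move: h1 h2 h3 xt t1 (normr_ge0 x); lra.
  by rewrite ler_wpM2r.
- apply: (@le_trans _ _ (B^-1 * t ^+ (a + 2))).
    rewrite invfM; apply: le_trans (_ : _ <= B^-1 * t * t) _.
      by rewrite ler_pM ?invr_ge0 ?(ltW e0) ?(ltW s0).
    by rewrite -mulrA -expr2 ler_wpM2l// tq// leq_addl.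
  by rewrite ler_wpM2r.
- have ct u : u <= c -> u * t <= c * t by move=> uc; rewrite ler_wpM2r.
  have h : (e `^ alpha * L e)^-1 <= 4 / L A * (c * t) ^+ (a + 2).
    apply: (@growth_inv R L alpha (fun e => 0 < e <= A)) => //.
    + by rewrite A0 lexx.
    + by rewrite e0.
    + apply: le_trans e1 _; rewrite -[leLHS]mulr1 ler_pM//.
      by rewrite /c -addrA lerDl addr_ge0.
    + by apply: le_trans eV (ct _ _); rewrite /c lerDr addr_ge0.
    + rewrite -ler_pdivrMr//; apply: (@le_trans _ _ (A / B * t)).
        by rewrite -mulrA ler_wpM2l// ltW.
      by apply: ct; rewrite /c addrAC lerDr addr_ge0.
    + apply: le_trans eA _; rewrite ler_peMl ?(ltW A0)// mulr_ege1//.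
      by rewrite /c -addrA lerDl addr_ge0.
  by apply: le_trans h _; rewrite exprMn mulrA ler_wpM2r.
Qed.

(** Leaving the range means [e r < B], so [e |x|] and [e s] stay below [B], while
    [e < B / r <= B / s <= B t]. *)
Lemma far_boundy B : slowly_comparable L (fun e => A <= e) -> 0 < A ->
  1 <= B -> A <= B -> exists K : R, forall e x s r t, B <= e -> 0 < s <= 1 ->
    ~ B <= e * r -> `|x| <= r -> s <= r -> 1 <= t -> s^-1 <= t ->
    [/\ 1 + `|0 + e *: x| + e * s <= K * t ^+ (a + 2), (e * s)^-1 <= K * t ^+ (a + 2) &
        (e `^ alpha * L e)^-1 <= K * t ^+ (a + 2)].
Proof.
move=> LD A0 B1 AB; have B0 : 0 < B by exact: lt_le_trans B1.
have LA0 : 0 < L A by have [] := proj1 LD A (lexx A).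
pose c := 1 + B + B / A.
have BA0 : 0 <= B / A by rewrite divr_ge0 ?(ltW A0) ?(ltW B0).
have c0 : 0 <= c by rewrite !addr_ge0// ltW.
have K30 : 0 <= 4 / L A * c ^+ (a + 2).
  by rewrite mulr_ge0 ?exprn_ge0 ?divr_ge0 ?(ltW LA0).
pose K := (1 + 2 * B) + 4 / L A * c ^+ (a + 2).
have Ks : [/\ 1 + 2 * B <= K, 1 <= K & 4 / L A * c ^+ (a + 2) <= K].
  by split; move: K30 B0; rewrite /K; lra.
have [K1 K2 K3] := Ks; exists K => e x s r t Be /andP[s0 s1] nV xr sr t1 st.
have r0 : 0 < r by exact: lt_le_trans sr.
have e1 : 1 <= e by exact: le_trans Be.
have e0 : 0 < e by exact: lt_le_trans e1.
have erB : e * r < B by rewrite ltNge; apply/negP.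
have t0 : 0 <= t by exact: le_trans t1.
have et : e <= B * t.
  apply: (@le_trans _ _ (B / s)); last by rewrite ler_wpM2l// ltW.
  by rewrite ler_pdivlMr// (le_trans _ (ltW erB))// ler_wpM2l// ltW.
have tq j : (j <= a + 2)%N -> t ^+ j <= t ^+ (a + 2) by move=> ja; rewrite ler_weXn2l.
have tq0 : 0 <= t ^+ (a + 2) by rewrite exprn_ge0.
have tq1 : 1 <= t ^+ (a + 2) by rewrite exprn_ege1.
have B20 : 0 <= 1 + 2 * B by rewrite addr_ge0// mulr_ge0// ltW.
split.
- apply: (@le_trans _ _ (1 + 2 * B)).
    have h1 : `|0 + e *: x| <= B.
      rewrite add0r normrZ gtr0_norm// (le_trans _ (ltW erB))// ler_wpM2l// ltW//.
    have h2 : e * s <= B by rewrite (le_trans _ (ltW erB))// ler_wpM2l// ltW.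
    by move: h1 h2; lra.
  by apply: le_trans K1 _; rewrite ler_peMr// (le_trans _ K2).
- apply: (@le_trans _ _ (1 * t ^+ (a + 2))).
    rewrite mul1r invfM; apply: le_trans (_ : _ <= s^-1) _.
      by rewrite ler_piMl ?invr_ge0 ?(ltW s0)// invf_le1.
    by apply: le_trans st _; have := tq 1%N (leq_trans (leqnSn 1) (leq_addl _ _)); rewrite expr1.
  by rewrite ler_wpM2r.
- have ct u : u <= c -> u * t <= c * t by move=> uc; rewrite ler_wpM2r.
  have ct1 : 1 <= c * t by rewrite mulr_ege1// /c -addrA lerDl addr_ge0// ltW.
  have h : (e `^ alpha * L e)^-1 <= 4 / L A * (c * t) ^+ (a + 2).
    apply: (@growth_inv R L alpha (fun e => A <= e)) => //.
    + exact: le_trans Be.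
    + by apply: le_trans et (ct _ _); rewrite /c addrAC lerDr addr_ge0.
    + by apply: le_trans ct1; rewrite invf_le1.
    + by apply: le_trans (le_trans AB Be) _; rewrite ler_peMl// ltW.
    + apply: le_trans et _; rewrite -ler_pdivrMr// mulrAC.
      by apply: ct; rewrite /c lerDr addr_ge0// ltW.
  by apply: le_trans h _; rewrite exprMn mulrA ler_wpM2r.
Qed.

End two_regimes.

Theorem theorem6p2 (R : realType) (n : nat) (E : completeNormedModType R[i])
    (phi : schwartzType R n) (phi_int : cintegral phi = 1)
    (f : {linear schwartzType R n -> E}) (f_cont : continuous f) (alpha : R) :
  (forall (L : R -> R) (x0 : 'rV[R]_n), slowly_varying0 L ->
    (weak_asymp_bounded0 f alpha x0 L <->
     exists k : nat,
       (limf_esup (fun e : R => ereal_sup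
          [set (p.2 ^+ k / (e `^ alpha * L e) *
                rnorm (phi_transform phi f (x0 + e *: p.1) (e * p.2)))%:E
          | p in @half_sphere R n]) 0^'+ < +oo)%E)) /\
  (forall L : R -> R, slowly_varyingy L ->
    (weak_asymp_boundedy f alpha L <->
     exists k : nat,
       (limf_esup (fun l : R => ereal_sup
          [set (p.2 ^+ k / (l `^ alpha * L l) *
                rnorm (phi_transform phi f (l *: p.1) (l * p.2)))%:E
          | p in @half_sphere R n]) +oo_R < +oo)%E)).
Proof.
split=> [L x0 sL|L sL].
- have [A A0 LD] := slowly_varying0_bound sL.
  (* The intervals []0, B N]] are a countable base at the origin, inside the domain of Potter's
     inequality and below 1, as [far_bound0] asks. *)
  pose B N := Num.min A N.+1%:R^-1.
  have B0 N : 0 < B N by rewrite lt_min A0 invr_gt0 ltr0n.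
  apply: (@transform_characterization R n E f phi x0 0^'+ _
    (fun N => [set e | 0 < e <= B N]) L alpha (fun e => 0 < e <= A) phi_int f_cont LD).
  + by move=> N e /andP[e0]; rewrite le_min => /andP[eA _]; rewrite e0.
  + move=> N M NM e /andP[e0 eB]; rewrite /= e0 (le_trans eB)//.
    rewrite le_min ge_min lexx /= ge_min; apply/orP; right.
    by rewrite lef_pV2 ?posrE ?ltr0n// ler_nat ltnS.
  + move=> N; exists (B N) => [|e /=]; [exact: B0|rewrite sub0r normrN => eB e0].
    by rewrite e0 -(gtr0_norm e0) ltW.
  + move=> U [d /= d0 hd]; exists (Num.truncn d^-1).+1 => e /= /andP[e0 eB].
    apply: hd => //=; rewrite sub0r normrN gtr0_norm//.
    apply: le_lt_trans eB _; rewrite gt_min; apply/orP; right.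
    rewrite invf_plt ?posrE ?ltr0n//; apply: lt_le_trans (truncnS_gt _) _.
    by rewrite ler_nat ltnW.
  move=> N; have [||K hK] := @far_bound0 R n L alpha A x0 (B N) LD A0.
  + by rewrite B0 ge_min invf_le1 ?ltr0n// ler1n orbT.
  + by rewrite ge_min lexx.
  exists N, K, ((Num.truncn `|alpha|).+1 + 2)%N; split=> [|e x s r t he hs nV xr sr t1 xt rt st].
    exact: leqnn.
  exact: (hK e x s r t).
- have [A A0 LD] := slowly_varyingy_bound sL.
  pose B N := Num.max A N.+1%:R.
  (* Dilations at infinity are centred at the origin; the summand 0 is the base point of the common
     form. *)
  have shift0 (k : nat) : (fun l : R => ereal_sup
        [set (p.2 ^+ k / (l `^ alpha * L l) *
              rnorm (phi_transform phi f (l *: p.1) (l * p.2)))%:E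
        | p in @half_sphere R n]) = (fun l : R => ereal_sup
        [set (p.2 ^+ k / (l `^ alpha * L l) *
              rnorm (phi_transform phi f (0 + l *: p.1) (l * p.2)))%:E
        | p in @half_sphere R n]).
    by apply/funext => l; congr ereal_sup; apply: eq_imagel => p _; rewrite add0r.
  under eq_exists do rewrite shift0.
  apply: (@transform_characterization R n E f phi 0 +oo_R _
    (fun N => [set e | B N <= e]) L alpha (fun e => A <= e) phi_int f_cont LD).
  + by move=> N e /=; rewrite ge_max => /andP[].
  + move=> N M NM e /= Be; apply: le_trans Be.
    by rewrite ge_max le_max lexx /= le_max ler_nat ltnS NM orbT.
  + move=> N; exists (B N); split; first exact: num_real.
    by move=> e /ltW.
  + move=> U [d [_ hd]]; exists (Num.truncn d) => e /= Be; apply: hd.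
    apply: lt_le_trans (truncnS_gt _) _; apply: le_trans Be.
    by rewrite le_max lexx orbT.
  + move=> N; have [||K hK] := @far_boundy R n L alpha A (B N) LD A0.
    * by rewrite le_max ler1n orbT.
    * by rewrite le_max lexx.
    exists N, K, ((Num.truncn `|alpha|).+1 + 2)%N; split=> [|e x s r t he hs nV xr sr t1 xt rt st].
      exact: leqnn.
    exact: (hK e x s r t).
Qed.
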